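(* Let $T$ be the torus with one boundary component (or one puncture), whose fundamental group is free on $a,b$, and write $A=a^{-1}$, $B=b^{-1}$. Let $\Phi$ denote the Euler totient function. (1) The number of elements of word length $\ell$ in the mapping class group orbit of the class $aabAB$ is $4\Phi(\ell-4)$. (2) The number of elements of word length $\ell$ in the mapping class group orbit of the class $abaB$ is $2\Phi(\ell/2)$ if $\ell$ is even and $0$ otherwise.
   Context: $T$ is the torus with one boundary component (or one puncture). A pair $(a,b)$ of generators of its fundamental group, a free group of rank two, is fixed, with inverses $A$ and $B$. A ''class'' is an unoriented free homotopy class of closed curves on $T$ that is not a proper power. Free homotopy classes of oriented closed curves correspond to conjugacy classes of the fundamental group, so a class is denoted by a cyclically reduced word in $\{a,b,A,B\}$ representing it, where a word and its inverse represent the same unoriented class. The word length of a class is the number of letters of the shortest word in $\{a,b,A,B\}$ representing it. The mapping class group is the group of connected components of the group of homeomorphisms of $T$, acting on the set of classes; the orbit of a class $\alpha$ is its orbit under this action. $\Phi$ is the Euler totient function, described as the number of positive integers smaller than $n$ and relatively prime to $n$. The statement gives no explicit range for $\ell$.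
   Formalization: Part (2) is proved for every length ℓ except 2 and 4, where the printed formula gives 2 but the true counts are 0 and 4 (abaB, babA, aabb, aaBB); Φ is the standard totient with Φ(1)=1, and Φ(ℓ−4) is read as 0 for ℓ≤4. *)

(* Defs.v *)
From HB Require Import structures.
From mathcomp Require Import all_boot all_order all_algebra.
From mathcomp Require Import all_classical all_reals.
From mathcomp Require Import topology normedtype.

Set Implicit Arguments.
Unset Strict Implicit.
Unset Printing Implicit Defensive.

Import Order.TTheory GRing.Theory Num.Theory.
Import numFieldNormedType.Exports.

Local Open Scope classical_set_scope.
Local Open Scope ring_scope.

Definition circle (R : realType) : set (R * R) :=
  [set z | z.1 ^+ 2 + z.2 ^+ 2 = 1].

Definition punctured_torus_set (R : realType) : set ((R * R) * (R * R)) :=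
  (@circle R `*` @circle R) `\ ((1, 0), (1, 0)).

(* [set_type] carries the subspace topology. *)
Definition ptorus (R : realType) : topologicalType :=
  set_type (@punctured_torus_set R).

Section Curves.
Context {R : realType}.
Notation T := (ptorus R).
Implicit Types (g d : R -> T) (C D : set (R -> T)).

(* A closed curve is a continuous map from R/Z, i.e. a 1-periodic one. *)
Definition closed_curve g := continuous g /\ forall t, g (t + 1) = g t.

Definition reverse g : R -> T := fun t => g (- t).

Definition power n g : R -> T := fun t => g (n%:R * t).

(* [H (s, _)] is the curve at time [s] in [0, 1]. *)
Definition is_homotopy (H : R * R -> T) g d :=
  [/\ {within `[0, 1]%classic `*` setT, continuous H},
      forall s t, 0 <= s <= 1 -> H (s, t + 1) = H (s, t),
      forall t, H (0, t) = g t
    & forall t, H (1, t) = d t].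

Definition freely_homotopic g d := exists H, is_homotopy H g d.

Definition proper_power g :=
  exists d n, [/\ closed_curve d, (1 < n)%N & freely_homotopic g (power n d)].

(* The unoriented free homotopy class of a closed curve. *)
Definition curve_class g : set (R -> T) :=
  [set d | closed_curve d /\
           (freely_homotopic g d \/ freely_homotopic g (reverse d))].

Definition classes : set (set (R -> T)) :=
  [set C | exists g, [/\ closed_curve g, ~ proper_power g & C = curve_class g]].

(* Orientation-reversing homeomorphisms are included. *)
Definition homeomorphisms : set {compact-open, T -> T} :=
  [set h | exists k : T -> T, [/\ continuous (h : T -> T), continuous k,
     cancel h k & cancel k h]].

Definition mapping_class_group : set (set {compact-open, T -> T}) :=
  [set connected_component homeomorphisms h | h in homeomorphisms].

(* A mapping class [M] acts on classes through any of its representatives; the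
   image of a class under composition with a homeomorphism is a full class. *)
Definition mcg_orbit C : set (set (R -> T)) :=
  [set D | classes D /\
     exists2 M, mapping_class_group M &
     exists2 h : T -> T, M h & D = [set h \o g | g in C]].

Definition based_loop (x : T) g := closed_curve g /\ g 0 = x.

Definition based_homotopic (x : T) g d :=
  exists2 H, is_homotopy H g d & forall s, 0 <= s <= 1 -> H (s, 0) = x.

(* [lA] and [lB] stand for the inverses of [la] and [lb]. *)
Inductive letter := la | lb | lA | lB.

Section Words.
Variables a b : R -> T.

Definition letter_curve (l : letter) : R -> T :=
  match l with
  | la => a
  | lb => b
  | lA => reverse a
  | lB => reverse b
  end.

(* On [k / n, (k + 1) / n], where [n] is the size of [w], the curve runs once
   along the [k]-th letter of [w]; the letters being 1-periodic, there is no
   need to shift the parameter by [k]. The empty word gives the constant curve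
   [a 0]. *)
Definition word_curve (w : seq letter) : R -> T := fun t =>
  let s := (size w)%:R * t in
  letter_curve (nth la w `|(Num.floor s %% (size w)%:Z)%Z|%N) s.

Definition generating_pair (x : T) :=
  [/\ based_loop x a, based_loop x b &
      forall g, based_loop x g ->
        exists w : seq letter, based_homotopic x g (word_curve w)].

Definition word_length C (l : nat) :=
  (exists2 w, C (word_curve w) & size w = l) /\
  (forall w, C (word_curve w) -> (l <= size w)%N).

(* The elements of word length [l] in the orbit of the class of [w]. *)
Definition orbit_of_length (w : seq letter) (l : nat) : set (set (R -> T)) :=
  [set D | mcg_orbit (curve_class (word_curve w)) D /\ word_length D l].

End Words.
End Curves.

(* Main.v *)
(* The arcs [z = 1] and [w = 1] cut the punctured torus into an open square, and
   reading off the crossings of a closed curve with them gives its holonomy, an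
   element of the free group F on two letters that is defined up to conjugacy
   and invariant under free homotopy. The holonomies of a generating pair
   generate F, so by Nielsen's theorem they form a basis; hence two closed
   curves are freely homotopic exactly when their holonomies are conjugate, and
   homeomorphisms act on holonomies by automorphisms. Conversely, the swap, the
   reflection and the shear [(z, w) |-> (z w, w)] realise generators of Aut F,
   so that an orbit of classes is an orbit of cyclic words under Aut F, taken
   up to inversion.
   For each coprime pair (m, n) of natural numbers, the Euclidean algorithm
   produces an element of the orbit out of the two positive twists a -> ab and
   b -> ab. Together with their images under the rotation a -> b, b -> A these
   elements exhaust the orbit. In the orbit of aabAB the element of slope
   (m, n) is represented by a positive word followed by AB, of length
   m + n + 4, in the orbit of abaB by a positive word of length 2 (m + n) (of
   length 4 if m + n = 1), and exponent sums tell slopes apart. *)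
From HB Require Import structures.
Require Import Defs.
From mathcomp Require Import all_boot all_order all_algebra.
From mathcomp Require Import all_classical all_reals.
From mathcomp Require Import topology normedtype realfun.
From mathcomp Require Import zify lra ring.

Set Implicit Arguments.
Unset Strict Implicit.
Unset Printing Implicit Defensive.

(** * The free group of rank two *)

Section FreeGroup.
Local Open Scope group_scope.

Definition leqb (l m : letter) : bool :=
  match l, m with
  | la, la | lb, lb | lA, lA | lB, lB => true
  | _, _ => false
  end.
Lemma leqbP : Equality.axiom leqb.
Proof. by case; case; constructor. Qed.
HB.instance Definition _ := hasDecEq.Build letter leqbP.

Definition letter_code (l : letter) : nat :=
  match l with la => 0 | lb => 1 | lA => 2 | lB => 3 end.
Definition letter_decode (n : nat) : letter :=
  match n with 0 => la | 1 => lb | 2 => lA | _ => lB end.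
Lemma letter_codeK : cancel letter_code letter_decode.
Proof. by case. Qed.
HB.instance Definition _ := CanIsCountable letter_codeK.

Definition linv (l : letter) : letter :=
  match l with la => lA | lb => lB | lA => la | lB => lb end.

Lemma linvK : involutive linv. Proof. by case. Qed.

Lemma linv_neq l : linv l != l.
Proof. by case: l. Qed.

Definition winv (w : seq letter) := rev (map linv w).

Lemma winvK : involutive winv.
Proof. by move=> w; rewrite /winv map_rev revK -map_comp (eq_map linvK) map_id. Qed.

Lemma winv_cons l w : winv (l :: w) = rcons (winv w) (linv l).
Proof. by rewrite /winv /= rev_cons. Qed.

Lemma size_winv w : size (winv w) = size w.
Proof. by rewrite size_rev size_map. Qed.

Definition compat (l m : letter) := m != linv l.
Definition reduced (w : seq letter) := sorted compat w.

Lemma compat_inv l m : compat (linv m) (linv l) = compat l m.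
Proof. by case: l; case: m. Qed.

Lemma reduced_cons2 l m w : reduced (l :: m :: w) = compat l m && reduced (m :: w).
Proof. by []. Qed.

Lemma reduced_tl l w : reduced (l :: w) -> reduced w.
Proof. exact: path_sorted. Qed.

Lemma reduced_winv w : reduced (winv w) = reduced w.
Proof.
rewrite /reduced /winv rev_sorted sorted_map; apply: eq_sorted => l m /=.
exact: compat_inv.
Qed.

Lemma reduced_cat u v : reduced (u ++ v) -> reduced u && reduced v.
Proof. by rewrite /reduced => /cat_sorted2[-> ->]. Qed.

Definition consr (l : letter) (w : seq letter) :=
  if w is m :: w' then if m == linv l then w' else l :: w else [:: l].

Definition red w := foldr consr [::] w.

Lemma consr_reduced l w : reduced w -> reduced (consr l w).
Proof.
case: w => [|m w] //= rw; case: eqP => [_|/eqP ne]; first exact: path_sorted rw.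
by rewrite /= /compat ne.
Qed.

Lemma foldr_consr_reduced v u : reduced v -> reduced (foldr consr v u).
Proof. by move=> rv; elim: u => //= l u; apply: consr_reduced. Qed.

Lemma consrK l w : reduced w -> consr (linv l) (consr l w) = w.
Proof.
case: w => [|m w] /=; first by rewrite linvK eqxx.
case: eqP => [->|_] rw /=; last by rewrite linvK eqxx.
case: w rw => [|k w] //=; rewrite /compat => /andP[] ne _.
by rewrite (negPf ne).
Qed.

Lemma foldr_consr_cat u v : reduced (u ++ v) -> foldr consr v u = u ++ v.
Proof.
elim: u => //= l u IH r; rewrite IH ?(reduced_tl r) //.
by case: (u ++ v) r => [|m w] //= /andP[]; rewrite /compat => /negPf ->.
Qed.

Lemma red_id w : reduced w -> red w = w.
Proof. by move=> rw; rewrite /red foldr_consr_cat cats0. Qed.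

Lemma red_reduced w : reduced (red w).
Proof. exact: foldr_consr_reduced. Qed.

Lemma foldr_consr_consr w l x : reduced w -> reduced x ->
  foldr consr w (consr l x) = consr l (foldr consr w x).
Proof.
move=> rw; case: x => [|m x] //= rx; case: eqP => [->|//].
by rewrite -[X in consr X (consr _ _)](linvK l) consrK ?foldr_consr_reduced.
Qed.

Record free2 := Free2 { fword :> seq letter; fwordP : reduced fword }.
HB.instance Definition _ := [isSub for fword].
HB.instance Definition _ := [Choice of free2 by <:].

Definition fone : free2 := @Free2 [::] isT.
Definition fmul (u v : free2) : free2 := Free2 (foldr_consr_reduced u (fwordP v)).
Lemma finv_proof (u : free2) : reduced (winv u).
Proof. by rewrite reduced_winv; case: u. Qed.
Definition finv (u : free2) : free2 := Free2 (finv_proof u).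

Lemma fmulA : associative fmul.
Proof.
move=> [u ru] [v rv] [w rw]; apply: val_inj => /=.
elim: u ru => //= l u IH r; rewrite IH ?(reduced_tl r) //.
by rewrite foldr_consr_consr // foldr_consr_reduced.
Qed.
Lemma fmul1 : left_id fone fmul. Proof. by move=> [u ru]; apply: val_inj. Qed.
Lemma fmulr1 : right_id fone fmul.
Proof. by move=> [u ru]; apply: val_inj => /=; exact: red_id. Qed.
Lemma fmulV : left_inverse fone finv fmul.
Proof.
move=> [u ru]; apply: val_inj => /=.
elim: u ru => //= l u IH r; rewrite winv_cons foldr_rcons /= linvK eqxx.
by rewrite IH ?(reduced_tl r).
Qed.
Lemma fmulVr : right_inverse fone finv fmul.
Proof.
move=> u; rewrite -[u in fmul u _](_ : finv (finv u) = u) ?fmulV //.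
by apply: val_inj; rewrite /= winvK.
Qed.
HB.instance Definition _ := isGroup.Build free2 fmulA fmul1 fmulr1 fmulV fmulVr.

Definition fw (w : seq letter) : free2 := Free2 (red_reduced w).

Lemma fwordK (x : free2) : fw x = x.
Proof. by apply: val_inj; rewrite /= red_id //; case: x. Qed.

Lemma fw_nil : fw [::] = 1. Proof. exact: val_inj. Qed.

Lemma fw_cat u v : fw (u ++ v) = fw u * fw v.
Proof.
apply: val_inj; rewrite /= /red foldr_cat -/(red v).
elim: u => //= l u ->.
by rewrite -/(red u) foldr_consr_consr ?red_reduced.
Qed.

Lemma fw_cons l w : fw (l :: w) = fw [:: l] * fw w.
Proof. by rewrite -cat1s fw_cat. Qed.

Lemma fw_linv l : fw [:: linv l] = (fw [:: l])^-1.
Proof. exact: val_inj. Qed.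

Lemma fw_winv w : fw (winv w) = (fw w)^-1.
Proof.
elim: w => [|l w IH]; first by rewrite fw_nil invg1.
by rewrite winv_cons -cats1 fw_cat IH fw_linv (fw_cons l w) invgM.
Qed.

Lemma fword_fw w : reduced w -> fw w = w :> seq letter.
Proof. exact: red_id. Qed.

Lemma size_foldr_consr u v : size (foldr consr v u) <= size u + size v.
Proof.
elim: u => //= l u IH; rewrite addSn; apply: leq_trans (_ : (size (foldr consr v u)).+1 <= _); last by [].
by case: (foldr _ _ _) => //= m w; case: eqP => //= _; rewrite leqW.
Qed.

Lemma size_fw w : size (fw w) <= size w.
Proof. by rewrite -[size w]addn0; exact: size_foldr_consr. Qed.

Lemma size_eq0_free2 (x : free2) : size x = 0 -> x = 1.
Proof. by move=> sx; apply: val_inj; apply: size0nil. Qed.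

Notation xa := (fw [:: la]).
Notation xb := (fw [:: lb]).

Section Eval.
Variable G : groupType.
Implicit Types u v : G.

Definition lval u v (l : letter) : G :=
  match l with la => u | lb => v | lA => u^-1 | lB => v^-1 end.
Definition ev u v (w : seq letter) : G := foldr (fun l g => lval u v l * g) 1 w.

Lemma lval_linv u v l : lval u v (linv l) = (lval u v l)^-1.
Proof. by case: l => //=; rewrite invgK. Qed.

Lemma ev_cat u v w w' : ev u v (w ++ w') = ev u v w * ev u v w'.
Proof. by elim: w => [|l w IH] /=; rewrite ?mul1g // IH mulgA. Qed.

Lemma ev_foldr u v w w' : ev u v (foldr consr w' w) = ev u v w * ev u v w'.
Proof.
elim: w => [|l w IH] /=; first by rewrite mul1g.
rewrite -mulgA -IH; case: (foldr _ _ _) => //= m x; case: eqP => //= ->.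
by rewrite lval_linv mulVKg.
Qed.

Lemma ev_fw u v w : ev u v (fw w) = ev u v w.
Proof. by rewrite /= /red ev_foldr /= mulg1. Qed.

Lemma evM u v (x y : free2) : ev u v (x * y) = ev u v x * ev u v y.
Proof. exact: ev_foldr. Qed.

Lemma evV u v (x : free2) : ev u v x^-1 = (ev u v x)^-1.
Proof. by apply: (@mulIg _ (ev u v x)); rewrite -evM !mulVg. Qed.

Lemma ev_conj u v c w : ev (u ^ c) (v ^ c) w = (ev u v w) ^ c.
Proof.
elim: w => [|l w IH] /=; first by rewrite conj1g.
by rewrite IH conjMg; congr (_ * _); case: l; rewrite //= -conjVg.
Qed.

End Eval.

Lemma ev_xab w : ev xa xb w = fw w.
Proof. by elim: w => [|l w IH]; rewrite ?fw_nil // (fw_cons l) /= IH; case: l. Qed.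

Lemma ev_ev (G : groupType) (u v : G) (p q : free2) w :
  ev u v (ev p q w) = ev (ev u v p) (ev u v q) w.
Proof. by elim: w => //= l w IH; rewrite evM IH; case: l => //=; rewrite evV. Qed.

Inductive elem := Esw | Einv | Elam.
Definition epair (e : elem) : free2 * free2 :=
  match e with
  | Esw => (xb, xa) | Einv => (xa^-1, xb) | Elam => (xa, xa * xb)
  end.
Definition act e (x : free2) : free2 := ev (epair e).1 (epair e).2 x.
Definition aut (es : seq elem) (x : free2) := foldr act x es.

Lemma ev_act (G : groupType) (u v : G) e x :
  ev u v (act e x) =
  match e with
  | Esw => ev v u x | Einv => ev u^-1 v x | Elam => ev u (u * v) x
  end.
Proof.
rewrite /act ev_ev.
by case: e; rewrite [epair _]/= ?evM ?evV ?ev_fw /= ?mulg1.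
Qed.

Lemma aut_cat es es' x : aut (es ++ es') x = aut es (aut es' x).
Proof. exact: foldr_cat. Qed.

Lemma autE es x : aut es x = ev (aut es xa) (aut es xb) x.
Proof.
elim: es x => [|e es IH] x /=; first by rewrite ev_xab fwordK.
by rewrite IH /act ev_ev.
Qed.

Lemma autM es x y : aut es (x * y) = aut es x * aut es y.
Proof. by rewrite autE evM -!autE. Qed.
Lemma autV es x : aut es x^-1 = (aut es x)^-1.
Proof. by rewrite autE evV -!autE. Qed.
Lemma aut1 es : aut es 1 = 1.
Proof. by rewrite autE. Qed.
Lemma autJ es x y : aut es (x ^ y) = aut es x ^ aut es y.
Proof. by rewrite /conjg !autM autV. Qed.
Lemma autX es x n : aut es (x ^+ n) = aut es x ^+ n.
Proof. by elim: n => [|n IH]; rewrite ?aut1 // !expgS autM IH. Qed.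

Lemma aut_ext es es' : aut es xa = aut es' xa -> aut es xb = aut es' xb ->
  aut es =1 aut es'.
Proof. by move=> ea eb x; rewrite autE ea eb -autE. Qed.

Definition einv (e : elem) := if e is Elam then [:: Einv; Elam; Einv] else [:: e].
Definition esinv es := flatten (map einv (rev es)).

Lemma einvK e : cancel (act e) (aut (einv e)).
Proof.
move=> x; rewrite -[act e x]/(aut [:: e] x) -aut_cat -[RHS]/(aut [::] x).
by apply: aut_ext; case: e; apply: val_inj.
Qed.

Lemma eKinv e : cancel (aut (einv e)) (act e).
Proof.
move=> x; rewrite -[act e _]/(aut [:: e] _) -aut_cat -[RHS]/(aut [::] x).
by apply: aut_ext; case: e; apply: val_inj.
Qed.

Lemma esinvK es : cancel (aut es) (aut (esinv es)).
Proof.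
elim: es => //= e es IH x; rewrite /esinv rev_cons map_rcons flatten_rcons.
by rewrite aut_cat einvK IH.
Qed.

Lemma esKinv es : cancel (aut (esinv es)) (aut es).
Proof.
elim: es => // e es IH x; rewrite /esinv rev_cons map_rcons flatten_rcons.
by rewrite aut_cat -cat1s aut_cat IH [LHS]eKinv.
Qed.

End FreeGroup.
Notation xa := (fw [:: la]).
Notation xb := (fw [:: lb]).

(** * Nielsen's theorem *)

Section Nielsen.
Local Open Scope group_scope.

Lemma reduced_cat_cons u l m v :
  reduced (rcons u l ++ m :: v) = [&& reduced (rcons u l), compat l m & reduced (m :: v)].
Proof.
by case: u => [|k u] //=; rewrite /reduced /= cat_path last_rcons.
Qed.

(* The length of the longest common prefix, that is the Gromov product at 1 in
   the Cayley tree. *)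
Fixpoint lcp (u v : seq letter) : nat :=
  match u, v with
  | l :: u', m :: v' => if l == m then (lcp u' v').+1 else 0
  | _, _ => 0
  end.

Lemma lcpC u v : lcp u v = lcp v u.
Proof. by elim: u v => [|l u IH] [|m v] //=; rewrite eq_sym IH. Qed.

Lemma lcp_ultra u v w : minn (lcp u v) (lcp v w) <= lcp u w.
Proof.
elim: u v w => [|l u IH] [|m v] [|k w] //=; rewrite ?minn0 ?min0n //.
case: eqP => [->|_]; last by rewrite min0n.
by case: eqP => // _; rewrite minnSS ltnS.
Qed.

Lemma lcp_take u v j : j <= lcp u v -> take j u = take j v.
Proof.
elim: j u v => [|j IH] [|l u] [|m v] //=; case: eqP => // -> lej.
by rewrite (IH u v).
Qed.

Lemma size_mulVg (x y : free2) : size (x^-1 * y) + 2 * lcp x y = size x + size y.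
Proof.
have [rx ry] := (fwordP x, fwordP y); rewrite /=.
elim: {x}(fword x) {y}(fword y) rx ry => [|l u IH] v ru rv /=; first by lia.
case: v rv => [|m v] rv.
  by rewrite -/(red (winv (l :: u))) red_id ?reduced_winv // size_winv /=; lia.
case: eqP => [elm|/eqP nelm].
  rewrite winv_cons foldr_rcons /= linvK elm eqxx /=.
  by have := IH v (reduced_tl ru) (reduced_tl rv); lia.
rewrite foldr_consr_cat; last first.
  rewrite winv_cons reduced_cat_cons rv -winv_cons reduced_winv ru /=.
  by rewrite /compat linvK eq_sym nelm.
by rewrite size_cat size_winv /=; lia.
Qed.

Lemma size_mulg (x y : free2) : size (x * y) + 2 * lcp x^-1 y = size x + size y.
Proof. by have := size_mulVg x^-1 y; rewrite invgK size_winv. Qed.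

Lemma lcp_square (x : free2) : x != 1 -> 2 * lcp x^-1 x < size x.
Proof.
move=> nx; rewrite ltnNge; apply/negP => hx.
have sx : 0 < size x by rewrite lt0n; apply: contra nx => /eqP/size_eq0_free2->.
pose k := (size x).-1./2.
have e := odd_double_half (size x).-1.
have kl : k < lcp x^-1 x by rewrite /k; lia.
have kx : k < size x by rewrite /k; lia.
have : nth la (winv x) k = nth la x k.
  by rewrite -(nth_take _ kl) (lcp_take (leqnn _)) nth_take.
rewrite nth_rev ?size_map // (nth_map la); last by lia.
case od: (odd (size x).-1) e => e.
  have -> : size x - k.+1 = k.+1 by rewrite /k; lia.
  move=> ek; have rx : reduced x := fwordP x.
  have /(sortedP la)/(_ k) := rx; rewrite -ek /compat linvK eqxx.
  by move=> /(_ _)/negP; apply => //; rewrite /k; lia.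
have -> : size x - k.+1 = k by rewrite /k; lia.
by move/eqP; rewrite (negPf (linv_neq _)).
Qed.

Section Reduced.
Variables u v : free2.
Local Notation lv := (lval u v).
Local Notation c l m := (lcp (lv l)^-1 (lv m)).
Hypothesis lv1 : forall l, 0 < size (lv l).
Hypothesis N1 : forall l m, compat l m -> 2 * c l m <= size (lv l) /\ 2 * c l m <= size (lv m).
Hypothesis N2 : forall l m k, compat l m -> compat m k -> c l m + c m k < size (lv m).

Lemma lcp_ev l m w : reduced [:: l, m & w] -> lcp (lv l)^-1 (ev u v (m :: w)) = c l m.
Proof.
elim: w l m => [|k w IH] l m; first by rewrite [ev _ _ _]mulg1.
case/andP=> lm r; have em := IH m k r; have /andP[mk _] := r.
change (ev u v [:: m, k & w]) with (lv m * ev u v (k :: w)).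
move: (ev u v (k :: w)) em => g em.
have := size_mulg (lv m) g; rewrite em => e1.
have := size_mulVg (lv m) (lv m * g); rewrite mulKg => e2.
have := N2 lm mk => n2.
have := lcp_ultra (lv l)^-1 (lv m) (lv m * g).
have := lcp_ultra (lv l)^-1 (lv m * g) (lv m).
rewrite (lcpC (lv m * g) (lv m)).
have ar smg A sm sg B C L : (smg + 2 * A = sm + sg -> sg + 2 * B = sm + smg ->
  C + A < sm -> minn L B <= C -> minn C B <= L -> L = C)%N by lia.
exact: (ar _ _ _ _ _ _ _ e1 e2 n2).
Qed.

Lemma size_ev l w : reduced (l :: w) -> size w < size (ev u v (l :: w)).
Proof.
move=> r; suff [] : size w < size (ev u v (l :: w)) /\ (if w is m :: _ then size w + size (lv l)
   <= size (ev u v (l :: w)) + c l m else true) by [].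
elim: w l r => [|m w IH] l r; first by rewrite [ev _ _ _]mulg1; split=> //; exact: lv1.
have lm : compat l m by case/andP: r.
have [IH1 IH2] := IH _ (reduced_tl r).
have es : (size (ev u v [:: l, m & w]) + 2 * c l m = size (lv l) + size (ev u v (m :: w)))%N.
  by rewrite -(lcp_ev r) -size_mulg.
have [n1 n1'] := N1 lm; have l1 := lv1 l; have m1 := lv1 m.
have ar n s s' sl C : (s + 2 * C = sl + s' -> n + C < s' -> 2 * C <= sl -> 0 < sl ->
  n.+1 < s /\ n.+1 + sl <= s + C)%N by lia.
apply: (ar _ _ _ _ _ es _ n1 l1).
case: w {IH IH1 es} r IH2 => [|k w] r IH2.
  rewrite [ev u v _]mulg1.
  have ar' sm C : (2 * C <= sm -> 0 < sm -> 0 + C < sm)%N by lia.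
  exact: ar' n1' m1.
have /and3P[_ mk _] := r.
have ar' n s' sm C D : (n + sm <= s' + D -> C + D < sm -> n + C < s')%N by lia.
exact: ar' IH2 (N2 lm mk).
Qed.

Lemma size1_ev (x : free2) w : size x = 1%N -> ev u v w = x -> exists l, lv l = x.
Proof.
move=> sx ew; have : ev u v (fw w) = x by rewrite ev_fw.
case: (fw w) => {w ew} [[|l w] rw] /=; first by move=> e; rewrite -e in sx.
move=> ex; have := size_ev rw; rewrite [ev _ _ _]ex sx.
by case: w rw ex => // rw <- _; exists l; rewrite [RHS]mulg1.
Qed.
End Reduced.

Definition gens (G : groupType) (p : G * G) := forall g : G, exists w, ev p.1 p.2 w = g.

Definition nequiv (G : groupType) (p q : G * G) :=
  exists es (c : G), forall w : free2, ev p.1 p.2 w = (ev q.1 q.2 (aut es w)) ^ c.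

Lemma nequiv_trans (G : groupType) (p q r : G * G) : nequiv p q -> nequiv q r -> nequiv p r.
Proof.
move=> [es [c h]] [es' [c' h']]; exists (es' ++ es), (c' * c) => w.
by rewrite h h' aut_cat conjgM.
Qed.

Lemma nequiv_refl (G : groupType) (p : G * G) : nequiv p p.
Proof. by exists [::], 1 => w; rewrite conjg1. Qed.

Lemma gens_nequiv (G : groupType) (p q : G * G) : nequiv p q -> gens p -> gens q.
Proof.
move=> [es [c h]] gp g; have [w ew] := gp (g ^ c).
exists (aut es (fw w)); apply: (@conjg_inj _ c).
by rewrite -h ev_fw.
Qed.

Lemma nequiv_aut (G : groupType) (u v u' v' : G) es :
  ev u' v' (aut es xa) = u -> ev u' v' (aut es xb) = v -> nequiv (u, v) (u', v').
Proof.
move=> eu ev'; exists es, 1 => w; rewrite conjg1 autE.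
by rewrite ev_ev eu ev'.
Qed.

Lemma aut_cons e es x : aut (e :: es) x = act e (aut es x). Proof. by []. Qed.
Lemma aut_nil x : aut [::] x = x. Proof. by []. Qed.

Lemma nequiv_mulr (G : groupType) (s t : G) : nequiv (s, t) (s, s * t).
Proof.
apply: (@nequiv_aut _ _ _ _ _ (einv Elam)); rewrite /einv !aut_cons aut_nil !ev_act ev_fw [ev _ _ _]mulg1 ?invgK //.
exact: mulKg.
Qed.

Lemma nequiv_swap (G : groupType) (s t : G) : nequiv (s, t) (t, s).
Proof. by apply: (@nequiv_aut _ _ _ _ _ [:: Esw]); rewrite aut_cons aut_nil ev_act ev_fw [ev _ _ _]mulg1. Qed.

Lemma nequiv_inv (G : groupType) (s t : G) : nequiv (s, t) (s^-1, t).
Proof. by apply: (@nequiv_aut _ _ _ _ _ [:: Einv]); rewrite aut_cons aut_nil ev_act ev_fw [ev _ _ _]mulg1 ?invgK. Qed.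

Lemma nequiv_mull (G : groupType) (s t : G) : nequiv (s, t) (s * t, t).
Proof.
apply: nequiv_trans (nequiv_inv s t) _.
apply: nequiv_trans (nequiv_swap s^-1 t) _.
apply: nequiv_trans (nequiv_inv t s^-1) _.
apply: nequiv_trans (nequiv_mulr t^-1 s^-1) _; rewrite -invgM.
apply: nequiv_trans (nequiv_swap t^-1 (s * t)^-1) _.
apply: nequiv_trans (nequiv_inv (s * t)^-1 t^-1) _; rewrite invgK.
apply: nequiv_trans (nequiv_swap (s * t) t^-1) _.
apply: nequiv_trans (nequiv_inv t^-1 (s * t)) _; rewrite invgK.
exact: nequiv_swap.
Qed.

Lemma nequiv_conj (G : groupType) (s t c : G) : nequiv (s, t) (s ^ c, t ^ c).
Proof. by exists [::], c^-1 => w; rewrite ev_conj conjgK. Qed.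

Definition typ l := (l == la) || (l == lA).

Lemma typ_alt l m k : typ l != typ m -> typ m != typ k -> k = l \/ k = linv l.
Proof. by case: l; case: m; case: k => //= _ _; auto. Qed.

Lemma nequiv_lval (G : groupType) (u v : G) l m : typ l != typ m ->
  nequiv (u, v) (lval u v l, lval u v m).
Proof.
have h1 s t : @nequiv G (s, t) (s, t^-1).
  apply: nequiv_trans (nequiv_swap _ _) _; apply: nequiv_trans (nequiv_inv _ _) _.
  exact: nequiv_swap.
have sw s t : @nequiv G (s, t) (t, s) by exact: nequiv_swap.
have iv s t : @nequiv G (s, t) (s^-1, t) by exact: nequiv_inv.
case: l; case: m => //= _; try exact: nequiv_refl; do ?[exact: sw | exact: iv | exact: h1].
- exact: nequiv_trans (sw u v) (h1 v u).
- exact: nequiv_trans (iv u v) (h1 u^-1 v).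
- exact: nequiv_trans (sw u v) (iv v u).
- exact: nequiv_trans (sw u v) (nequiv_trans (iv v u) (h1 v^-1 u)).
Qed.

Lemma drop_winv (w : seq letter) n : drop (size w - n) w = winv (take n (winv w)).
Proof.
have [le|le] := leqP n (size w); last first.
  rewrite take_oversize ?size_winv 1?ltnW // winvK.
  by rewrite (_ : _ - _ = 0)%N ?drop0 //; lia.
by rewrite /winv take_rev map_rev revK map_drop -map_comp size_map
  (eq_map linvK) map_id.
Qed.

(* Here [t = p q^-1] cancels by halves on both sides in [s t s]; then
   [s = q m p^-1], so that [(s t)^q = m] and [t^q = q^-1 p]. *)
Lemma half_cancel (s t : free2) : 0 < size t -> size t <= size s ->
  (2 * lcp s^-1 t = size t)%N -> (2 * lcp t^-1 s = size t)%N ->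
  exists q : free2, size ((s * t) ^ q) + size (t ^ q) < size s + size t.
Proof.
move=> t0 ts; set h := lcp s^-1 t => eh1 eh2.
have eh : lcp t^-1 s = h by lia.
pose q := take h (winv t); pose p := take h t.
have qs : q = take h s by rewrite /q; apply: (@lcp_take t^-1); rewrite eh.
have ps : p = take h (winv s) by rewrite /p; apply/esym/(@lcp_take s^-1).
have et : t = p ++ winv q :> seq letter.
  by rewrite /q -drop_winv (_ : _ - _ = h)%N ?cat_take_drop //; lia.
have [m em] : exists m, s = q ++ m ++ winv p :> seq letter.
  exists (drop h (take (size s - h) s)); rewrite ps -drop_winv catA.
  have -> : q = take h (take (size s - h) s) by rewrite take_takel //; lia.
  by rewrite cat_take_drop cat_take_drop.
have sq : size q = h by rewrite qs size_takel //; lia.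
have sp : size p = h by rewrite size_takel //; lia.
have -> : s = fw q * (fw m * (fw p)^-1) by rewrite -(fwordK s) em !fw_cat fw_winv.
have -> : t = fw p * (fw q)^-1 by rewrite -(fwordK t) et !fw_cat fw_winv.
exists (fw q).
have -> : (fw q * (fw m * (fw p)^-1) * (fw p * (fw q)^-1)) ^ fw q = fw m.
  by rewrite /conjg !mulgA mulVg mul1g !mulgVK.
have -> : (fw p * (fw q)^-1) ^ fw q = fw (winv q ++ p).
  by rewrite /conjg fw_cat fw_winv mulgVK.
rewrite -!fw_winv -!fw_cat -et -em !fwordK.
have := size_fw m; have := size_fw (winv q ++ p).
rewrite em !size_cat !size_winv sq sp => l1 l2; lia.
Qed.

Lemma gens_neq1 (t : free2) : ~ gens (1, t).
Proof.
move=> gt; have ct w : commute t (ev 1 t w).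
  elim: w => [|l w IH] /=; first exact: commute1.
  apply: commuteM IH; case: l => /=; [exact: commute1 | exact: commute_refl | |].
    by rewrite invg1; exact: commute1.
  exact/commuteV/commute_refl.
have tc g : commute t g by have [w <-] := gt g.
have : commute xa xb.
  have [w <-] := gt xa; elim: w => [|l w IH] /=; first exact/commute_sym/commute1.
  apply/commute_sym/commuteM/commute_sym=> //; apply/commute_sym.
  case: l => /=; rewrite ?invg1; try exact/commute_sym/commute1; first exact: tc.
  exact/commute_sym/commuteV/commute_sym/tc.
by move/(congr1 fword).
Qed.

Lemma nielsen (p : free2 * free2) : gens p -> nequiv p (xa, xb).
Proof.
have [n] := ubnP (size p.1 + size p.2)%N; elim: n p => // n IH [u v] /= le gp.
have slv l m : typ l != typ m ->
    (size (lval u v l) + size (lval u v m) = size u + size v)%N.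
  by case: l; case: m; rewrite //= ?size_winv // addnC.
have step l m q : typ l != typ m -> nequiv (lval u v l, lval u v m) q ->
    (size q.1 + size q.2 < size (lval u v l) + size (lval u v m))%N ->
    nequiv (u, v) (xa, xb).
  move=> t nq; rewrite slv // => l1; have nuv := nequiv_trans (nequiv_lval u v t) nq.
  apply: (nequiv_trans nuv); apply: IH; first exact: leq_trans l1 _.
  exact: gens_nequiv gp.
apply: contrapT => N.
have nlv l m q : typ l != typ m -> nequiv (lval u v l, lval u v m) q ->
    (size (lval u v l) + size (lval u v m) <= size q.1 + size q.2)%N.
  by move=> t nq; rewrite leqNgt; apply/negP => l1; apply: N; exact: step nq l1.
have lv_neq1 l : lval u v l != 1.
  apply/eqP => e; have [m t] : exists m, typ l != typ m.
    by case: (l) => //; [exists lb | exists la | exists lb | exists la].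
  by have := gens_nequiv (nequiv_lval u v t) gp; rewrite e; exact: gens_neq1.
have lv1 l : 0 < size (lval u v l).
  by rewrite lt0n; apply: contra (lv_neq1 l) => /eqP/size_eq0_free2->.
have sq l : 2 * lcp (lval u v l)^-1 (lval u v l) < size (lval u v l).
  exact: lcp_square.
have same l m : compat l m -> typ l = typ m -> l = m.
  by case: l; case: m.
have N1 l m : compat l m -> 2 * lcp (lval u v l)^-1 (lval u v m) <= size (lval u v l) /\
    2 * lcp (lval u v l)^-1 (lval u v m) <= size (lval u v m).
  move=> lm; have [/(same _ _ lm) <-|t] := eqVneq (typ l) (typ m).
    by split; exact/ltnW/sq.
  have := size_mulg (lval u v l) (lval u v m).
  have := nlv _ _ _ t (nequiv_mulr _ _); have := nlv _ _ _ t (nequiv_mull _ _).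
  move=> /=; rewrite leq_add2l leq_add2r => h1 h2 h3.
  have ar (x y z c : nat) : (x <= z -> y <= z -> z + 2 * c = x + y ->
    2 * c <= x /\ 2 * c <= y)%N by lia.
  exact: ar h1 h2 h3.
have N2 l m k : compat l m -> compat m k ->
    lcp (lval u v l)^-1 (lval u v m) + lcp (lval u v m)^-1 (lval u v k) < size (lval u v m).
  move=> lm mk; have [n1 n1'] := N1 _ _ lm; have [n2 n2'] := N1 _ _ mk.
  have ar1 (c d x : nat) : (2 * c < x -> 2 * d <= x -> c + d < x)%N by lia.
  have ar2 (c d x : nat) : (2 * d < x -> 2 * c <= x -> c + d < x)%N by lia.
  have [elm|tlm] := eqVneq (typ l) (typ m).
    by have el := same _ _ lm elm; rewrite el; apply: ar1 (sq m) _.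
  have [emk|tmk] := eqVneq (typ m) (typ k).
    by have ek := same _ _ mk emk; rewrite -ek; apply: ar2 (sq m) _.
  rewrite ltnNge; apply/negP => ge.
  have ar3 (c d x : nat) : (2 * c <= x -> 2 * d <= x -> x <= c + d ->
    2 * c = x /\ 2 * d = x)%N by lia.
  have [e1 e2] := ar3 _ _ _ n1' n2 ge.
  have [ekl|ekl] : k = l \/ k = linv l.
    exact: typ_alt tlm tmk.
  - rewrite ekl in e2.
    have [|q] := half_cancel (lv1 m) _ e1 e2; first by rewrite -e1.
    rewrite ltnNge => /negP; apply.
    apply: (nlv _ _ (_, _) tlm).
    apply: nequiv_trans (nequiv_mull _ _) _; exact: nequiv_conj.
  - have := lcp_ultra (lval u v m)^-1 (lval u v k) (lval u v m).
    have := sq m; have : lcp (lval u v k) (lval u v m) = lcp (lval u v l)^-1 (lval u v m).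
      by rewrite ekl lval_linv.
    have ar4 (x c d e f : nat) : (2 * c = x -> 2 * d = x -> f = c -> 2 * e < x ->
      minn d f <= e -> False)%N by lia.
    exact: ar4 e1 e2.
have ex (x : free2) : size x = 1%N -> exists l, lval u v l = x.
  by move=> sx; have [w ew] := gp x; exact: size1_ev lv1 N1 N2 x w sx ew.
have [l1 e1] := ex xa erefl; have [l2 e2] := ex xb erefl.
apply: N; rewrite -{1}e1 -e2; apply: nequiv_lval.
apply/negP => /eqP t; have [/(same _ _)|] := boolP (compat l1 l2).
  by move=> /(_ t) e; move: e1; rewrite e e2 => /(congr1 fword).
rewrite negbK => /eqP e; move: e2; rewrite e lval_linv e1.
by move/(congr1 fword).
Qed.

End Nielsen.

(** * Conjugacy *)

Section Conj.
Local Open Scope group_scope.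

Definition cycred (w : seq letter) := cycle compat w.

Lemma cycred_reduced w : cycred w -> reduced w.
Proof. by case: w => //= l w; rewrite rcons_path => /andP[]. Qed.

Lemma cycred_rot i w : cycred (rot i w) = cycred w.
Proof. exact: rot_cycle. Qed.

Lemma rot_rot1 i (w : seq letter) : exists j, rot 1 (rot i w) = rot j w.
Proof.
have [le|/ltnW le] := leqP i (size w); last by exists 1%N; rewrite (rot_oversize le).
case: w le => [|l w] le; first by exists 0.
by rewrite rot_add_mod //; case: ifP => _; eexists.
Qed.

Lemma rotr_rot1 i (w : seq letter) : exists j, rotr 1 (rot i w) = rot j w.
Proof.
case: w => [|l w]; first by exists 0; rewrite /rot.
have [le|/ltnW le] := leqP i (size (l :: w)); last by exists (size w); rewrite (rot_oversize le) /rotr subn1.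
rewrite /rotr rot_add_mod ?size_rot ?leq_subr //.
by eexists.
Qed.

Lemma fw_conj1 l w : fw w ^ fw [:: l] = fw (linv l :: w ++ [:: l]).
Proof. by rewrite (fw_cons (linv l)) fw_cat fw_linv. Qed.
(* Only letters cancelling at both ends of [k] or across the ends of the
   cyclically reduced core can disappear. *)
Lemma conj_cycred w v : cycred w -> exists k i,
  reduced (k ++ rot i w ++ winv k) /\ fw w ^ fw v = fw (k ++ rot i w ++ winv k).
Proof.
move=> cw; have [->|w0] := eqVneq w [::].
  by exists [::], 0; rewrite fw_nil conj1g.
elim/last_ind: v => [|v l [k [i [rk ek]]]].
  by exists [::], 0; rewrite fw_nil conjg1 rot0 cats0 cycred_reduced.
rewrite -cats1 fw_cat conjgM ek fw_conj1.
case: k rk {ek} => [|m k] rk; last first.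
  have ew : (m :: k) ++ rot i w ++ winv (m :: k) =
      m :: rcons (k ++ rot i w ++ winv k) (linv m).
    by rewrite winv_cons -!cats1 /= -!catA.
  rewrite ew in rk *; have [em|nm] := eqVneq m l.
    exists k, i; split.
      by move: rk => /reduced_tl; rewrite -cats1 => /reduced_cat/andP[].
    rewrite em -fw_conj1 -cats1.
    have := fw_conj1 (linv l) (k ++ rot i w ++ winv k); rewrite linvK => <-.
    by rewrite fw_linv conjgKV.
  exists [:: linv l, m & k], i; have -> : [:: linv l, m & k] ++ rot i w ++ winv [:: linv l, m & k] =
      linv l :: (m :: rcons (k ++ rot i w ++ winv k) (linv m)) ++ [:: l].
    by rewrite -ew winv_cons linvK -cats1 /= -!catA.
  split=> //; rewrite -[X in reduced X]/(rcons [:: linv l, m & _] (linv m) ++ [:: l]).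
  by rewrite reduced_cat_cons !rcons_cons reduced_cons2 rk /compat !linvK nm eq_sym nm.
move: rk; rewrite /= cats0; set r := rot i w => rr.
have cr : cycred r by rewrite cycred_rot.
have : r != [::] by rewrite -size_eq0 size_rot size_eq0.
case er : r => [//|m r1] _.
have [em|nm] := eqVneq m l.
  have [j ej] := rot_rot1 i w; exists [::], j; rewrite -ej -/r er cats0 rot1_cons.
  split; first by rewrite cycred_reduced // -rot1_cons -er cycred_rot.
  by rewrite em fw_cons fw_linv cat_cons (fw_cons l (_ ++ _)) mulKg cats1.
have er2 : r = rcons (belast m r1) (last m r1) by rewrite er lastI.
move: (belast m r1) (last m r1) er2 => r2 m2 er2.
have [em2|nm2] := eqVneq m2 (linv l).
  have [j ej] := rotr_rot1 i w; exists [::], j; rewrite -ej cats0 -/r er2 em2 rotr1_rcons.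
  split; first by rewrite cycred_reduced // -rotr1_rcons -em2 -er2 cycred_rot.
  rewrite cat0s -fw_conj1 -er er2 em2 -cats1 fw_cat fw_linv /conjg mulgVK.
  by rewrite -fw_linv -fw_cat cat1s.
have er3 : winv [:: linv l] = [:: l] by rewrite /winv /= linvK.
exists [:: linv l], i; rewrite -/r er3 er; split=> //.
rewrite -er er2 -[X in reduced X]/(rcons (linv l :: r2) m2 ++ [:: l]).
rewrite reduced_cat_cons rcons_cons -er2 er reduced_cons2 -er rr /compat linvK nm andbT /=.
by rewrite andbT; apply: contra nm2 => /eqP->; rewrite linvK.
Qed.

Lemma size_conj w (c : free2) : cycred w -> size w <= size (fw w ^ c).
Proof.
move=> cw; have [k [i [r]]] := conj_cycred c cw; rewrite fwordK => ->.
by rewrite fword_fw // 2!size_cat size_rot; lia.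
Qed.

Lemma cycred_conj_rot w w' (c : free2) : cycred w -> cycred w' ->
  fw w ^ c = fw w' -> exists i, w' = rot i w.
Proof.
move=> cw cw'; have [k [i [r]]] := conj_cycred c cw; rewrite fwordK => -> /(congr1 fword).
rewrite (fword_fw r) (fword_fw (cycred_reduced cw')).
case: k {r} => [|m k]; first by rewrite cats0 => <-; exists i.
move=> ew; move: cw'; rewrite -ew winv_cons -cats1 !catA cats1 /cycred /= rcons_path.
by rewrite last_rcons /compat linvK eqxx andbF.
Qed.

Definition conjp (x y : free2) := exists c, y = x ^ c.
Definition conjpm x y := conjp x y \/ conjp x^-1 y.

Lemma conjp_refl x : conjp x x. Proof. by exists 1; rewrite conjg1. Qed.
Lemma conjp_sym x y : conjp x y -> conjp y x.
Proof. by move=> [c ->]; exists c^-1; rewrite conjgK. Qed.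
Lemma conjp_trans x y z : conjp x y -> conjp y z -> conjp x z.
Proof. by move=> [c ->] [d ->]; exists (c * d); rewrite conjgM. Qed.
Lemma conjpV x y : conjp x y -> conjp x^-1 y^-1.
Proof. by move=> [c ->]; exists c; rewrite conjVg. Qed.
Lemma conjp_aut es x y : conjp x y -> conjp (aut es x) (aut es y).
Proof. by move=> [c ->]; exists (aut es c); rewrite autJ. Qed.
Lemma conjp_autV es x y : conjp (aut es x) (aut es y) -> conjp x y.
Proof. by move/(conjp_aut (esinv es)); rewrite !esinvK. Qed.

Lemma conjpm_sym x y : conjpm x y -> conjpm y x.
Proof.
case=> [h|/conjp_sym/conjpV]; first by left; apply: conjp_sym.
by rewrite invgK; right.
Qed.
Lemma conjpm_trans x y z : conjpm x y -> conjpm y z -> conjpm x z.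
Proof.
case=> h1 [h2|h2].
- by left; apply: conjp_trans h2.
- by right; apply: conjp_trans (conjpV h1) h2.
- by right; apply: conjp_trans h2.
- by left; have := conjp_trans (conjpV h1) h2; rewrite invgK.
Qed.
Lemma conjpm_aut es x y : conjpm x y -> conjpm (aut es x) (aut es y).
Proof. by case=> /(conjp_aut es); rewrite ?autV; [left|right]. Qed.
Lemma conjpm_refl x : conjpm x x. Proof. by left; exact: conjp_refl. Qed.

Lemma size_conjpm w (x : free2) : cycred w -> conjpm (fw w) x -> size w <= size x.
Proof.
move=> cw [[c ->]|[c]]; first exact: size_conj.
by move=> ->; rewrite conjVg size_winv; exact: size_conj.
Qed.

Definition expo (l : letter) (w : seq letter) : int :=
  ((count_mem l w)%:Z - (count_mem (linv l) w)%:Z)%R.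

Lemma expo_nil l : expo l [::] = 0%R.
Proof. exact: GRing.subrr. Qed.

Lemma expo_cons l m w : expo l (m :: w) = (expo l [:: m] + expo l w)%R.
Proof. by rewrite /expo /=; lia. Qed.

Lemma expo_consr l m w : expo l (consr m w) = (expo l [:: m] + expo l w)%R.
Proof.
case: w => [|k w]; first by rewrite expo_nil GRing.addr0.
rewrite /consr; case: eqP => [->|_]; last exact: expo_cons.
rewrite (expo_cons _ (linv m)) GRing.addrA -[LHS]GRing.add0r; congr (_ + _)%R.
by case: l; case: m.
Qed.

Lemma expo_foldr l u v : expo l (foldr consr v u) = (expo l u + expo l v)%R.
Proof.
elim: u => [|m u IH]; first by rewrite expo_nil GRing.add0r.
by rewrite expo_consr IH (expo_cons _ m u) GRing.addrA.
Qed.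

Lemma expo_fw l w : expo l (fw w) = expo l w.
Proof. by rewrite expo_foldr expo_nil GRing.addr0. Qed.
Lemma expoM l (x y : free2) : expo l (x * y) = (expo l x + expo l y)%R.
Proof. exact: expo_foldr. Qed.
Lemma expoV l (x : free2) : expo l x^-1 = (- expo l x)%R.
Proof.
by apply/eqP; rewrite -GRing.addr_eq0 -expoM mulVg expo_nil.
Qed.
Lemma expoJ l (x c : free2) : expo l (x ^ c) = expo l x.
Proof. by rewrite /conjg !expoM expoV; lia. Qed.
Lemma expoX l (x : free2) n : expo l (x ^+ n) = (n%:Z * expo l x)%R.
Proof.
elim: n => [|n IH]; first by rewrite GRing.mul0r expo_nil.
by rewrite expgS expoM IH; lia.
Qed.
Lemma expo_conjp l x y : conjp x y -> expo l y = expo l x.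
Proof. by move=> [c ->]; exact: expoJ. Qed.

Lemma expo_ev l (p q : free2) w :
  expo l (ev p q w) = (expo l p * expo la w + expo l q * expo lb w)%R.
Proof.
elim: w => [|m w IH]; first by rewrite !expo_nil !GRing.mulr0.
rewrite (expo_cons la) (expo_cons lb) [LHS]expoM IH.
by case: m => /=; rewrite ?expoV /expo /=; lia.
Qed.

End Conj.

(** * Orbits of slopes *)

Section Family.
Local Open Scope group_scope.

Definition eR := [:: Einv; Esw].
Definition eL := [:: Elam].
Definition eP := [:: Esw; Elam; Esw].

Lemma outer_ext es es' c : aut es' xa = aut es xa ^ c -> aut es' xb = aut es xb ^ c ->
  forall x, conjp (aut es x) (aut es' x).
Proof. by move=> ea eb x; exists c; rewrite autE ea eb ev_conj -autE. Qed.

Lemma autLRL x : conjp (aut eL (aut eR (aut eL x))) (aut eP x).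
Proof. by apply: (@outer_ext (eL ++ eR ++ eL) eP xa); apply: val_inj. Qed.
Lemma autLRP x : aut eL (aut eR (aut eP x)) = aut eR x.
Proof. by apply: (@aut_ext (eL ++ eR ++ eP) eR); apply: val_inj. Qed.
Lemma autLRR x : conjp (aut eL (aut eR (aut eR x))) (aut eR (aut eR (aut eL x))).
Proof. by apply: (@outer_ext (eL ++ eR ++ eR) (eR ++ eR ++ eL) xa); apply: val_inj. Qed.
Lemma autPRR x : conjp (aut eP (aut eR (aut eR x))) (aut eR (aut eR (aut eP x))).
Proof. by apply: (@outer_ext (eP ++ eR ++ eR) (eR ++ eR ++ eP) xb); apply: val_inj. Qed.
Lemma autSL x : act Esw (aut eL x) = aut eP (act Esw x).
Proof. by apply: (@aut_ext (Esw :: eL) (eP ++ [:: Esw])); apply: val_inj. Qed.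
Lemma autSP x : act Esw (aut eP x) = aut eL (act Esw x).
Proof. by apply: (@aut_ext (Esw :: eP) (eL ++ [:: Esw])); apply: val_inj. Qed.
Lemma autSR x : act Esw (aut eR x) = aut eR (aut eR (aut eR (act Esw x))).
Proof. by apply: (@aut_ext (Esw :: eR) (eR ++ eR ++ eR ++ [:: Esw])); apply: val_inj. Qed.
Lemma autR4 x : aut eR (aut eR (aut eR (aut eR x))) = x.
Proof. by apply: (@aut_ext (eR ++ eR ++ eR ++ eR) [::]); apply: val_inj. Qed.
Lemma autRS x : aut eR (act Esw x) = act Einv x.
Proof. by apply: (@aut_ext (eR ++ [:: Esw]) [:: Einv]); apply: val_inj. Qed.

Lemma aut_RR es x : conjp (aut es (aut eR (aut eR x))) (aut eR (aut eR (aut es x))).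
Proof.
elim: es => [|e es IH]; first exact: conjp_refl.
apply: conjp_trans (conjp_aut [:: e] IH) _; rewrite !aut_cons aut_nil.
move: (aut es x) => y; case: e; last exact: autLRR.
  by have -> : act Esw (aut eR (aut eR y)) = aut eR (aut eR (act Esw y));
    [apply: (@aut_ext (Esw :: eR ++ eR) (eR ++ eR ++ [:: Esw])); apply: val_inj | exact: conjp_refl].
by have -> : act Einv (aut eR (aut eR y)) = aut eR (aut eR (act Einv y));
  [apply: (@aut_ext (Einv :: eR ++ eR) (eR ++ eR ++ [:: Einv])); apply: val_inj | exact: conjp_refl].
Qed.

Lemma coprime_addl m n : coprime (m + n) n = coprime m n.
Proof. by rewrite coprime_sym /coprime gcdnDr gcdnC. Qed.
Lemma coprime_addr m n : coprime m (n + m) = coprime m n.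
Proof. by rewrite /coprime gcdnDr. Qed.

Lemma coprime_ind (P : nat -> nat -> Prop) :
  P 1%N 0%N -> P 0%N 1%N ->
  (forall m n, coprime m n -> P m n -> P (m + n)%N n) ->
  (forall m n, coprime m n -> P m n -> P m (n + m)%N) ->
  forall m n, coprime m n -> P m n.
Proof.
move=> P10 P01 PL PP m n; have [k] := ubnP (m + n)%N; elim: k m n => // k IH m n le cmn.
have [n0|n0] := posnP n.
  by move: cmn; rewrite n0 /coprime gcdn0 => /eqP->.
have [m0|m0] := posnP m.
  by move: cmn; rewrite m0 /coprime gcd0n => /eqP->.
have [le'|/ltnW le'] := leqP n m.
  have c : coprime (m - n) n by rewrite -coprime_addl subnK.
  by rewrite -(subnK le'); apply: PL => //; apply: IH => //; lia.
have c : coprime m (n - m) by rewrite -coprime_addr subnK.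
by rewrite -(subnK le'); apply: PP => //; apply: IH => //; lia.
Qed.

Lemma coprime_step m n : coprime m n ->
  (exists k, coprime k n /\ m = (k + n)%N) \/ (exists k, coprime m k /\ n = (k + m)%N).
Proof.
move: m n; apply: coprime_ind.
- by left; exists 1%N.
- by right; exists 1%N.
- by move=> m n c _; left; exists m.
- by move=> m n c _; right; exists n.
Qed.

Variable w0 : free2.

(* [f] is fuel for the Euclidean algorithm; [slope] supplies enough of it. *)
Fixpoint zes (f m n : nat) : seq elem :=
  if f is f'.+1 then
    if n == 0%N then [::] else if m == 0%N then eR
    else if n <= m then eL ++ zes f' (m - n) n else eP ++ zes f' m (n - m)
  else [::].
Definition slope m n := aut (zes (m + n) m n) w0.

Lemma zes_fuel f m n : m + n <= f -> zes f m n = zes (m + n) m n.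
Proof.
have [k] := ubnP f; elim: k f m n => // k IH [|f] m n lk le.
  by have [-> ->] : m = 0%N /\ n = 0%N by lia.
case e : (m + n)%N => [|g] /=; first by have -> : n = 0%N by lia.
case: eqP => // n0; case: eqP => // m0; case: ifP => h; [congr (_ :: _) | congr [:: _, _, _ & _]].
  by transitivity (zes (m - n + n) (m - n) n); [|symmetry]; apply: IH; lia.
by transitivity (zes (m + (n - m)) m (n - m)); [|symmetry]; apply: IH; lia.
Qed.

Hypothesis hL : conjp (aut eL w0) w0.
Hypothesis hP : conjp (aut eP (aut eR w0)) (aut eR w0).
Hypothesis hLP : conjp (aut eL (aut eR w0)) (aut eP w0).
Hypothesis hS : conjp (act Esw w0) (aut eR (aut eR (aut eR w0)))^-1.

Lemma slope10 : slope 1 0 = w0. Proof. by []. Qed.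
Lemma slope01 : slope 0 1 = aut eR w0. Proof. by []. Qed.

Lemma slopeL m n : coprime m n -> conjp (aut eL (slope m n)) (slope (m + n) n).
Proof.
move=> c; have [n0|n0] := posnP n.
  by move: c; rewrite n0 /coprime gcdn0 => /eqP->; rewrite slope10.
suff -> : slope (m + n) n = aut eL (slope m n) by exact: conjp_refl.
rewrite /slope -aut_cat; case e : (m + n + n)%N => [|f]; first lia.
rewrite /= (gtn_eqF n0) leq_addl (_ : (_ == 0%N) = false); last lia.
by rewrite addnK zes_fuel //; lia.
Qed.

Lemma slopeP m n : coprime m n -> conjp (aut eP (slope m n)) (slope m (n + m)).
Proof.
move=> c; have [m0|m0] := posnP m.
  by move: c; rewrite m0 /coprime gcd0n => /eqP->; rewrite slope01.
have [n0|n0] := posnP n.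
  move: c; rewrite n0 /coprime gcdn0 => /eqP->; rewrite slope10 -[slope _ _]/(aut eL (aut eR w0)).
  exact: conjp_sym.
suff -> : slope m (n + m) = aut eP (slope m n) by exact: conjp_refl.
rewrite /slope -aut_cat; case e : (m + (n + m))%N => [|f]; first lia.
rewrite /= (gtn_eqF m0) (_ : (_ == 0%N) = false); last lia.
rewrite (_ : (n + m <= m) = false); last lia.
by rewrite addnK zes_fuel //; lia.
Qed.

Definition rr j := flatten (nseq j eR).
Lemma aut_rrS j x : aut (rr j.+1) x = aut eR (aut (rr j) x).
Proof. exact: aut_cat. Qed.
Lemma aut_rrD i j x : aut (rr (i + j)) x = aut (rr i) (aut (rr j) x).
Proof. by elim: i => // i IH; rewrite addSn !aut_rrS IH. Qed.
Lemma aut_rr_mod4 j x : aut (rr j) x = aut (rr (j %% 4)) x.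
Proof.
rewrite {1}(divn_eq j 4); elim: (j %/ 4) => // k IH.
by rewrite mulSn -addnA aut_rrD IH [LHS]autR4.
Qed.

Definition sorbit x := exists j m n, coprime m n /\ conjp (aut (rr j) (slope m n)) x.

Lemma sorbit_conj x y : conjp x y -> sorbit x -> sorbit y.
Proof.
move=> xy [j [m [n [c h]]]]; exists j, m, n; split=> //; exact: conjp_trans xy.
Qed.
Lemma sorbitR x : sorbit x -> sorbit (aut eR x).
Proof.
move=> [j [m [n [c h]]]]; exists j.+1, m, n; split=> //; rewrite aut_rrS.
exact: conjp_aut.
Qed.

Lemma sorbit_slope m n : coprime m n -> sorbit (slope m n).
Proof. by move=> c; exists 0%N, m, n; split=> //; exact: conjp_refl. Qed.

Lemma sorbitL x : sorbit x -> sorbit (aut eL x).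
Proof.
move=> [j [m [n [c /(conjp_aut eL)/sorbit_conj h]]]]; apply: h.
have [k] := ubnP j; elim: k j => // k IH [|[|j]] lk.
- apply: sorbit_conj (conjp_sym (slopeL c)) (sorbit_slope _).
  by rewrite coprime_addl.
- rewrite aut_rrS; case: (coprime_step c) => [[i [ci ->]]|[i [ci ->]]].
    apply: sorbit_conj (conjp_aut eL (conjp_aut eR (slopeL ci))) _.
    apply: sorbit_conj (conjp_sym (autLRL _)) _.
    apply: sorbit_conj (conjp_sym (slopeP ci)) (sorbit_slope _).
    by rewrite coprime_addr.
  apply: sorbit_conj (conjp_aut eL (conjp_aut eR (slopeP ci))) _.
  by rewrite autLRP; exact/sorbitR/sorbit_slope.
- rewrite !aut_rrS; apply: sorbit_conj (conjp_sym (autLRR _)) _.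
  by apply/sorbitR/sorbitR/IH; lia.
Qed.

Lemma slopeS m n : coprime m n ->
  conjp (act Esw (slope m n)) (aut eR (aut eR (slope n m)))^-1.
Proof.
move: m n; apply: coprime_ind.
- exact: hS.
- rewrite slope01 autSR; have := conjp_aut (eR ++ eR ++ eR) hS.
  by rewrite !aut_cat !autV autR4 slope10.
- move=> m n c IH; apply: conjp_trans (conjp_aut [:: Esw] (conjp_sym (slopeL c))) _.
  rewrite /= autSL; apply: conjp_trans (conjp_aut eP IH) _; rewrite autV; apply: conjpV.
  apply: conjp_trans (autPRR _) _; do 2!apply: conjp_aut.
  by apply: slopeP; rewrite coprime_sym.
- move=> m n c IH; apply: conjp_trans (conjp_aut [:: Esw] (conjp_sym (slopeP c))) _.
  rewrite /= autSP; apply: conjp_trans (conjp_aut eL IH) _; rewrite autV; apply: conjpV.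
  apply: conjp_trans (autLRR _) _; do 2!apply: conjp_aut.
  by apply: slopeL; rewrite coprime_sym.
Qed.

Definition sorbitpm x := sorbit x \/ sorbit x^-1.

Lemma sorbitpmR x : sorbitpm x -> sorbitpm (aut eR x).
Proof. by case=> /sorbitR; rewrite ?autV; [left|right]. Qed.
Lemma sorbitpmL x : sorbitpm x -> sorbitpm (aut eL x).
Proof. by case=> /sorbitL; rewrite ?autV; [left|right]. Qed.
Lemma sorbitpmV x : sorbitpm x^-1 <-> sorbitpm x.
Proof. by rewrite /sorbitpm invgK; split; case; auto. Qed.
Lemma sorbitpm_conj x y : conjp x y -> sorbitpm x -> sorbitpm y.
Proof.
move=> h [s|s]; first by left; apply: sorbit_conj s.
by right; apply: sorbit_conj s; exact: conjpV.
Qed.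

Lemma sorbitpmS x : sorbitpm x -> sorbitpm (act Esw x).
Proof.
wlog : x / sorbit x.
  move=> H [s|s]; first by apply: H; [|left].
  apply/sorbitpmV; rewrite -[_^-1](autV [:: Esw]); apply: H => //; by left.
move=> [j [m [n [c h]]]] _; apply: sorbitpm_conj (conjp_aut [:: Esw] h) _ => {h}.
rewrite aut_cons aut_nil; elim: j => [|j IH].
  apply: sorbitpm_conj (conjp_sym (slopeS c)) _; apply/sorbitpmV; left.
  by apply/sorbitR/sorbitR/sorbit_slope; rewrite coprime_sym.
by rewrite aut_rrS autSR; do 3!apply: sorbitpmR.
Qed.

Lemma sorbit_aut es : sorbitpm (aut es w0).
Proof.
elim: es => [|e es IH]; first by left; rewrite -slope10; exact: sorbit_slope.
case: e; rewrite aut_cons; first exact: sorbitpmS.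
  by rewrite -autRS; apply/sorbitpmR/sorbitpmS.
exact: sorbitpmL.
Qed.

End Family.

(** * Cyclically reduced words of slopes *)

Section SlopeWords.
Local Open Scope group_scope.

Definition pos (l : letter) := (l == la) || (l == lb).
Definition lamw (w : seq letter) := flatten (map (fun l =>
  match l with la => [:: la] | lb => [:: la; lb] | lA => [:: lA] | lB => [:: lB; lA] end) w).
Definition rhow (w : seq letter) := flatten (map (fun l =>
  match l with la => [:: la; lb] | lb => [:: lb] | lA => [:: lB; lA] | lB => [:: lB] end) w).
Definition rotl l := match l with la => lb | lb => lA | lA => lB | lB => la end.

Lemma fw_lamw w : aut eL (fw w) = fw (lamw w).
Proof.
rewrite autE ev_fw; elim: w => [|l w IH]; first by rewrite fw_nil.
rewrite [LHS]/= IH /lamw /= fw_cat; congr (_ * _).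
by case: l; apply: val_inj.
Qed.

Lemma fw_rhow w : conjp (aut eP (fw w)) (fw (rhow w)).
Proof.
exists xb; rewrite autE ev_fw -ev_conj.
elim: w => [|l w IH]; first by rewrite fw_nil.
rewrite [RHS]/= -IH /rhow /= fw_cat; congr (_ * _).
by case: l; apply: val_inj.
Qed.

Lemma fw_rotl w : aut eR (fw w) = fw (map rotl w).
Proof.
rewrite autE ev_fw; elim: w => [|l w IH]; first by rewrite fw_nil.
by rewrite [LHS]/= IH [RHS]fw_cons; congr (_ * _); case: l; apply: val_inj.
Qed.

Lemma fw_rotl_iter j w : aut (rr j) (fw w) = fw (iter j (map rotl) w).
Proof. by elim: j => // j IH; rewrite aut_rrS IH fw_rotl. Qed.

Lemma cycred_rotl w : cycred (map rotl w) = cycred w.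
Proof. by rewrite /cycred cycle_map; apply: eq_cycle; case; case. Qed.

Lemma cycred_rotl_iter j w : cycred (iter j (map rotl) w) = cycred w.
Proof. by elim: j => // j IH; rewrite iterS cycred_rotl. Qed.

Lemma size_rotl_iter j w : size (iter j (map rotl) w) = size w.
Proof. by elim: j => // j IH; rewrite iterS size_map. Qed.

Lemma pos_cycred w : all pos w -> cycred w.
Proof.
case: w => //= l w /andP[pl pw].
have : all pos (rcons w l) by rewrite all_rcons pl.
move: (rcons w l) => s {w pw}; elim: s l pl => //= m s IH l pl /andP[pm ps].
by rewrite IH // andbT; case: l pl => // _; case: m pm IH.
Qed.

Lemma pos_lamw w : all pos w -> all pos (lamw w).
Proof. by elim: w => //= l w IH /andP[pl pw]; rewrite /lamw /= all_cat IH // andbT; case: l pl. Qed.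
Lemma pos_rhow w : all pos w -> all pos (rhow w).
Proof. by elim: w => //= l w IH /andP[pl pw]; rewrite /rhow /= all_cat IH // andbT; case: l pl. Qed.

Lemma count_lamw w : all pos w ->
  count_mem la (lamw w) = (count_mem la w + count_mem lb w)%N /\
  count_mem lb (lamw w) = count_mem lb w.
Proof.
elim: w => //= l w IH /andP[pl /IH[ea eb]].
by rewrite /lamw /= !count_cat ea eb; case: l pl => //= _; lia.
Qed.
Lemma count_rhow w : all pos w ->
  count_mem la (rhow w) = count_mem la w /\
  count_mem lb (rhow w) = (count_mem lb w + count_mem la w)%N.
Proof.
elim: w => //= l w IH /andP[pl /IH[ea eb]].
by rewrite /rhow /= !count_cat ea eb; case: l pl => //= _; lia.
Qed.

Lemma size_pos w : all pos w -> size w = (count_mem la w + count_mem lb w)%N.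
Proof. by elim: w => //= l w IH /andP[pl /IH->]; case: l pl => //= _; lia. Qed.

Lemma lamw_cat u v : lamw (u ++ v) = lamw u ++ lamw v.
Proof. by rewrite /lamw map_cat flatten_cat. Qed.
Lemma rhow_cat u v : rhow (u ++ v) = rhow u ++ rhow v.
Proof. by rewrite /rhow map_cat flatten_cat. Qed.

Definition word1 := [:: la; la; lb; lA; lB].
Definition word2 := [:: la; lb; la; lB].

Lemma word1L : conjp (aut eL (fw word1)) (fw word1).
Proof. by exists xa; apply: val_inj. Qed.
Lemma word1P : conjp (aut eP (aut eR (fw word1))) (aut eR (fw word1)).
Proof. by exists 1; apply: val_inj. Qed.
Lemma word1LP : conjp (aut eL (aut eR (fw word1))) (aut eP (fw word1)).
Proof. by exists xb^-1; apply: val_inj. Qed.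
Lemma word1S : conjp (act Esw (fw word1)) (aut eR (aut eR (aut eR (fw word1))))^-1.
Proof. by exists (fw [:: lb; lb]); apply: val_inj. Qed.

Lemma word2L : conjp (aut eL (fw word2)) (fw word2).
Proof. by exists xa; apply: val_inj. Qed.
Lemma word2P : conjp (aut eP (aut eR (fw word2))) (aut eR (fw word2)).
Proof. by exists 1; apply: val_inj. Qed.
Lemma word2LP : conjp (aut eL (aut eR (fw word2))) (aut eP (fw word2)).
Proof. by exists xb^-1; apply: val_inj. Qed.
Lemma word2S : conjp (act Esw (fw word2)) (aut eR (aut eR (aut eR (fw word2))))^-1.
Proof. by exists xb; apply: val_inj. Qed.

Lemma slope1_word m n : coprime m n -> exists q,
  [/\ all pos q, count_mem la q = m, count_mem lb q = n &
      conjp (slope (fw word1) m n) (fw (la :: q ++ [:: lb; lA; lB]))].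
Proof.
move: m n; apply: coprime_ind.
- by exists [:: la]; split=> //; exact: conjp_refl.
- exists [:: lb]; split=> //; exists xa^-1; exact: val_inj.
- move=> m n c [q [pq qa qb h]].
  have [q' eq'] : exists q', lamw q ++ [:: la] = la :: q'.
    case: (q) pq => [|l s]; first by exists [::].
    by case: l => //= _; [exists (lamw s ++ [:: la]) | exists (lb :: lamw s ++ [:: la])].
  have pq' : all pos (la :: q') by rewrite -eq' all_cat pos_lamw.
  have [ca cb] := count_lamw pq; exists q'; split.
  + by case/andP: pq'.
  + by apply: succn_inj; rewrite -[RHS]addn1 -qa -qb -ca -[1%N]/(count_mem la [:: la]) -count_cat eq'.
  + by rewrite -qb -cb -[RHS]addn0 -[0%N]/(count_mem lb [:: la]) -count_cat eq'.
  apply: conjp_trans (conjp_sym (slopeL word1L c)) _.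
  apply: conjp_trans (conjp_aut eL h) _; rewrite fw_lamw -cat1s lamw_cat lamw_cat.
  have -> : lamw [:: la] ++ lamw q ++ lamw [:: lb; lA; lB] =
      la :: (lamw q ++ [:: la]) ++ [:: lb; lA; lB] ++ [:: lA] by rewrite -catA.
  by rewrite eq'; apply: conjp_sym; exists xa^-1; rewrite -(fw_linv la) fw_conj1 /= -catA.
- move=> m n c [q [pq qa qb h]].
  have [q' eq'] : exists q', lb :: rhow q = rcons q' lb.
    rewrite lastI; eexists; congr rcons.
    have : all pos q := pq; elim/last_ind: (q) => // s l IH; rewrite all_rcons => /andP[pl _].
    by rewrite -cats1 rhow_cat last_cat; case: l pl.
  have pq' : all pos (rcons q' lb) by rewrite -eq' /= pos_rhow.
  have [ca cb] := count_rhow pq; exists q'; split.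
  + by move: pq'; rewrite all_rcons.
  + have := congr1 (count_mem la) eq'; rewrite -cats1 count_cat /= ca qa; lia.
  + have := congr1 (count_mem lb) eq'; rewrite -cats1 count_cat /= cb qa qb; lia.
  apply: conjp_trans (conjp_sym (slopeP word1P word1LP c)) _.
  apply: conjp_trans (conjp_aut eP h) _; apply: conjp_trans (fw_rhow _) _.
  rewrite -cat1s rhow_cat rhow_cat.
  have -> : rhow [:: la] ++ rhow q ++ rhow [:: lb; lA; lB] =
      la :: (lb :: rhow q) ++ [:: lb; lB; lA; lB] by [].
  rewrite eq' -cat_rcons -!cats1; exists 1; rewrite conjg1 -!cat_cons -!catA.
  by rewrite !(fw_cat (la :: q')); congr (_ * _); apply: val_inj.
Qed.

Lemma cycred_slope1 q : all pos q -> cycred (la :: q ++ [:: lb; lA; lB]).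
Proof.
rewrite /cycred /= rcons_cat /=.
suff h l : pos l -> all pos q -> path compat l (q ++ [:: lb; lA; lB; la]) by exact: h.
elim: q l => [|m q IH] l pl /=; first by case: l pl.
by move=> /andP[pm pq]; rewrite IH // andbT; case: l pl => // _; case: m pm IH.
Qed.

Lemma slope1_cycred m n : coprime m n -> exists w,
  [/\ cycred w, size w = (m + n + 4)%N & conjp (fw w) (slope (fw word1) m n)].
Proof.
move=> /slope1_word[q [pq qa qb h]]; exists (la :: q ++ [:: lb; lA; lB]); split.
- exact: cycred_slope1.
- by rewrite /= size_cat (size_pos pq) qa qb /=; lia.
- exact: conjp_sym.
Qed.

Lemma slope2_word m n : coprime m n -> 0 < m -> 0 < n -> exists w,
  [/\ all pos w, count_mem la w = (2 * m)%N, count_mem lb w = (2 * n)%N &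
      conjp (slope (fw word2) m n) (fw w)].
Proof.
have h11 : exists w,
    [/\ all pos w, count_mem la w = (2 * 1)%N, count_mem lb w = (2 * 1)%N &
      conjp (slope (fw word2) 1 1) (fw w)].
  by exists [:: la; lb; lb; la]; split=> //; exists 1; exact: val_inj.
move: m n; apply: coprime_ind => // m n c IH m0 n0.
- have [mz|mp] := posnP m; first by move: c; rewrite mz /coprime gcd0n => /eqP->.
  have [w [pw wa wb h]] := IH mp n0; have [ca cb] := count_lamw pw.
  exists (lamw w); split; [exact: pos_lamw | rewrite ca wa wb; lia | by rewrite cb |].
  by apply: conjp_trans (conjp_sym (slopeL word2L c)) _; rewrite -fw_lamw; exact: conjp_aut.
- have [nz|np] := posnP n; first by move: c; rewrite nz /coprime gcdn0 => /eqP->.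
  have [w [pw wa wb h]] := IH m0 np; have [ca cb] := count_rhow pw.
  exists (rhow w); split; [exact: pos_rhow | by rewrite ca | rewrite cb wa wb; lia |].
  apply: conjp_trans (conjp_sym (slopeP word2P word2LP c)) _.
  by apply: conjp_trans (conjp_aut _ h) _; exact: fw_rhow.
Qed.

Lemma slope2_cycred m n : coprime m n -> exists w,
  [/\ cycred w, size w = (if m + n == 1 then 4 else 2 * (m + n))%N
    & conjp (fw w) (slope (fw word2) m n)].
Proof.
move=> c; have [m0|m0] := posnP m.
  move: c; rewrite m0 /coprime gcd0n => /eqP->; exists (map rotl word2).
  by split=> //; rewrite -fw_rotl; exact: conjp_refl.
have [n0|n0] := posnP n.
  move: c; rewrite n0 /coprime gcdn0 => /eqP->; exists word2.
  by split=> //; exact: conjp_refl.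
have [w [pw wa wb h]] := slope2_word c m0 n0; exists w; split.
- exact: pos_cycred.
- by rewrite (size_pos pw) wa wb; case: eqP; lia.
- exact: conjp_sym.
Qed.

End SlopeWords.

(** * Counting *)

Section Count.
Local Open Scope group_scope.

Definition slope_index (J N : nat) : seq (nat * nat) :=
  [seq (j, n) | j <- iota 0 J, n <- [seq n <- iota 0 N | coprime N n]].

Lemma size_slope_index J N : size (slope_index J N) = (J * totient N)%N.
Proof.
rewrite size_allpairs size_iota size_filter totient_count_coprime -sum1_count big_mkcond.
by congr (_ * _)%N; rewrite /index_iota subn0; apply: eq_bigr => i _; case: coprime.
Qed.

Lemma slope_index_uniq J N : uniq (slope_index J N).
Proof.
apply: allpairs_uniq; [exact: iota_uniq | exact/filter_uniq/iota_uniq |].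
by move=> [a b] [c d] _ _ /= [-> ->].
Qed.

Lemma mem_slope_index J N j n :
  ((j, n) \in slope_index J N) = [&& j < J, n < N & coprime N n].
Proof.
apply/allpairsP/idP => [[[a b] /= [h1 h2 [-> ->]]]|/and3P[jJ nN c]].
  by move: h1 h2; rewrite mem_filter !mem_iota /= !add0n => -> /andP[-> ->].
by exists (j, n); rewrite mem_filter !mem_iota !add0n c.
Qed.

Definition counted (x : free2) (l c : nat) := exists s : seq (seq letter),
  [/\ size s = c,
      forall w, w \in s -> [/\ cycred w, size w = l & exists es, conjp (fw w) (aut es x)],
      forall i j, i < size s -> j < size s ->
        conjpm (fw (nth [::] s i)) (fw (nth [::] s j)) -> i = j
    & forall es, exists w, [/\ cycred w, conjpm (fw w) (aut es x) & (size w = l -> w \in s)]].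

Lemma expoL x : expo la (aut eL x) = (expo la x + expo lb x)%R /\ expo lb (aut eL x) = expo lb x.
Proof. by rewrite !expo_ev !expoM !expo_fw /expo /=; lia. Qed.
Lemma expoP x : expo la (aut eP x) = expo la x /\ expo lb (aut eP x) = (expo la x + expo lb x)%R.
Proof.
have e : aut eP x = ev (xb * xa) xb x by rewrite autE; congr ev; apply: val_inj.
by rewrite e !expo_ev !expoM !expo_fw /expo /=; lia.
Qed.
Lemma expoR x : expo la (aut eR x) = (- expo lb x)%R /\ expo lb (aut eR x) = expo la x.
Proof.
have e : aut eR x = ev xb xa^-1 x by rewrite autE; congr ev; apply: val_inj.
by rewrite e !expo_ev !expoV !expo_fw /expo /=; lia.
Qed.

(* The vector [(M, N)] turned [j] times by a right angle. *)
Definition quarter j (M N : int) : int * int :=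
  nth (0, 0)%R [:: (M, N); (- N, M)%R; (- M, - N)%R; (N, - M)%R] j.

Lemma quarter_inj j j' (M N M' N' : nat) : j < 4 -> j' < 4 -> 0 < M -> 0 < M' ->
  quarter j M N = quarter j' M' N' -> [/\ j = j', M = M' & N = N'].
Proof.
case: j => [|[|[|[|]]]] // _; case: j' => [|[|[|[|]]]] // _ M0 M0' [];
 by move=> *; split=> //; lia.
Qed.

Lemma quarter_opp j M N : j < 4 ->
  quarter ((j + 2) %% 4) M N = (- (quarter j M N).1, - (quarter j M N).2)%R.
Proof. by case: j => [|[|[|[|]]]] // _; rewrite /quarter /= ?GRing.opprK. Qed.

Section Generic.
Variables (w0 : free2) (k : nat).
Hypothesis hL : conjp (aut eL w0) w0.
Hypothesis hP : conjp (aut eP (aut eR w0)) (aut eR w0).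
Hypothesis hLP : conjp (aut eL (aut eR w0)) (aut eP w0).
Hypothesis hS : conjp (act Esw w0) (aut eR (aut eR (aut eR w0)))^-1.
Hypothesis ea0 : expo la w0 = k.
Hypothesis eb0 : expo lb w0 = 0%R.
Hypothesis k0 : 0 < k.

Lemma expo_slope m n : coprime m n ->
  expo la (slope w0 m n) = (k * m)%N /\ expo lb (slope w0 m n) = (k * n)%N.
Proof.
move: m n; apply: coprime_ind.
- by rewrite slope10 ea0 eb0 muln0 muln1.
- by rewrite slope01 (expoR _).1 (expoR _).2 ea0 eb0 muln0 muln1 GRing.oppr0.
- move=> m n c [ea eb]; have h := slopeL hL c.
  by rewrite !(expo_conjp _ h) (expoL _).1 (expoL _).2 ea eb; lia.
- move=> m n c [ea eb]; have h := slopeP hP hLP c.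
  by rewrite !(expo_conjp _ h) (expoP _).1 (expoP _).2 ea eb; lia.
Qed.

Lemma expo_rr j x : j < 4 ->
  (expo la (aut (rr j) x), expo lb (aut (rr j) x)) = quarter j (expo la x) (expo lb x).
Proof.
by case: j => [|[|[|[|]]]] // _; rewrite ?aut_rrS ?(expoR _).1 ?(expoR _).2 ?GRing.opprK;
  rewrite ?(expoR _).1 ?(expoR _).2 ?GRing.opprK.
Qed.

Lemma expo_rr_slope j m n : coprime m n -> j < 4 ->
  (expo la (aut (rr j) (slope w0 m n)), expo lb (aut (rr j) (slope w0 m n))) =
  quarter j (k * m)%N (k * n)%N.
Proof. by move=> c lj; rewrite expo_rr //; have [-> ->] := expo_slope c. Qed.

Lemma slope_rr_inj j m n j' m' n' : coprime m n -> coprime m' n' -> 0 < m -> 0 < m' ->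
  j < 4 -> j' < 4 -> conjp (aut (rr j) (slope w0 m n)) (aut (rr j') (slope w0 m' n')) ->
  [/\ j = j', m = m' & n = n'].
Proof.
move=> c c' m0 m0' lj lj' h; have := expo_rr_slope c' lj'.
rewrite !(expo_conjp _ h) expo_rr_slope // => /quarter_inj[] //; rewrite ?muln_gt0 ?k0 //.
by move=> -> /eqP + /eqP; rewrite !eqn_pmul2l // => /eqP-> /eqP->.
Qed.

Lemma slope_rr_injV j m n j' m' n' : coprime m n -> coprime m' n' -> 0 < m -> 0 < m' ->
  j < 4 -> j' < 4 -> conjp (aut (rr j) (slope w0 m n))^-1 (aut (rr j') (slope w0 m' n')) ->
  [/\ j' = (j + 2) %% 4, m = m' & n = n'].
Proof.
move=> c c' m0 m0' lj lj' h; have := expo_rr_slope c' lj'.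
have e1 := congr1 fst (expo_rr_slope c lj).
have e2 := congr1 snd (expo_rr_slope c lj).
rewrite /fst /snd in e1 e2.
rewrite !(expo_conjp _ h) !expoV e1 e2 -quarter_opp // => /quarter_inj[] //;
  rewrite ?muln_gt0 ?k0 ?ltn_mod //.
by move=> -> /eqP + /eqP; rewrite !eqn_pmul2l // => /eqP-> /eqP->.
Qed.

(* Rotating by right angles moves the slope (0, 1) to (1, 0), so that the first
   coordinate may be taken positive. *)
Lemma aut_slope es : exists j m n, [/\ coprime m n, 0 < m, j < 4 &
  conjpm (aut (rr j) (slope w0 m n)) (aut es w0)].
Proof.
have st x : sorbit w0 x -> exists j m n, [/\ coprime m n, 0 < m, j < 4 &
    conjp (aut (rr j) (slope w0 m n)) x].
  move=> [j [m [n [c h]]]]; have [m0|m0] := posnP m.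
    move: c h; rewrite m0 /coprime gcd0n => /eqP->.
    rewrite slope01 -(aut_rrD j 1) aut_rr_mod4 => h.
    by exists ((j + 1) %% 4), 1%N, 0%N; rewrite ltn_mod.
  by exists (j %% 4), m, n; rewrite -aut_rr_mod4 ltn_mod.
case: (sorbit_aut hL hP hLP hS es) => /st[j [m [n [c m0 lj h]]]].
  by exists j, m, n; split=> //; left.
by exists j, m, n; split=> //; apply: conjpm_sym; right; exact: conjp_sym.
Qed.

End Generic.

Lemma word1_RR : ~ conjp (fw word1)^-1 (aut eR (aut eR (fw word1))).
Proof.
rewrite -fw_winv !fw_rotl => -[c /esym]/cycred_conj_rot[] // i.
have [le|/ltnW le] := leqP (size (winv word1)) i; first by rewrite rot_oversize.
by move: i le => [|[|[|[|[|[|i]]]]]] //.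
Qed.

Lemma counted1 l : counted (fw word1) l (4 * totient (l - 4)).
Proof.
have ea : expo la (fw word1) = 1%N by rewrite expo_fw.
have eb : expo lb (fw word1) = 0%R by rewrite expo_fw.
have [rep hrep] : {rep : nat -> nat -> nat -> seq letter | forall j m n, coprime m n ->
    [/\ cycred (rep j m n), size (rep j m n) = (m + n + 4)%N &
        conjp (fw (rep j m n)) (aut (rr j) (slope (fw word1) m n))]}.
  suff /choice[f hf] : forall x : nat * nat * nat, exists w, coprime x.1.2 x.2 ->
      [/\ cycred w, size w = (x.1.2 + x.2 + 4)%N &
        conjp (fw w) (aut (rr x.1.1) (slope (fw word1) x.1.2 x.2))].
    by exists (fun j m n => f (j, m, n)) => j m n; exact: (hf (j, m, n)).
  move=> [[j m] n] /=; have [c|] := boolP (coprime m n); last by exists [::].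
  have [w [cw sw h]] := slope1_cycred c; exists (iter j (map rotl) w) => _; split.
  - by rewrite cycred_rotl_iter.
  - by rewrite size_rotl_iter.
  - by rewrite -fw_rotl_iter; exact: conjp_aut.
pose N := l - 4; pose s := [seq rep p.1 (N - p.2) p.2 | p <- slope_index 4 N].
have cop n : n < N -> coprime N n -> coprime (N - n) n.
  by move=> lt; rewrite -{1}(subnK (ltnW lt)) coprime_addl.
exists s; split.
- by rewrite size_map size_slope_index.
- move=> w /mapP[[j n]]; rewrite mem_slope_index => /and3P[lj ln c] -> /=.
  have [cw sw h] := hrep j _ _ (cop _ ln c); split=> //; first by rewrite sw; lia.
  exists (rr j ++ zes (N - n + n) (N - n) n); by rewrite aut_cat.
- move=> i i'; rewrite size_map => li li'.
  rewrite !(nth_map (0, 0)%N) //.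
  have := mem_nth (0, 0)%N li; have := mem_nth (0, 0)%N li'.
  case ei : (nth _ _ i) => [j n]; case ei' : (nth _ _ i') => [j' n'] /=.
  rewrite !mem_slope_index => /and3P[lj' ln' c'] /and3P[lj ln c].
  have [_ _ h] := hrep j _ _ (cop _ ln c); have [_ _ h'] := hrep j' _ _ (cop _ ln' c').
  have m0 : 0 < N - n by lia.
  have m0' : 0 < N - n' by lia.
  have fin : j = j' -> n = n' -> i = i'.
    move=> ej en; apply/eqP; rewrite -(nth_uniq (0, 0)%N li li' (slope_index_uniq _ _)).
    by rewrite ei ei' ej en.
  case=> hc.
    have [] // := slope_rr_inj word1L word1P word1LP ea eb _ (cop _ ln c) (cop _ ln' c') m0 m0' lj lj'
      (conjp_trans (conjp_sym h) (conjp_trans hc h')).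
    by move=> ej _ en; exact: fin.
  have hc' := conjp_trans (conjpV (conjp_sym h)) (conjp_trans hc h').
  have [//|ej _ en] := slope_rr_injV word1L word1P word1LP ea eb _ (cop _ ln c) (cop _ ln' c') m0 m0' lj lj' hc'.
  exfalso; apply: word1_RR.
  move: hc'; rewrite ej -en -aut_rr_mod4 aut_rrD -autV => /conjp_autV.
  rewrite /slope -autV => hc'; apply: (@conjp_autV (zes (N - n + n) (N - n) n)).
  by apply: conjp_trans hc' _; apply: conjp_sym; exact: aut_RR.
- move=> es; have [j [m [n [c m0 lj h]]]] := aut_slope word1L word1P word1LP word1S es.
  have [cw sw hw] := hrep j _ _ c; exists (rep j m n); split=> //.
    by apply: conjpm_trans h; left.
  rewrite sw => el; apply/mapP; exists (j, n).
    by rewrite mem_slope_index lj /N -el addnK coprime_addl c andbT /=; lia.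
  by rewrite /= /N -el !addnK.
Qed.

Lemma word2_RR es : conjp (aut (rr 2) (aut es (fw word2))) (aut es (fw word2))^-1.
Proof.
apply: conjp_trans (conjp_sym (aut_RR es _)) _; rewrite -autV; apply: conjp_aut.
by exists (fw [:: lB]); apply: val_inj.
Qed.

Lemma counted2 l : l <> 2%N -> l <> 4%N ->
  counted (fw word2) l (if odd l then 0 else 2 * totient l./2)%N.
Proof.
move=> l2 l4.
have ea : expo la (fw word2) = 2%N by rewrite expo_fw.
have eb : expo lb (fw word2) = 0%R by rewrite expo_fw.
have [rep hrep] : {rep : nat -> nat -> nat -> seq letter | forall j m n, coprime m n ->
    [/\ cycred (rep j m n), size (rep j m n) = (if m + n == 1 then 4 else 2 * (m + n))%N &
        conjp (fw (rep j m n)) (aut (rr j) (slope (fw word2) m n))]}.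
  suff /choice[f hf] : forall x : nat * nat * nat, exists w, coprime x.1.2 x.2 ->
      [/\ cycred w, size w = (if x.1.2 + x.2 == 1 then 4 else 2 * (x.1.2 + x.2))%N &
        conjp (fw w) (aut (rr x.1.1) (slope (fw word2) x.1.2 x.2))].
    by exists (fun j m n => f (j, m, n)) => j m n; exact: (hf (j, m, n)).
  move=> [[j m] n] /=; have [c|] := boolP (coprime m n); last by exists [::].
  have [w [cw sw h]] := slope2_cycred c; exists (iter j (map rotl) w) => _; split.
  - by rewrite cycred_rotl_iter.
  - by rewrite size_rotl_iter.
  - by rewrite -fw_rotl_iter; exact: conjp_aut.
pose N := (if odd l then 0 else l./2)%N; have oe := odd_double_half l.
have N1 : N != 1%N by rewrite /N; case: (odd l) oe => //= oe; apply/eqP; lia.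
pose s := [seq rep p.1 (N - p.2) p.2 | p <- slope_index 2 N].
have cop n : n < N -> coprime N n -> coprime (N - n) n.
  by move=> lt; rewrite -{1}(subnK (ltnW lt)) coprime_addl.
exists s; split.
- by rewrite size_map size_slope_index /N; case: ifP.
- move=> w /mapP[[j n]]; rewrite mem_slope_index => /and3P[lj ln c] -> /=.
  have [cw sw h] := hrep j _ _ (cop _ ln c); split=> //.
    rewrite sw subnK ?(ltnW ln) // (negPf N1) /N.
    by move: ln oe; rewrite /N; case: (odd l) => //=; lia.
  exists (rr j ++ zes (N - n + n) (N - n) n); by rewrite aut_cat.
- move=> i i'; rewrite size_map => li li'.
  rewrite !(nth_map (0, 0)%N) //.
  have := mem_nth (0, 0)%N li; have := mem_nth (0, 0)%N li'.
  case ei : (nth _ _ i) => [j n]; case ei' : (nth _ _ i') => [j' n'] /=.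
  rewrite !mem_slope_index => /and3P[lj' ln' c'] /and3P[lj ln c].
  have [_ _ h] := hrep j _ _ (cop _ ln c); have [_ _ h'] := hrep j' _ _ (cop _ ln' c').
  have m0 : 0 < N - n by lia.
  have m0' : 0 < N - n' by lia.
  have lj4 : j < 4 by lia.
  have lj4' : j' < 4 by lia.
  have fin : j = j' -> n = n' -> i = i'.
    move=> ej en; apply/eqP; rewrite -(nth_uniq (0, 0)%N li li' (slope_index_uniq _ _)).
    by rewrite ei ei' ej en.
  case=> hc.
    have [] // := slope_rr_inj word2L word2P word2LP ea eb _ (cop _ ln c) (cop _ ln' c') m0 m0' lj4 lj4'
      (conjp_trans (conjp_sym h) (conjp_trans hc h')).
    by move=> ej _ en; exact: fin.
  have hc' := conjp_trans (conjpV (conjp_sym h)) (conjp_trans hc h').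
  have [//|ej _ en] := slope_rr_injV word2L word2P word2LP ea eb _ (cop _ ln c) (cop _ ln' c') m0 m0' lj4 lj4' hc'.
  by case: j j' lj lj' ej {ei ei' h h' hc hc' lj4 lj4' fin} => [|[|j]] [|[|j']].
- move=> es; have [j [m [n [c m0 lj h]]]] := aut_slope word2L word2P word2LP word2S es.
  have [cw sw hw] := hrep (j %% 2) _ _ c; exists (rep (j %% 2) m n); split=> //.
    have hj : conjpm (aut (rr (j %% 2)) (slope (fw word2) m n))
        (aut (rr j) (slope (fw word2) m n)).
      case: j lj {h cw sw hw} => [|[|[|[|]]]] // _; try exact: conjpm_refl.
        by right; apply/conjp_sym/word2_RR.
      rewrite (aut_rrD 1 2); right; rewrite -autV; apply: conjp_aut.
      exact/conjp_sym/word2_RR.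
    by apply: conjpm_trans h; apply: conjpm_trans hj; left.
  rewrite sw; case: ifP => [_ /esym //|mn el]; apply/mapP; exists (j %% 2, n).
    rewrite mem_slope_index ltn_mod /= (_ : N = m + n)%N; last first.
      by rewrite /N; case: (odd l) oe => /=; lia.
    by rewrite coprime_addl c andbT; lia.
  have -> : (N - n = m)%N by rewrite /N; case: (odd l) oe => /=; lia.
  by [].
Qed.

Definition rootfree (x : free2) := forall (y : free2) n, 1 < n -> ~ conjp (y ^+ n) x.

Lemma rootfree_aut x es y n : rootfree x -> 1 < n -> ~ conjpm (y ^+ n) (aut es x).
Proof.
move=> rx n1 [|]; rewrite -1?expVgn => /(conjp_aut (esinv es)); rewrite autX esinvK;
  exact: rx.
Qed.

Lemma rootfree1 : rootfree (fw word1).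
Proof.
move=> y n n1 /(expo_conjp la); rewrite expo_fw expoX => e.
have /(congr1 absz) : (n%:Z * expo la y = 1)%R by rewrite -e.
by rewrite abszM /= => /eqP; rewrite muln_eq1 => /andP[/eqP]; lia.
Qed.

Lemma rootfree2 : rootfree (fw word2).
Proof.
move=> y n n1 h.
have n2 : n = 2.
  have := expo_conjp la h; rewrite expo_fw expoX => e.
  have /(congr1 absz) : (n%:Z * expo la y = 2)%R by rewrite -e.
  by rewrite abszM /=; case: `|_|%N => [|[|a]]; nia.
move: h; rewrite n2 expg2 => -[c ec].
have {ec} : (y ^ c) * (y ^ c) = fw word2 by rewrite -conjMg.
move: (y ^ c) => {n n1 n2 c} {}y ey.
have y1 : y != 1 by apply/eqP => y1; move: ey; rewrite y1 mulg1 => /(congr1 fword).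
have := size_mulg y y; rewrite ey -[size _]/4 => sy.
have sq := lcp_square y1; have {sy sq y1} : size y < 4 by lia.
case: y ey => [[|l1 [|l2 [|l3 [|]]]] ry] // /(congr1 fword) /=.
- by case: l1 ry.
- by case: l1 ry => /=; case: l2.
- by case: l1 ry => /=; case: l2 => //=; case: l3.
Qed.

End Count.

(** * Lifts along a local cocycle *)

Import Order.TTheory GRing.Theory Num.Theory.
Import numFieldNormedType.Exports.

Local Open Scope classical_set_scope.
Local Open Scope ring_scope.

Lemma interval_ind (R : realType) (a b : R) (P : R -> R -> Prop) : a <= b ->
  (forall u v w, a <= u -> u <= v -> v <= w -> w <= b -> P u v -> P v w -> P u w) ->
  (forall x, a <= x <= b -> exists2 e, 0 < e & forall u v,
     x - e < u -> v < x + e -> a <= u -> u <= x -> x <= v -> v <= b -> P u v) ->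
  P a b.
Proof.
move=> ab Padd Ploc; pose S := [set t | a <= t <= b /\ P a t].
have Sa : S a.
  split; first by rewrite lexx.
  have [|e e0 h] := Ploc a; first by rewrite lexx.
  by apply: h => //; lra.
have hS : has_sup S by split; [exists a | exists b => t [/andP[]]].
have cb : sup S <= b by apply: ge_sup => [|t [/andP[]] //]; exists a.
have ca : a <= sup S by apply: sup_upper_bound.
have [|e e0 h] := Ploc (sup S); first by rewrite ca.
have [t [/andP[at_ tb] Pt] et] := sup_adherent e0 hS.
have tc : t <= sup S by apply: sup_upper_bound => //; rewrite /S /= at_ tb.
pose v := Num.min b (sup S + e / 2).
have vb : v <= b by rewrite ge_min lexx.
have cv : sup S <= v by rewrite le_min cb; lra.
have ve : v < sup S + e by rewrite gt_min; apply/orP; right; lra.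
have Sv : S v.
  split; first by apply/andP; split; lra.
  by apply: (Padd a t v) => //; [lra | apply: h => //; lra].
have vc : v <= sup S by exact: sup_upper_bound.
have vE : v = b by move: vc; rewrite /v minEle; case: ifP => // _; lra.
by move: Sv => [_]; rewrite vE.
Qed.

Lemma withinP (X Z : topologicalType) (K : set X) (g : X -> Z) :
  {within K, continuous g} <->
  forall x, K x -> forall P, nbhs (g x) P -> \forall y \near x, K y -> P (g y).
Proof.
split=> [/subspace_continuousP h x Kx P /(h x Kx)|h]; first by [].
by apply/subspace_continuousP => x Kx P /(h x Kx).
Qed.

Lemma continuous_fst (X Z : topologicalType) : continuous (@fst X Z).
Proof. by move=> x; exact: cvg_fst. Qed.
Lemma continuous_snd (X Z : topologicalType) : continuous (@snd X Z).
Proof. by move=> x; exact: cvg_snd. Qed.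

Lemma continuous_pair (X Y Z : topologicalType) (f : X -> Y) (g : X -> Z) :
  continuous f -> continuous g -> continuous (fun x => (f x, g x)).
Proof.
move=> cf cg x P [[A B] /= [nA nB] h].
have nfg : \forall y \near x, A (f y) /\ B (g y) by apply: filterI; [exact: cf | exact: cg].
by apply: filterS nfg => y [Ay By]; exact: h.
Qed.
Lemma continuous_cst (X Z : topologicalType) (z : Z) : continuous (fun _ : X => z).
Proof. by move=> x; exact: cvg_cst. Qed.
Lemma continuous_idfun (X : topologicalType) : continuous (fun x : X => x).
Proof. by move=> x. Qed.

Section Lifts.
Local Open Scope group_scope.
Variables (Y : topologicalType) (G : groupType) (tau : Y -> Y -> G).

Definition local_cocycle := (forall p, tau p p = 1) /\
  (forall p, \forall q \near p, \forall q' \near q, tau p q' = tau p q * tau q q').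

Definition clift (X : topologicalType) (K : set X) (g : X -> Y) (f : X -> G) :=
  forall x, K x -> \forall y \near x, K y -> f y = f x * tau (g x) (g y).

Lemma lift_eq (X : topologicalType) (K : set X) g f g' f' :
  (forall x, K x -> g x = g' x) -> (forall x, K x -> f x = f' x) ->
  clift K g f -> clift K g' f'.
Proof.
move=> eg ef lf x Kx; apply: filterS (lf x Kx) => y h Ky.
by rewrite -!ef -?eg //; exact: h.
Qed.

Lemma lift_mull (X : topologicalType) (K : set X) g f c :
  clift K g f -> clift K g (fun x => c * f x).
Proof. by move=> lf x Kx; apply: filterS (lf x Kx) => y h Ky; rewrite h // mulgA. Qed.

Lemma lift_comp (X X' : topologicalType) (K : set X) (K' : set X') (r : X' -> X) g f :
  continuous r -> (forall x, K' x -> K (r x)) ->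
  clift K g f -> clift K' (g \o r) (f \o r).
Proof.
move=> cr rK lf x Kx; have n : \forall y \near x, K (r y) -> f (r y) = f (r x) * tau (g (r x)) (g (r y)) :=
  cr x _ (lf _ (rK _ Kx)).
apply: filterS n => y h Ky.
by apply: h; exact: rK.
Qed.

Lemma liftU (X : topologicalType) (K K' : set X) g f : closed K -> closed K' ->
  clift K g f -> clift K' g f -> clift (K `|` K') g f.
Proof.
have half (A B : set X) : closed B -> clift A g f -> clift B g f -> forall x, A x ->
    \forall y \near x, (A `|` B) y -> f y = f x * tau (g x) (g y).
  move=> cB lA lB x Ax; have [Bx|nBx] := pselect (B x).
    by apply: filterS2 (lA x Ax) (lB x Bx) => y hA hB []; [exact: hA | exact: hB].
  have nB : \forall y \near x, ~ B y by exact: open_nbhs_nbhs (conj (closed_openC cB) nBx).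
  by apply: filterS2 (lA x Ax) nB => y hA nBy [] // Ay; exact: hA.
move=> cK cK' l l' x [Kx|Kx]; first exact: half.
by rewrite setUC; exact: half.
Qed.

Lemma lift_glue (X : topologicalType) (K K' : set X) g f f' c : closed K -> closed K' ->
  clift K g f -> clift K' g f' -> (forall x, K x -> K' x -> f x = c * f' x) ->
  exists h, clift (K `|` K') g h.
Proof.
move=> cK cK' l l' e; exists (fun x => if `[< K x >] then f x else c * f' x).
apply: liftU => //; first by apply: lift_eq l => // x Kx; rewrite asboolT.
apply: lift_eq (lift_mull c l') => // x Kx; case: asboolP => // Kx'.
by rewrite e.
Qed.

Section Real.
Variable R : realType.

Lemma lift_uniq (a b : R) (g : R -> Y) f f' t : clift `[a, b] g f -> clift `[a, b] g f' ->
  a <= t <= b -> f t = f a * (f' a)^-1 * f' t.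
Proof.
move=> l l' /andP[ta tb]; suff : f a / f' a = f t / f' t by move=> ->; rewrite mulgVK.
apply: (interval_ind (P := fun u v => f u / f' u = f v / f' v)) => //.
  by move=> u v w _ _ _ _ -> ->.
move=> x /andP[xa xt]; have Kx : x \in `[a, b] by rewrite in_itv /= xa (le_trans xt).
have /nbhs_ballP[e e0 h] : \forall y \near x, y \in `[a, b] -> f y / f' y = f x / f' x.
  apply: filterS2 (l x Kx) (l' x Kx) => y h h' Ky.
  by rewrite (h Ky) (h' Ky) invgM !mulgA mulgK.
exists e => // u v xu vx au ux xv vt.
have inab y : a <= y -> y <= t -> y \in `[a, b] by rewrite in_itv /= => -> /le_trans->.
have bx y : x - e < y -> y < x + e -> ball x e y.
  by rewrite /ball /= ltr_distlC => -> ->.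
rewrite !h //; [apply: bx => //; lra | apply: inab => //; lra| apply: bx => //; lra| apply: inab => //; lra].
Qed.

Definition box (u v c d : R) : set (R * R) := [set p | u <= p.1 <= v /\ c <= p.2 <= d].

Lemma closed_box u v c d : closed (box u v c d).
Proof.
have -> : box u v c d = (fst @^-1` `[u, v]%classic) `&` (snd @^-1` `[c, d]%classic).
  by apply/seteqP; split=> -[x y]; rewrite /box /= !in_itv.
apply: closedI; apply: preimage_closed; try exact: itv_closed.
  by move=> x _; exact: continuous_fst.
by move=> x _; exact: continuous_snd.
Qed.

Lemma box_split2 u v c d e : c <= d -> d <= e ->
  box u v c d `|` box u v d e = box u v c e.
Proof.
move=> cd de; apply/seteqP; split=> -[x y]; rewrite /box /=.
  by move=> [] [-> /andP[h1 h2]]; split=> //; apply/andP; split; lra.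
move=> [-> /andP[h1 h2]]; have [yd|yd] := leP y d; [left|right]; split=> //;
  apply/andP; split => //; lra.
Qed.
Lemma box_split1 u v w c d : u <= v -> v <= w ->
  box u v c d `|` box v w c d = box u w c d.
Proof.
move=> uv vw; apply/seteqP; split=> -[x y]; rewrite /box /=.
  by move=> [] [/andP[h1 h2] ->]; split=> //; apply/andP; split; lra.
move=> [/andP[h1 h2] ->]; have [yd|yd] := leP x v; [left|right]; split=> //;
  apply/andP; split => //; lra.
Qed.

Variable H : R * R -> Y.
Hypothesis cocycle : local_cocycle.
Hypothesis cH : {within box 0 1%R 0 1%R, continuous H}.
Let ex_lift u v c d := exists f, clift (box u v c d) H f.

Lemma ex_lift_add2 u v c d e : u <= v -> c <= d -> d <= e ->
  ex_lift u v c d -> ex_lift u v d e -> ex_lift u v c e.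
Proof.
move=> uv cd de [f lf] [f' lf']; rewrite /ex_lift -(box_split2 _ _ cd de).
have cr : continuous (fun s : R => (s, d)).
  exact: continuous_pair (@continuous_idfun _) (@continuous_cst _ _ _).
apply: (lift_glue (c := f (u, d) * (f' (u, d))^-1) _ _ lf lf'); try exact: closed_box.
move=> [s y] [/= us /andP[_ yd]] [/= _ /andP[dy _]].
have -> : y = d by apply/eqP; rewrite eq_le yd dy.
apply: (lift_uniq (a := u) (b := v) (g := H \o (fun s : R => (s, d)))
  (f := f \o (fun s : R => (s, d))) (f' := f' \o (fun s : R => (s, d)))) us.
  by apply: lift_comp lf => // x /=; rewrite in_itv /box /= => ->; rewrite cd lexx.
by apply: lift_comp lf' => // x /=; rewrite in_itv /box /= => ->; rewrite de lexx.
Qed.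

Lemma ex_lift_add1 u v w c d : u <= v -> v <= w -> c <= d ->
  ex_lift u v c d -> ex_lift v w c d -> ex_lift u w c d.
Proof.
move=> uv vw cd [f lf] [f' lf']; rewrite /ex_lift -(box_split1 _ _ uv vw).
have cr : continuous (fun t : R => (v, t)).
  exact: continuous_pair (@continuous_cst _ _ _) (@continuous_idfun _).
apply: (lift_glue (c := f (v, c) * (f' (v, c))^-1) _ _ lf lf'); try exact: closed_box.
move=> [y t] [/= /andP[_ yv] ct] [/= /andP[vy _] _].
have -> : y = v by apply/eqP; rewrite eq_le yv vy.
apply: (lift_uniq (a := c) (b := d) (g := H \o (fun s : R => (v, s)))
  (f := f \o (fun s : R => (v, s))) (f' := f' \o (fun s : R => (v, s)))) ct.
  by apply: lift_comp lf => // x /=; rewrite in_itv /box /= => ->; rewrite uv lexx.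
by apply: lift_comp lf' => // x /=; rewrite in_itv /box /= => ->; rewrite vw lexx.
Qed.

Lemma ex_lift_local s t : box 0 1%R 0 1%R (s, t) -> exists2 e, 0 < e & forall u v c d,
  s - e < u -> v < s + e -> t - e < c -> d < t + e ->
  0 <= u -> v <= 1%R -> 0 <= c -> d <= 1%R -> ex_lift u v c d.
Proof.
have cHP := (withinP _ _).1 cH.
move=> Kx; have [t1 tM] := cocycle.
have /nbhs_ballP[e e0 h] := cHP _ Kx _ (tM (H (s, t))).
exists e => // u v c d su vs tc dt u0 v1 c0 d1.
exists (fun y => tau (H (s, t)) (H y)) => -[y1 y2] [/= /andP[uy yv] /andP[cy yd]].
have Ky : box 0 1%R 0 1%R (y1, y2) by split=> /=; apply/andP; split; lra.
have yb : ball (s, t) e (y1, y2).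
  by split; rewrite /= /ball /= ltr_distlC; apply/andP; split; lra.
have n := cHP _ Ky _ (h _ yb Ky); apply: filterS n => -[z1 z2] h' [/= /andP[uz zv] /andP[cz zd]].
by apply: h'; split=> /=; apply/andP; split; lra.
Qed.

Lemma homotopy_lift : exists f, clift (box 0 1%R 0 1%R) H f.
Proof.
have strip s : 0 <= s <= 1%R -> exists2 e, 0 < e & forall u v, s - e < u -> v < s + e ->
    0 <= u -> u <= v -> v <= 1%R -> ex_lift u v 0 1%R.
  move=> s01.
  apply: (interval_ind (P := fun c d => exists2 e : R, 0 < e & forall u v,
    s - e < u -> v < s + e -> 0 <= u -> u <= v -> v <= 1%R -> ex_lift u v c d)) => //.
    move=> c d e c0 cd de e1 [r r0 hr] [r' r'0 hr'].
    exists (Num.min r r'); first by rewrite lt_min r0.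
    move=> u v; rewrite ltrBlDr -ltrBlDl lt_min -ltrBlDl lt_min => /andP[h1 h2] /andP[h3 h4] u0 uv v1.
    by apply: (ex_lift_add2 (d := d)) => //; [apply: hr => //; lra | apply: hr' => //; lra].
  move=> t t01; have [|e e0 h] := @ex_lift_local s t; first by split.
  exists e => // c d tc dt c0 ct td d1; exists e => // u v su vs u0 uv v1.
  exact: h.
apply: (interval_ind (P := fun u v => ex_lift u v 0 1%R)) => //.
  by move=> u v w u0 uv vw w1; apply: ex_lift_add1.
move=> s /strip[e e0 h]; exists e => // u v su vs u0 us sv v1; apply: h => //.
exact: le_trans us sv.
Qed.

End Real.
End Lifts.

(** * Holonomy *)

Section Holonomy.
Local Open Scope group_scope.
Variables (R : realType) (Y : topologicalType) (G : groupType) (tau : Y -> Y -> G).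
Hypothesis cocycle : local_cocycle tau.
Implicit Types (a b c : R) (g : R -> Y) (k : G).

Definition holp a b g k := exists2 f, clift tau `[a, b] g f & k = (f a)^-1 * f b.

Lemma holp_uniq a b g k k' : (a <= b)%R -> holp a b g k -> holp a b g k' -> k = k'.
Proof.
move=> ab [f lf ->] [f' lf' ->].
by rewrite (lift_uniq lf lf' (t := b)) ?ab ?lexx // !mulgA mulVg mul1g.
Qed.

Lemma holp_ext a b g g' k : (forall t, (a <= t <= b)%R -> g t = g' t) ->
  holp a b g k -> holp a b g' k.
Proof.
move=> e [f lf ->]; exists f => //; by apply: lift_eq lf => // t; rewrite /= in_itv /=; exact: e.
Qed.

Lemma holp_cat a b c g k k' : (a <= b)%R -> (b <= c)%R ->
  holp a b g k -> holp b c g k' -> holp a c g (k * k').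
Proof.
move=> ab bc [f lf ->] [f' lf' ->].
pose h t := if (t <= b)%R then f t else f b * (f' b)^-1 * f' t.
have hl t : (t <= b)%R -> h t = f t by rewrite /h => ->.
have hr t : (b <= t)%R -> h t = f b * (f' b)^-1 * f' t.
  move=> bt; rewrite /h; case: ifP => // tb.
  by have -> : t = b by [apply/eqP; rewrite eq_le tb bt]; rewrite mulgVK.
exists h; last by rewrite hl // hr // !mulgA.
have -> : `[a, c]%classic = `[a, b]%classic `|` `[b, c]%classic.
  apply/seteqP; split=> t; rewrite /= !in_itv /=.
    move=> /andP[h1 h2]; have [tb|tb] := leP t b; [left|right]; apply/andP; split; lra.
  by move=> [] /andP[h1 h2]; apply/andP; split; lra.
apply: liftU; try exact: itv_closed.
  by apply: lift_eq lf => // t; rewrite /= in_itv /= => /andP[_ tb]; rewrite hl.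
apply: lift_eq (lift_mull _ lf') => // t; rewrite /= in_itv /= => /andP[bt _].
by rewrite hr.
Qed.

Lemma holp_comp a b a' b' r g k : continuous r ->
  (forall t, (a' <= t <= b')%R -> (a <= r t <= b)%R) -> r a' = a -> r b' = b ->
  holp a b g k -> holp a' b' (g \o r) k.
Proof.
move=> cr hr ra rb [f lf ->]; exists (f \o r); last by rewrite /= ra rb.
by apply: lift_comp lf => // t; rewrite /= !in_itv /=; exact: hr.
Qed.

Lemma holp_compV a b a' b' r g k : continuous r ->
  (forall t, (a' <= t <= b')%R -> (a <= r t <= b)%R) -> r a' = b -> r b' = a ->
  holp a b g k -> holp a' b' (g \o r) k^-1.
Proof.
move=> cr hr ra rb [f lf ->]; exists (f \o r); last by rewrite /= ra rb invgM invgK.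
by apply: lift_comp lf => // t; rewrite /= !in_itv /=; exact: hr.
Qed.

Lemma holp_cst a b (y : Y) : holp a b (fun _ => y) 1.
Proof.
exists (fun _ => 1); last by rewrite mulg1 invg1.
by move=> t _; apply: filterS filterT => u _ _; rewrite (proj1 cocycle) mulg1.
Qed.

Lemma hol_square (H : R * R -> Y) : {within box 0 1%R 0 1%R, continuous H} ->
  exists c0 c1 k k' : G, [/\ holp 0 1%R (fun s => H (s, 0)) c0, holp 0 1%R (fun s => H (s, 1%R)) c1,
    holp 0 1%R (fun t => H (0, t)) k, holp 0 1%R (fun t => H (1%R, t)) k' & c0 * k' = k * c1].
Proof.
move=> cH; have [f lf] := homotopy_lift cocycle cH.
have i0 : (0 <= (0 : R) <= 1)%R by rewrite lexx ler01.
have i1 : (0 <= (1 : R) <= 1)%R by rewrite lexx ler01.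
have l1 (t : R) : (0 <= t <= 1)%R ->
    clift tau (`[0%R, 1%R] : set R) (fun s => H (s, t)) (fun s => f (s, t)).
  move=> t01; apply: (@lift_comp _ _ tau _ _ _ _ (fun s : R => (s, t)) _ _ _ _ lf).
    exact: continuous_pair (@continuous_idfun _) (@continuous_cst _ _ _).
  by move=> x /=; rewrite in_itv.
have l2 (t : R) : (0 <= t <= 1)%R ->
    clift tau (`[0%R, 1%R] : set R) (fun s => H (t, s)) (fun s => f (t, s)).
  move=> t01; apply: (@lift_comp _ _ tau _ _ _ _ (fun s : R => (t, s)) _ _ _ _ lf).
    exact: continuous_pair (@continuous_cst _ _ _) (@continuous_idfun _).
  by move=> x /=; rewrite in_itv.
exists ((f (0, 0))^-1 * f (1%R, 0)), ((f (0, 1%R))^-1 * f (1%R, 1%R)).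
exists ((f (0, 0))^-1 * f (0, 1%R)), ((f (1%R, 0))^-1 * f (1%R, 1%R)).
split; [exists (fun s => f (s, 0)) | exists (fun s => f (s, 1%R)) | exists (fun s => f (0, s))
  | exists (fun s => f (1%R, s)) | by rewrite !mulgA !mulgK] => //; by [exact: l1 | exact: l2].
Qed.

Lemma hol_exists g : {within `[0, 1%R], continuous g} -> exists k, holp 0 1%R g k.
Proof.
move=> /withinP cg.
have [|c0 [c1 [k [k' [_ _ hk _ _]]]]] := @hol_square (g \o snd); last by exists k.
apply/withinP => -[s t] [/= _ ht] P nP.
have Kt : (`[0%R, 1%R]%classic : set R) t by rewrite /= in_itv.
have n : \forall y \near (s, t), (`[0%R, 1%R]%classic : set R) y.2 -> P (g y.2).
  exact: (@continuous_snd _ _ (s, t) _ (cg t Kt P nP)).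
by apply: filterS n => y h [_ yt]; apply: h; rewrite /= in_itv.
Qed.

Lemma holp_equiv (h : Y -> Y) (psi : G -> G) (c : Y -> G) a b g k :
  {morph psi : x y / x * y} -> {morph psi : x / x^-1} ->
  (forall p, \forall q \near p, tau (h p) (h q) = (c p)^-1 * psi (tau p q) * c q) ->
  {within `[a, b], continuous g} -> holp a b g k ->
  holp a b (h \o g) ((c (g a))^-1 * psi k * c (g b)).
Proof.
move=> psiM psiV hc /withinP cg [f lf ->].
exists (fun t => psi (f t) * c (g t)); last by rewrite psiM psiV invgM !mulgA.
move=> t Kt; apply: filterS2 (lf t Kt) (cg t Kt _ (hc (g t))) => y hf hg Ky.
by rewrite /= (hf Ky) (hg Ky) psiM !mulgA mulgK.
Qed.

End Holonomy.

(** * The punctured torus *)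

Section RealFunctions.
Variables (R : realType) (X : topologicalType).
Implicit Types f g : X -> R.
Lemma contD f g : continuous f -> continuous g -> continuous (fun x => f x + g x).
Proof. by move=> cf cg x; exact: cvgD (cf x) (cg x). Qed.
Lemma contN f : continuous f -> continuous (fun x => - f x).
Proof. by move=> cf x; exact: cvgN (cf x). Qed.
Lemma contM f g : continuous f -> continuous g -> continuous (fun x => f x * g x).
Proof. by move=> cf cg x; exact: cvgM (cf x) (cg x). Qed.
Lemma near_lt f x c : continuous f -> f x < c -> \forall y \near x, f y < c.
Proof. by move=> cf fx; exact: (cf x _ (open_nbhs_nbhs (conj (@open_lt R c) fx))). Qed.
Lemma near_gt f x c : continuous f -> c < f x -> \forall y \near x, c < f y.
Proof. by move=> cf fx; exact: (cf x _ (open_nbhs_nbhs (conj (@open_gt R c) fx))). Qed.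
End RealFunctions.

Lemma continuous_comp2 (X Y Z : topologicalType) (f : X -> Y) (g : Y -> Z) :
  continuous f -> continuous g -> continuous (g \o f).
Proof. by move=> cf cg x; apply: continuous_comp; [exact: cf | exact: cg]. Qed.

Section Torus.
Variable R : realType.
Notation T := (ptorus R).

Definition tcoord (p : T) : (R * R) * (R * R) := set_val p.
Notation z1 p := (tcoord p).1.1.
Notation z2 p := (tcoord p).1.2.
Notation w1 p := (tcoord p).2.1.
Notation w2 p := (tcoord p).2.2.

Lemma continuous_tcoord : continuous tcoord.
Proof. exact: initial_continuous. Qed.

Lemma continuous_into_torus (X : topologicalType) (f : X -> T) :
  continuous (tcoord \o f) -> continuous f.
Proof. exact: continuous_comp_initial. Qed.

Lemma cont_z1 : continuous (fun p : T => z1 p).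
Proof. exact: continuous_comp2 continuous_tcoord (continuous_comp2 (@continuous_fst _ _) (@continuous_fst _ _)). Qed.
Lemma cont_z2 : continuous (fun p : T => z2 p).
Proof. exact: continuous_comp2 continuous_tcoord (continuous_comp2 (@continuous_fst _ _) (@continuous_snd _ _)). Qed.
Lemma cont_w1 : continuous (fun p : T => w1 p).
Proof. exact: continuous_comp2 continuous_tcoord (continuous_comp2 (@continuous_snd _ _) (@continuous_fst _ _)). Qed.
Lemma cont_w2 : continuous (fun p : T => w2 p).
Proof. exact: continuous_comp2 continuous_tcoord (continuous_comp2 (@continuous_snd _ _) (@continuous_snd _ _)). Qed.

Definition on_torus (v : (R * R) * (R * R)) :=
  [/\ v.1.1 ^+ 2 + v.1.2 ^+ 2 = 1, v.2.1 ^+ 2 + v.2.2 ^+ 2 = 1 & ~ (v.1.1 = 1 /\ v.2.1 = 1)].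

Lemma on_torusP v : on_torus v <-> @punctured_torus_set R v.
Proof.
case: v => [[a b] [c d]]; rewrite /on_torus /punctured_torus_set /circle /=.
split=> [[h1 h2 h3]|[[h1 h2] h3]]; split=> //.
  by move=> [ea _ ec _]; apply: h3.
move=> [ea ec]; apply: h3.
have eb : b ^+ 2 = 0 by rewrite ea in h1; lra.
have ed : d ^+ 2 = 0 by rewrite ec in h2; lra.
by move/eqP: eb; move/eqP: ed; rewrite !expf_eq0 /= => /eqP-> /eqP->; rewrite ea ec.
Qed.

Lemma tcoordP p : on_torus (tcoord p).
Proof. by apply/on_torusP; exact: set_valP. Qed.

Definition tmk v (h : on_torus v) : T := SigSub (mem_set ((on_torusP v).1 h)).
Lemma tmkK v (h : on_torus v) : tcoord (tmk h) = v.
Proof. by []. Qed.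

Lemma tcoord_inj : injective tcoord.
Proof. exact: val_inj. Qed.

(* A point lies on the arc [z = 1], on the arc [w = 1], or in the open square
   left by cutting along these two arcs. *)
Variant square_spec (p : T) : bool -> bool -> Prop :=
| OnZ of z1 p = 1 & z2 p = 0 & w1 p < 1 : square_spec p true false
| OnW of w1 p = 1 & w2 p = 0 & z1 p < 1 : square_spec p false true
| OffZW of z1 p < 1 & w1 p < 1 : square_spec p false false.

Lemma le1_circle (x y : R) : x ^+ 2 + y ^+ 2 = 1 -> x <= 1.
Proof. by move=> h; nra. Qed.

Lemma squareP p : square_spec p (z1 p == 1) (w1 p == 1).
Proof.
have [hz hw hp] := tcoordP p; have := le1_circle hz; have := le1_circle hw.
have [ez|nz] := eqVneq (z1 p) 1; have [ew|nw] := eqVneq (w1 p) 1 => lw lz.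
- by case: hp.
- apply: OnZ => //; last by rewrite lt_neqAle nw.
  by apply/eqP; rewrite -sqrf_eq0; apply/eqP; rewrite ez in hz; lra.
- apply: OnW => //; last by rewrite lt_neqAle nz.
  by apply/eqP; rewrite -sqrf_eq0; apply/eqP; rewrite ew in hw; lra.
- by apply: OffZW; rewrite lt_neqAle ?nz ?nw.
Qed.

Lemma circle_z2 (x y : R) : x ^+ 2 + y ^+ 2 = 1 -> 0 < x -> x < 1 -> y != 0.
Proof. by move=> h x0 x1; apply/eqP => y0; rewrite y0 in h; nra. Qed.

(* The crossing made on the way from [p] to a nearby point [q]; the points of
   an arc count as lying on its positive side. *)
Definition tau (p q : T) : free2 :=
  (if z1 p == 1%R then if z2 q < 0 then xa^-1 else 1
   else if w1 p == 1%R then if w2 q < 0 then xb^-1 else 1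
   else 1)%g.

Lemma tau_off p q : z1 p < 1 -> w1 p < 1 -> tau p q = 1%g.
Proof. by move=> h h'; rewrite /tau (lt_eqF h) (lt_eqF h'). Qed.

Lemma near_sign (f : T -> R) q : continuous f -> f q != 0 ->
  \forall q' \near q, (f q' < 0) = (f q < 0).
Proof.
move=> cf; rewrite neq_lt => /orP[h|h].
  by apply: filterS (near_lt cf h) => q' ->; rewrite h.
by apply: filterS (near_gt cf h) => q' h'; rewrite !ltNge !ltW.
Qed.

Lemma tau_cocycle : local_cocycle tau.
Proof.
split=> p.
  rewrite /tau; case: squareP => [_ -> _|_ -> _|_ _]; rewrite ?ltxx //.
rewrite /tau; case: squareP => [p1 p2 p3|p1 p2 p3|p1 p2].
- have z0 : 0 < z1 p by rewrite p1.
  apply: filterS2 (near_gt cont_z1 z0) (near_lt cont_w1 p3) => q qz qw.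
  have [hz _ _] := tcoordP q; case: squareP => [q1 q2 q3|q1 q2 q3|q1 q2].
  + by apply: filterS filterT => q' _; rewrite q2 ltxx mul1g.
  + by rewrite q1 ltxx in qw.
  + apply: filterS (near_sign cont_z2 (circle_z2 hz qz q1)) => q' ->.
    by rewrite mulg1.
- have w0 : 0 < w1 p by rewrite p1.
  apply: filterS2 (near_gt cont_w1 w0) (near_lt cont_z1 p3) => q qw qz.
  have [_ hw _] := tcoordP q; case: squareP => [q1 q2 q3|q1 q2 q3|q1 q2].
  + by rewrite q1 ltxx in qz.
  + by apply: filterS filterT => q' _; rewrite q2 ltxx mul1g.
  + apply: filterS (near_sign cont_w2 (circle_z2 hw qw q2)) => q' ->.
    by rewrite mulg1.
- apply: filterS2 (near_lt cont_z1 p1) (near_lt cont_w1 p2) => q q1 q2.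
  rewrite (lt_eqF q1) (lt_eqF q2).
  by apply: filterS filterT => q' _; rewrite mulg1.
Qed.

Definition homeo (h : T -> T) :=
  exists k : T -> T, [/\ continuous h, continuous k, cancel h k & cancel k h].

Definition realises (e : elem) := exists h (c : T -> free2), homeo h /\
  forall p, \forall q \near p, tau (h p) (h q) = ((c p)^-1 * act e (tau p q) * c q)%g.

Lemma act1 e : act e 1%g = 1%g. Proof. exact: aut1 [:: e]. Qed.
Lemma actV e x : act e x^-1%g = (act e x)^-1%g. Proof. exact: autV [:: e] x. Qed.

Lemma swap_on p : on_torus ((tcoord p).2, (tcoord p).1).
Proof. by have [h1 h2 h3] := tcoordP p; split=> //= -[e1 e2]; apply: h3. Qed.
Definition tswap p := tmk (swap_on p).

Lemma tau_swap p q : tau (tswap p) (tswap q) = act Esw (tau p q).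
Proof.
rewrite /tau /tswap /=.
by case: squareP => *; do ?case: ifP; rewrite ?act1 ?actV // => *; apply: val_inj.
Qed.

Lemma continuous_tswap : continuous tswap.
Proof.
apply: continuous_into_torus; apply: continuous_pair.
  exact: continuous_comp2 continuous_tcoord (@continuous_snd _ _).
exact: continuous_comp2 continuous_tcoord (@continuous_fst _ _).
Qed.

Lemma realises_swap : realises Esw.
Proof.
exists tswap, (fun _ => 1%g); split.
  exists tswap; split; try exact: continuous_tswap;
    by move=> p; apply: tcoord_inj; rewrite /tswap !tmkK; case: (tcoord p).
by move=> p; apply: filterS filterT => q _; rewrite mulg1 invg1 mul1g tau_swap.
Qed.

Lemma inv_on p : on_torus ((z1 p, - z2 p), (tcoord p).2).
Proof. by have [h1 h2 h3] := tcoordP p; split; rewrite //= sqrrN. Qed.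
Definition tinv p := tmk (inv_on p).

Lemma realises_inv : realises Einv.
Proof.
exists tinv, (fun q => if z1 q == 1 then xa else 1%g); split.
  have ct : continuous tinv.
    apply: continuous_into_torus; apply: continuous_pair.
      apply: continuous_pair; [exact: cont_z1 | exact: contN cont_z2].
    exact: continuous_comp2 continuous_tcoord (@continuous_snd _ _).
  exists tinv; split=> // p; apply: tcoord_inj; rewrite /tinv !tmkK /= opprK;
    by case: (tcoord p) => [[]].
move=> p; rewrite /tau /=; case: squareP => [p1 p2 p3|p1 p2 p3|p1 p2].
- have z0 : 0 < z1 p by rewrite p1.
  apply: filterS2 (near_gt cont_z1 z0) (near_lt cont_w1 p3) => q qz qw.
  have [hz _ _] := tcoordP q; case: squareP => [q1 q2 q3|q1 q2 q3|q1 q2].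
  + by rewrite q2 oppr0 ltxx act1 mulg1 mulVg.
  + by rewrite q1 ltxx in qw.
  + rewrite oppr_lt0; have := circle_z2 hz qz q1; case: ltgtP => // _ _.
      by rewrite act1 !mulg1.
    by rewrite actV mulg1; apply: val_inj.
- apply: filterS (near_lt cont_z1 p3) => q qz; rewrite (lt_eqF qz) invg1 mulg1 mul1g.
  by case: ifP; rewrite ?act1 // actV => _; apply: val_inj.
- apply: filterS (near_lt cont_z1 p1) => q qz; rewrite (lt_eqF qz).
  by rewrite act1 invg1 !mulg1.
Qed.

Definition cmul (x y : R * R) : R * R := (x.1 * y.1 - x.2 * y.2, x.1 * y.2 + x.2 * y.1).
Definition conj (x : R * R) : R * R := (x.1, - x.2).

Lemma eq1_circle (x y : R) : x ^+ 2 + y ^+ 2 = 1 -> x = 1 -> y = 0.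
Proof.
by move=> h e; apply/eqP; rewrite -sqrf_eq0; apply/eqP; rewrite e in h; lra.
Qed.

Lemma shear_on p : on_torus (cmul (tcoord p).1 (tcoord p).2, (tcoord p).2).
Proof.
have [h1 h2 h3] := tcoordP p; split=> //=.
  have <- : (z1 p ^+ 2 + z2 p ^+ 2) * (w1 p ^+ 2 + w2 p ^+ 2) = 1 by rewrite h1 h2 mulr1.
  by ring.
move=> [e1 e2]; apply: h3; split=> //.
by move: e1; rewrite e2 (eq1_circle h2 e2) mulr0 subr0 mulr1.
Qed.
Definition tshear p := tmk (shear_on p).

Lemma unshear_on p : on_torus (cmul (tcoord p).1 (conj (tcoord p).2), (tcoord p).2).
Proof.
have [h1 h2 h3] := tcoordP p; split=> //=.
  have <- : (z1 p ^+ 2 + z2 p ^+ 2) * (w1 p ^+ 2 + w2 p ^+ 2) = 1 by rewrite h1 h2 mulr1.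
  by ring.
move=> [e1 e2]; apply: h3; split=> //.
by move: e1; rewrite e2 (eq1_circle h2 e2) oppr0 mulr0 subr0 mulr1.
Qed.
Definition tunshear p := tmk (unshear_on p).

Lemma homeo_shear : homeo tshear.
Proof.
exists tunshear; split.
- apply: continuous_into_torus; apply: continuous_pair; last first.
    exact: continuous_comp2 continuous_tcoord (@continuous_snd _ _).
  apply: continuous_pair.
    exact: contD (contM cont_z1 cont_w1) (contN (contM cont_z2 cont_w2)).
  exact: contD (contM cont_z1 cont_w2) (contM cont_z2 cont_w1).
- apply: continuous_into_torus; apply: continuous_pair; last first.
    exact: continuous_comp2 continuous_tcoord (@continuous_snd _ _).
  apply: continuous_pair.
    exact: contD (contM cont_z1 cont_w1) (contN (contM cont_z2 (contN cont_w2))).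
  exact: contD (contM cont_z1 (contN cont_w2)) (contM cont_z2 cont_w1).
- move=> p; apply: tcoord_inj; rewrite /tshear /tunshear !tmkK /=.
  have [_ h _] := tcoordP p; move: h; case: (tcoord p) => [[a b] [c d]] /= h.
  by rewrite /cmul /=; congr ((_, _), _); rewrite -[RHS]mulr1 -h; ring.
- move=> p; apply: tcoord_inj; rewrite /tshear /tunshear !tmkK /=.
  have [_ h _] := tcoordP p; move: h; case: (tcoord p) => [[a b] [c d]] /= h.
  by rewrite /cmul /=; congr ((_, _), _); rewrite -[RHS]mulr1 -h; ring.
Qed.

(* On the open square, with half-angle cotangents [x] and [y] of the two
   coordinates, [diag] is a positive multiple of [x + y]: its zero set is the
   arc [z w = 1], and it is negative beyond it. *)
Definition diag (p : T) := z2 p * (1 - w1 p) + w2 p * (1 - z1 p).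

Lemma cont_diag : continuous diag.
Proof.
have c1 (f : T -> R) : continuous f -> continuous (fun p => 1 - f p).
  by move=> cf; exact: contD (@continuous_cst _ R 1) (contN cf).
apply: contD; apply: contM; by [exact: cont_z2 | exact: cont_w2 | apply: c1; exact: cont_w1 | apply: c1; exact: cont_z1].
Qed.

Lemma diag_z p : diag p * (1 + z1 p) = z2 p * ((1 - w1 p) * (1 + z1 p) + w2 p * z2 p).
Proof.
have [h _ _] := tcoordP p; have := congr1 ( *%R (w2 p)) h; rewrite /diag; move=> e; lra.
Qed.
Lemma diag_w p : diag p * (1 + w1 p) = w2 p * ((1 - z1 p) * (1 + w1 p) + w2 p * z2 p).
Proof.
have [_ h _] := tcoordP p; have := congr1 ( *%R (z2 p)) h; rewrite /diag; move=> e; lra.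
Qed.
Lemma diag_im p : 2 * (1 - z1 p) * (1 - w1 p) * (z1 p * w2 p + z2 p * w1 p) =
  (z2 p * w2 p - (1 - z1 p) * (1 - w1 p)) * diag p.
Proof.
have [hz hw _] := tcoordP p; rewrite /diag.
have := congr1 ( *%R (w2 p * (1 - w1 p))) hz; have := congr1 ( *%R (z2 p * (1 - z1 p))) hw.
move=> e1 e2; lra.
Qed.
Lemma diag_re p : 2 * (1 - z1 p) * (1 - w1 p) * (1 - (z1 p * w1 p - z2 p * w2 p)) = diag p ^+ 2.
Proof.
have [hz hw _] := tcoordP p; rewrite /diag.
have := congr1 ( *%R ((1 - w1 p) ^+ 2)) hz; have := congr1 ( *%R ((1 - z1 p) ^+ 2)) hw.
move=> e1 e2; lra.
Qed.

Definition beyond (q : T) : free2 :=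
  if [&& z1 q < 1, w1 q < 1 & diag q <= 0] then xa else 1%g.

Lemma tau_shear_off p q : z1 p * w1 p - z2 p * w2 p < 1 -> w1 p < 1 ->
  tau (tshear p) (tshear q) = 1%g.
Proof. by move=> h1 h2; rewrite tau_off. Qed.

Lemma act_lam_a : act Elam xa^-1%g = xa^-1%g. Proof. exact: val_inj. Qed.
Lemma act_lam_b : act Elam xb^-1%g = (xb^-1 * xa^-1)%g. Proof. exact: val_inj. Qed.

Lemma cont_sub1 (f : T -> R) : continuous f -> continuous (fun p => 1 - f p).
Proof. by move=> cf; exact: contD (@continuous_cst _ R 1) (contN cf). Qed.
Lemma cont_add1 (f : T -> R) : continuous f -> continuous (fun p => 1 + f p).
Proof. by move=> cf; exact: contD (@continuous_cst _ R 1) cf. Qed.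

Lemma mul_sign (x y d b : R) : 0 < y -> 0 < b -> d * y = x * b -> (d <= 0) = (x <= 0).
Proof.
move=> y0 b0 e; rewrite -(pmulr_lle0 d y0) e.
by rewrite pmulr_lle0.
Qed.

Lemma realises_lam : realises Elam.
Proof.
exists tshear, beyond; split; first exact: homeo_shear.
move=> p; case: (squareP p) (erefl (z1 p == 1)) => [p1 p2 p3|p1 p2 p3|p1 p2] _.
- have z0 : 0 < z1 p by rewrite p1.
  have b0 : 0 < (1 - w1 p) * (1 + z1 p) + w2 p * z2 p by rewrite p1 p2; lra.
  have cb : continuous (fun p : T => (1 - w1 p) * (1 + z1 p) + w2 p * z2 p).
    by apply: contD; apply: contM; [exact: cont_sub1 cont_w1 | exact: cont_add1 cont_z1 | exact: cont_w2 | exact: cont_z2].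
  apply: filterS3 (near_gt cont_z1 z0) (near_lt cont_w1 p3) (near_gt cb b0) => q qz qw qb.
  rewrite tau_shear_off ?p1 ?p2 ?mul0r ?mul1r ?subr0 // /tau p1 eqxx.
  rewrite /beyond p1 ltxx invg1 mul1g qw /=.
  have [hz _ _] := tcoordP q; case: (squareP q) qw (erefl (w1 q)) => [q1 q2 q3|q1 q2 q3|q1 q2] qw _.
  + by rewrite q1 q2 !ltxx act1 mul1g.
  + by rewrite q1 ltxx in qw.
  + have y0 : 0 < 1 + z1 q by lra.
    rewrite q1 (mul_sign y0 qb (diag_z q)).
    have := circle_z2 hz qz q1; case: ltgtP => // _ _; first by rewrite act_lam_a mulVg.
    by rewrite act1 mul1g.
- have w0 : 0 < w1 p by rewrite p1.
  have b0 : 0 < (1 - z1 p) * (1 + w1 p) + w2 p * z2 p by rewrite p1 p2; lra.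
  have cb : continuous (fun p : T => (1 - z1 p) * (1 + w1 p) + w2 p * z2 p).
    by apply: contD; apply: contM; [exact: cont_sub1 cont_z1 | exact: cont_add1 cont_w1 | exact: cont_w2 | exact: cont_z2].
  apply: filterS3 (near_gt cont_w1 w0) (near_lt cont_z1 p3) (near_gt cb b0) => q qw qz qb.
  rewrite /tau /= p1 p2 eqxx mulr0 subr0 mulr1 (lt_eqF p3).
  rewrite /beyond p1 ltxx andbF invg1 mul1g qz /=.
  have [_ hw _] := tcoordP q; case: (squareP q) qz (erefl (w1 q)) => [q1 q2 q3|q1 q2 q3|q1 q2] qz _.
  + by rewrite q1 ltxx in qz.
  + by rewrite q1 q2 !ltxx act1 mul1g.
  + have y0 : 0 < 1 + w1 q by lra.
    rewrite q2 (mul_sign y0 qb (diag_w q)).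
    have := circle_z2 hw qw q2; case: ltgtP => // _ _; first by rewrite act_lam_b mulgVK.
    by rewrite act1 mul1g.
- have [hz hw _] := tcoordP p; have hr := diag_re p; have hi := diag_im p.
  have [[_ _ _] [hzq _ _]] := (tcoordP p, tcoordP (tshear p)).
  have := le1_circle hzq; rewrite /= le_eqVlt => /orP[/eqP re1|re1]; last first.
    have d0 : diag p != 0.
      apply/eqP => d0; move: hr; rewrite d0 expr0n /=; apply/eqP.
      by rewrite !mulf_neq0 ?pnatr_eq0 // subr_eq0 gt_eqF.
    have nd := near_sign (contN cont_diag) (q := p); rewrite oppr_eq0 in nd.
    apply: filterS3 (near_lt cont_z1 p1) (near_lt cont_w1 p2) (nd d0) => q q1 q2.
    rewrite !oppr_lt0 !ltNge => /(congr1 negb); rewrite !negbK => ed.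
    rewrite tau_shear_off // tau_off // act1 mulg1 /beyond p1 p2 q1 q2 ed /=.
    by rewrite mulVg.
  have d0 : diag p = 0.
    by apply/eqP; rewrite -sqrf_eq0 -hr re1 subrr mulr0.
  have b0 : 0 < (1 - z1 p) * (1 - w1 p) - z2 p * w2 p.
    have : 0 < (1 - z1 p) * (1 - w1 p) by rewrite mulr_gt0 ?subr_gt0.
    have : z1 p * w2 p + z2 p * w1 p = 0 by exact: eq1_circle hzq re1.
    move: re1 => /=; nra.
  have cb : continuous (fun p : T => (1 - z1 p) * (1 - w1 p) - z2 p * w2 p).
    apply: contD; last apply: contN; apply: contM;
      by [exact: cont_sub1 cont_z1 | exact: cont_sub1 cont_w1 | exact: cont_w2 | exact: cont_z2].
  apply: filterS3 (near_lt cont_z1 p1) (near_lt cont_w1 p2) (near_gt cb b0) => q q1 q2 qb.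
  rewrite (tau_off _ p1 p2) act1 mulg1 /beyond p1 p2 q1 q2 d0 lexx /=.
  rewrite /tau /= re1 eqxx.
  have a0 : 0 < 2 * (1 - z1 q) * (1 - w1 q) by rewrite !mulr_gt0 ?subr_gt0.
  have e : (- (z1 q * w2 q + z2 q * w1 q)) * (2 * (1 - z1 q) * (1 - w1 q)) =
      diag q * ((1 - z1 q) * (1 - w1 q) - z2 q * w2 q).
    by have := diag_im q; lra.
  have := mul_sign a0 qb e; rewrite oppr_le0 leNgt => <-.
  by case: ltP => _ /=; rewrite ?mulVg ?mulg1.
Qed.

Lemma realises_elem e : realises e.
Proof. by case: e; [exact: realises_swap | exact: realises_inv | exact: realises_lam]. Qed.

Lemma homeo_comp h h' : homeo h -> homeo h' -> homeo (h \o h').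
Proof.
move=> [k [ch ck hk kh]] [k' [ch' ck' hk' kh']]; exists (k' \o k); split.
- exact: continuous_comp2.
- exact: continuous_comp2.
- by move=> x /=; rewrite hk hk'.
- by move=> x /=; rewrite kh' kh.
Qed.

Lemma realises_aut es : exists2 h, homeo h & forall (g : R -> T) k,
  continuous g -> g 1 = g 0 -> holp tau 0 1 g k ->
  exists2 k', conjp (aut es k) k' & holp tau 0 1 (h \o g) k'.
Proof.
elim: es => [|e es [h hh IH]].
  exists id; first by exists id; split=> //; exact: continuous_idfun.
  by move=> g k _ _ hk; exists k => //; exact: conjp_refl.
have [h' [c [hh' hc]]] := realises_elem e; exists (h' \o h); first exact: homeo_comp.
move=> g k cg g1 hk; have [k' kk' hk'] := IH g k cg g1 hk.
have [hi [ch _ _ _]] := hh.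
exists (act e k' ^ c (h (g 0)))%g.
  by apply: conjp_trans (conjp_aut [:: e] kk') _; exists (c (h (g 0))).
have := holp_equiv (autM [:: e]) (autV [:: e]) hc (continuous_subspaceT _) hk'.
by rewrite /= g1 /conjg mulgA; apply; exact: continuous_comp2.
Qed.

End Torus.

(** * Free homotopies *)

Section Frac.
Variable R : realType.

Definition fracp (t : R) : R := t - (Num.floor t)%:~R.

Lemma fracp_itv t : 0 <= fracp t < 1.
Proof. by rewrite /fracp; have := floor_itv t; rewrite intrD; lra. Qed.

Lemma fracp_eq (m : int) t : m%:~R <= t < m%:~R + 1 -> fracp t = t - m%:~R.
Proof. by move=> h; rewrite /fracp (@floor_def _ t m) // intrD. Qed.

Lemma fracpD1 t : fracp (t + 1) = fracp t.
Proof.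
have := floor_itv t; rewrite intrD => h.
by rewrite (@fracp_eq (Num.floor t + 1)) /fracp ?intrD; lra.
Qed.

Lemma fracp_id t : 0 <= t < 1 -> fracp t = t.
Proof. by move=> h; rewrite (@fracp_eq 0) ?subr0 ?add0r. Qed.
Lemma fracp0 : fracp 0 = 0. Proof. by rewrite fracp_id // lexx ltr01. Qed.
Lemma fracp1 : fracp 1 = 0. Proof. by rewrite -[1]add0r fracpD1 fracp0. Qed.

Lemma continuous_fracp (S Y : topologicalType) (K : set S) (phi : S * R -> Y) :
  {within K `*` `[0, 1], continuous phi} ->
  (forall s, K s -> phi (s, 0) = phi (s, 1)) ->
  {within K `*` setT, continuous (fun p => phi (p.1, fracp p.2))}.
Proof.
move=> /withinP cphi per; apply/withinP => -[s t] [/= Ks _] P nP.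
have ct (c : R) : continuous (fun p : S * R => (p.1, p.2 - c)).
  apply: continuous_pair; first exact: continuous_fst.
  exact: contD (@continuous_snd _ _) (@continuous_cst _ R _).
have pull c : 0 <= t - c <= 1 -> nbhs (phi (s, t - c)) P ->
    \forall p \near (s, t), K p.1 -> 0 <= p.2 - c <= 1 -> P (phi (p.1, p.2 - c)).
  move=> h nP'; have Kst : (K `*` `[0, 1]) (s, t - c) by split; rewrite //= in_itv.
  have n : \forall p \near (s, t), (K `*` `[0, 1]) (p.1, p.2 - c) -> P (phi (p.1, p.2 - c)).
    exact: ct c (s, t) _ (cphi _ Kst _ nP').
  by apply: filterS n => p hp Kp hc; apply: hp; split; rewrite //= in_itv.
have nt (a b : R) : a < t -> t < b -> \forall p \near (s, t), a < p.2 < b.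
  move=> at_ tb; apply: filterS2 (near_gt (x := (s, t)) (@continuous_snd S R) at_)
    (near_lt (x := (s, t)) (@continuous_snd S R) tb) => p h1 h2.
  by apply/andP.
set m := Num.floor t; have := floor_itv t; rewrite -/m intrD => hm.
have fm : fracp t = t - m%:~R by [].
have [e|ne] := eqVneq t m%:~R.
  have nP0 : nbhs (phi (s, t - m%:~R)) P by rewrite -fm.
  have nP1 : nbhs (phi (s, t - (m%:~R - 1))) P.
    by rewrite -[X in (s, X)](_ : 1 = _) ?e; [rewrite -per // -(subrr (m%:~R : R)) -{1}e | lra].
  have s0 : 0 <= t - m%:~R <= 1 by lra.
  have s1 : 0 <= t - (m%:~R - 1) <= 1 by lra.
  have l0 : m%:~R - 1 < t by lra.
  have l1 : t < m%:~R + 1 by lra.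
  apply: filterS3 (pull _ s0 nP0) (pull _ s1 nP1) (nt _ _ l0 l1).
  move=> [s' t'] h0 h1 /= h2 [/= Ks' _].
  have [le|lt] := leP m%:~R t'.
    by rewrite (@fracp_eq m) /=; [apply: h0; rewrite //=; lra | lra].
  rewrite (@fracp_eq (m - 1)) intrD /=; last lra.
  by apply: h1; rewrite //=; lra.
have mt : m%:~R < t by rewrite lt_neqAle eq_sym ne; lra.
have s0 : 0 <= t - m%:~R <= 1 by lra.
have l1 : t < m%:~R + 1 by lra.
apply: filterS2 (pull _ s0 nP) (nt _ _ mt l1) => -[s' t'] h0 /= h2 [/= Ks' _].
by rewrite (@fracp_eq m) /=; [apply: h0; rewrite //=; lra | lra].
Qed.

End Frac.

Lemma continuous_glue (X Y : topologicalType) (K A B : set X) (f g h : X -> Y) :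
  K `<=` A `|` B -> closed A -> closed B ->
  {within A, continuous f} -> {within B, continuous g} ->
  (forall x, A x -> h x = f x) -> (forall x, B x -> h x = g x) ->
  {within K, continuous h}.
Proof.
move=> KAB cA cB cf cg hf hg; apply: (continuous_subspaceW KAB).
apply: withinU_continuous => //.
  by apply/withinP => x Ax P; rewrite (hf x Ax) => nP;
    apply: filterS ((withinP _ _).1 cf x Ax P nP) => y hy Ay; rewrite hf //; exact: hy.
by apply/withinP => x Ax P; rewrite (hg x Ax) => nP;
  apply: filterS ((withinP _ _).1 cg x Ax P nP) => y hy Ay; rewrite hg //; exact: hy.
Qed.

Lemma within_comp (X Y Z : topologicalType) (A : set X) (B : set Y) (r : X -> Y) (f : Y -> Z) :
  continuous r -> (forall x, A x -> B (r x)) -> {within B, continuous f} ->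
  {within A, continuous (f \o r)}.
Proof.
move=> cr h /withinP cf; apply/withinP => x Ax P nP.
have n : \forall y \near x, B (r y) -> P (f (r y)) := cr x _ (cf _ (h _ Ax) P nP).
by apply: filterS n => y hy Ay; apply: hy; exact: h.
Qed.

Section Homotopy.
Variable R : realType.
Notation T := (ptorus R).
Implicit Types g d : R -> T.

Lemma closed_set_le (X : topologicalType) (f : X -> R) c : continuous f -> closed [set x | f x <= c].
Proof.
move=> cf; apply: (@preimage_closed _ _ f [set x | x <= c]); last exact: closed_le.
by move=> x _; exact: cf.
Qed.
Lemma closed_set_ge (X : topologicalType) (f : X -> R) c : continuous f -> closed [set x | c <= f x].
Proof.
move=> cf; apply: (@preimage_closed _ _ f [set x | c <= x]); last exact: closed_ge.
by move=> x _; exact: cf.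
Qed.

Lemma closed_curveDn g (n : nat) t : closed_curve g -> g (t + n%:R) = g t.
Proof.
move=> [_ p]; elim: n => [|n IH]; first by rewrite addr0.
by rewrite -addn1 natrD addrA p.
Qed.
Lemma closed_curveDz g (m : int) t : closed_curve g -> g (t + m%:~R) = g t.
Proof.
move=> cg; case: m => n; first exact: closed_curveDn.
by rewrite NegzE mulrNz -[in RHS](subrK n.+1%:R t) closed_curveDn.
Qed.
Lemma closed_curve_frac g t : closed_curve g -> g (fracp t) = g t.
Proof. by move=> cg; rewrite /fracp -mulrNz closed_curveDz. Qed.

Lemma freely_homotopic_refl g : closed_curve g -> freely_homotopic g g.
Proof.
move=> [cg pg]; exists (g \o snd); split=> // [|s t _]; last exact: pg.
by apply: continuous_subspaceT; exact: continuous_comp2 (@continuous_snd _ _) cg.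
Qed.

Lemma freely_homotopic_sym g d : freely_homotopic g d -> freely_homotopic d g.
Proof.
move=> [H [cH pH H0 H1]]; exists (H \o (fun p => (1 - p.1, p.2))); split.
- apply: within_comp cH.
    apply: continuous_pair; last exact: continuous_snd.
    exact: contD (@continuous_cst _ R 1) (contN (@continuous_fst _ _)).
  by move=> [s t] [/=]; rewrite !in_itv /= => h _; split=> //=; lra.
- by move=> s t h; rewrite /= pH //; lra.
- by move=> t; rewrite /= subr0.
- by move=> t; rewrite /= subrr.
Qed.

Lemma freely_homotopic_trans g d e : freely_homotopic g d -> freely_homotopic d e ->
  freely_homotopic g e.
Proof.
move=> [H [cH pH H0 H1]] [K [cK pK K0 K1]].
exists (fun p => if p.1 <= 1 / 2 then H (2 * p.1, p.2) else K (2 * p.1 - 1, p.2)); split.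
- have c2 : continuous (fun p : R * R => 2 * p.1).
    exact: contM (@continuous_cst _ R 2) (@continuous_fst _ _).
  apply: (@continuous_glue _ _ _
    ([set p : R * R | 0 <= p.1] `&` [set p | p.1 <= 1 / 2])
    ([set p : R * R | 1 / 2 <= p.1] `&` [set p | p.1 <= 1])
    (H \o (fun p => (2 * p.1, p.2))) (K \o (fun p => (2 * p.1 - 1, p.2)))).
  + move=> [s t] [/=]; rewrite in_itv /= => h _.
    by have [le|lt] := leP s (1 / 2); [left|right]; split=> /=; lra.
  + by apply: closedI; [apply: closed_set_ge | apply: closed_set_le]; exact: continuous_fst.
  + by apply: closedI; [apply: closed_set_ge | apply: closed_set_le]; exact: continuous_fst.
  + apply: within_comp cH; first exact: continuous_pair c2 (@continuous_snd _ _).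
    by move=> [s t] [/= h1 h2]; split=> //=; rewrite in_itv /=; lra.
  + apply: within_comp cK.
      apply: continuous_pair (@continuous_snd _ _).
      exact: contD c2 (@continuous_cst _ R _).
    by move=> [s t] [/= h1 h2]; split=> //=; rewrite in_itv /=; lra.
  + by move=> [s t] [/= _ ->].
  + move=> [s t] [/= h1 _]; case: ifP => // h2.
    have -> : s = 1 / 2 by lra.
    by rewrite mul1r divff ?pnatr_eq0 // subrr H1 K0.
- by move=> s t h /=; case: ifP => h'; rewrite ?pH ?pK //; lra.
- by move=> t; rewrite /= mulr0 H0 ifT //; lra.
- by move=> t; rewrite /= ifF; [rewrite (_ : 2 * 1 - 1 = 1) ?K1 //; lra | apply/negbTE; lra].
Qed.

Lemma closed_reverse g : closed_curve g -> closed_curve (reverse g).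
Proof.
move=> [cg pg]; split; first exact: continuous_comp2 (contN (@continuous_idfun _)) cg.
by move=> t; rewrite /reverse opprD -[in RHS](subrK 1 (- t)) pg.
Qed.

Lemma closed_curve_comp h g : continuous h -> closed_curve g -> closed_curve (h \o g).
Proof. by move=> ch [cg pg]; split; [exact: continuous_comp2 | move=> t /=; rewrite pg]. Qed.

Lemma freely_homotopic_comp (h : T -> T) g d : continuous h -> freely_homotopic g d ->
  freely_homotopic (h \o g) (h \o d).
Proof.
move=> ch [H [cH pH H0 H1]]; exists (h \o H); split.
- by apply/withinP => x Kx P nP; exact: ((withinP _ _).1 cH x Kx _ (ch _ _ nP)).
- by move=> s t hs /=; rewrite pH.
- by move=> t /=; rewrite H0.
- by move=> t /=; rewrite H1.
Qed.

Lemma freely_homotopic_shift g c : closed_curve g -> freely_homotopic g (fun t => g (t + c)).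
Proof.
move=> [cg pg]; exists (fun p => g (p.2 + p.1 * c)); split.
- apply: continuous_subspaceT; apply: (@continuous_comp2 _ _ _ (fun p : R * R => p.2 + p.1 * c)) cg.
  exact: contD (@continuous_snd _ _) (contM (@continuous_fst _ _) (@continuous_cst _ R _)).
- by move=> s t _ /=; rewrite addrAC pg.
- by move=> t /=; rewrite mul0r addr0.
- by move=> t /=; rewrite mul1r.
Qed.

(* [P] runs along [rho], around [g] and back along [rho]; the homotopy drops
   the initial and final parts of it. *)
Lemma change_base (rho : R -> T) g : continuous rho -> closed_curve g -> rho 1 = g 0 ->
  exists2 g', based_loop (rho 0) g' & exists2 H, is_homotopy H g' g &
    forall s, 0 <= s <= 1 -> H (s, 0) = rho s.
Proof.
move=> crho cg rg.
pose P y := if y <= 1 then rho y else if y <= 2 then g (y - 1) else rho (3 - y).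
have g1 : g 1 = g 0 by rewrite -[1]add0r cg.2.
have P1 y : y <= 1 -> P y = rho y by rewrite /P => ->.
have P2 y : 1 <= y <= 2 -> P y = g (y - 1).
  move=> /andP[h1 h2]; rewrite /P h2; case: ifP => // h3.
  have -> : y = 1 by lra.
  by rewrite subrr.
have P3 y : 2 <= y -> P y = rho (3 - y).
  move=> h; rewrite /P; rewrite ifF; last by apply/negbTE; lra.
  case: ifP => // h3; have -> : y = 2 by lra.
  have e21 : 2 - 1 = 1 :> R by lra.
  have e32 : 3 - 2 = 1 :> R by lra.
  by rewrite e21 e32 g1 rg.
have csub (c : R) : continuous (fun y : R => y - c).
  exact: contD (@continuous_idfun _) (@continuous_cst _ R _).
have cP : {within setT, continuous P}.
  apply: (@continuous_glue _ _ _ [set y : R | y <= 1] [set y : R | 1 <= y] rho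
    (fun y => if y <= 2 then g (y - 1) else rho (3 - y))).
  + by move=> y _ /=; case: (leP y 1); [left | right; exact: ltW].
  + exact: closed_le.
  + exact: closed_ge.
  + exact: continuous_subspaceT.
  + apply: (@continuous_glue _ _ _ [set y : R | y <= 2] [set y : R | 2 <= y]
      (fun y => g (y - 1)) (fun y => rho (3 - y))).
    * by move=> y _ /=; case: (leP y 2); [left | right; exact: ltW].
    * exact: closed_le.
    * exact: closed_ge.
    * by apply: continuous_subspaceT; exact: continuous_comp2 (csub 1) cg.1.
    * apply: continuous_subspaceT.
      apply: (@continuous_comp2 _ _ _ (fun y : R => 3 - y)) crho.
      exact: contD (@continuous_cst _ R _) (contN (@continuous_idfun _)).
    * by move=> y /= ->.
    * move=> y /= h; have [lt2|//] := leP y 2.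
      have e2 : y = 2 by lra.
      by rewrite e2 -P3 ?lexx // -P2 //; lra.
  + exact: P1.
  + move=> y /= h; have [h2|h2] := leP y 2; first by apply: P2; rewrite h.
    by apply: P3; exact: ltW.
pose H (p : R * R) := P (p.1 + (3 - 2 * p.1) * fracp p.2).
have cH : {within `[0, 1]%classic `*` setT, continuous H}.
  have cf := @continuous_fracp R R T `[0, 1]%classic (fun p => P (p.1 + (3 - 2 * p.1) * p.2)).
  apply: cf.
    apply: (@within_comp _ _ _ _ setT (fun p : R * R => p.1 + (3 - 2 * p.1) * p.2)) cP => //.
    apply: contD (@continuous_fst _ _) (contM _ (@continuous_snd _ _)).
    apply: contD (@continuous_cst _ R _) (contN _).
    exact: contM (@continuous_cst _ R _) (@continuous_fst _ _).
  move=> s; rewrite /= in_itv /= => h; rewrite mulr0 addr0 mulr1 P1 ?P3; [|lra|lra].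
  by congr rho; lra.
have H0 s : s <= 1 -> H (s, 0) = rho s by move=> h; rewrite /H /= fracp0 mulr0 addr0 P1.
exists (fun t => H (0, t)); last first.
  exists H; last by move=> s /andP[_]; exact: H0.
  split=> // [s t _|t]; first by rewrite /H /= fracpD1.
  have := fracp_itv t => h; rewrite /H /= -(closed_curve_frac t cg) P2; last lra.
  by congr g; lra.
split; last by rewrite H0.
split; last by move=> t; rewrite /H /= fracpD1.
have c0 : {within setT, continuous (H \o (fun t : R => (0 : R, t)))}.
  apply: within_comp cH; first exact: continuous_pair (@continuous_cst _ R _) (@continuous_idfun _).
  by move=> t _; split=> //=; rewrite in_itv /= lexx ler01.
move=> t P' nP; have n : \forall y \near t, setT y -> P' (H (0, y)) := (withinP _ _).1 c0 t I P' nP.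
by apply: filterS n => y; apply.
Qed.

Lemma homotopy_box (H : R * R -> T) g d : is_homotopy H g d ->
  {within box 0 1 0 1, continuous H}.
Proof.
case=> cH _ _ _; apply: (continuous_subspaceW _ cH).
by move=> [s t] [/= h _]; split; rewrite //= in_itv.
Qed.

Lemma homotopy_hol (H : R * R -> T) g d k k' c : is_homotopy H g d ->
  holp (@tau R) 0 1 g k -> holp (@tau R) 0 1 d k' ->
  holp (@tau R) 0 1 (fun s => H (s, 0)) c -> k' = (k ^ c)%g.
Proof.
move=> hH hg hd hc.
have [c0 [c1 [l [l' [h0 h1 hl hl' e]]]]] := hol_square (@tau_cocycle R) (homotopy_box hH).
have [cH pH H0 H1] := hH.
have u := fun g k k' => @holp_uniq R _ _ (@tau R) 0 1 g k k' ler01.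
have ec0 : c0 = c by exact: u h0 hc.
have ec1 : c1 = c.
  apply: u h1 _; apply: holp_ext hc => s hs.
  by rewrite -[in RHS](add0r 1) pH.
have el : l = k by apply: u hl _; apply: holp_ext hg => t _; rewrite H0.
have el' : l' = k' by apply: u hl' _; apply: holp_ext hd => t _; rewrite H1.
by move: e; rewrite ec0 ec1 el el' => e; rewrite /conjg -e mulgA mulVg mul1g.
Qed.

Lemma closed_hol g : closed_curve g -> exists k, holp (@tau R) 0 1 g k.
Proof. by move=> [cg _]; apply: hol_exists; [exact: tau_cocycle | exact: continuous_subspaceT]. Qed.

Lemma freely_homotopic_hol g d k k' : freely_homotopic g d ->
  holp (@tau R) 0 1 g k -> holp (@tau R) 0 1 d k' -> conjp k k'.
Proof.
move=> [H hH] hg hd.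
have [c0 [c1 [l [l' [h0 _ _ _ _]]]]] := hol_square (@tau_cocycle R) (homotopy_box hH).
by exists c0; exact: homotopy_hol hH hg hd h0.
Qed.

End Homotopy.

(** * Word curves *)

Section WordCurves.
Variables (R : realType) (x : ptorus R) (a b : R -> ptorus R).
Hypothesis (ha : based_loop x a) (hb : based_loop x b).
Notation T := (ptorus R).
Notation hol := (holp (@tau R) 0 1).
Notation wc := (word_curve a b).

Lemma reverse_hol (g : R -> T) k : closed_curve g -> hol g k -> hol (reverse g) k^-1%g.
Proof.
move=> cg hg; apply: (@holp_ext _ _ _ _ _ _ (g \o (fun t => 1 - t))).
  by move=> t _; rewrite /reverse /= addrC -[1]/(1%:R) (closed_curveDn 1 _ cg).
apply: holp_compV hg; rewrite ?subr0 ?subrr //; last by move=> t h; lra.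
exact: contD (@continuous_cst _ R _) (contN (@continuous_idfun _)).
Qed.

Lemma letter_closed l : closed_curve (letter_curve a b l).
Proof. by case: l; [exact: ha.1 | exact: hb.1 | exact: closed_reverse ha.1 | exact: closed_reverse hb.1]. Qed.

Lemma letter_int l (m : int) : letter_curve a b l m%:~R = x.
Proof.
rewrite -[m%:~R]add0r (closed_curveDz _ _ (letter_closed l)).
by case: l; rewrite /= /reverse ?oppr0 ?ha.2 ?hb.2.
Qed.
Lemma letter_nat l (n : nat) : letter_curve a b l n%:R = x.
Proof. exact: (letter_int l n). Qed.

Lemma letter_linv l y : letter_curve a b (linv l) y = letter_curve a b l (- y).
Proof. by case: l; rewrite /= /reverse ?opprK. Qed.

Definition wpath (w : seq letter) (y : R) : T :=
  letter_curve a b (nth la w `|(Num.floor y %% (size w)%:Z)%Z|%N) y.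

Lemma word_curveE w t : wc w t = wpath w ((size w)%:R * t). Proof. by []. Qed.

Lemma wpath_int w (m : int) : wpath w m%:~R = x. Proof. exact: letter_int. Qed.

Lemma wpath_cont w : continuous (wpath w).
Proof.
move=> y P nP; suff : \forall y' \near y, P (wpath w y') by [].
set m := Num.floor y; have := floor_itv y; rewrite -/m intrD => hm.
have [e|ne] := eqVneq y m%:~R.
  have nl l : \forall y' \near y, P (letter_curve a b l y').
    have := (letter_closed l).1 y P; apply; rewrite e letter_int.
    by rewrite e wpath_int in nP.
  have n4 : \forall y' \near y,
      (P (letter_curve a b la y') /\ P (letter_curve a b lb y')) /\
      (P (letter_curve a b lA y') /\ P (letter_curve a b lB y')).
    by apply: filterI; apply: filterI; exact: nl.
  apply: filterS n4 => y' [[h1 h2] [h3 h4]]; rewrite /wpath.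
  by case: (nth la w _).
have my : m%:~R < y by rewrite lt_neqAle eq_sym ne; lra.
have ym : y < m%:~R + 1 by lra.
have nl : \forall y' \near y, P (letter_curve a b (nth la w `|(m %% (size w)%:Z)%Z|%N) y').
  exact: (letter_closed _).1 y P nP.
apply: filterS3 nl (near_gt (@continuous_idfun R) my) (near_lt (@continuous_idfun R) ym).
move=> y' hP h1 h2; rewrite /= /wpath (_ : Num.floor y' = m) //.
by apply: floor_def; rewrite intrD; lra.
Qed.

Lemma wpath_nat w (k : nat) y : (k < size w)%N -> k%:R <= y < k%:R + 1 ->
  wpath w y = letter_curve a b (nth la w k) y.
Proof.
move=> kw hy; rewrite /wpath (_ : Num.floor y = k).
  by rewrite modz_small //; lia.
by apply: floor_def; rewrite intrD.
Qed.

Lemma wpath_seg w (k : nat) y : (k < size w)%N -> k%:R <= y <= k%:R + 1 ->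
  wpath w y = letter_curve a b (nth la w k) y.
Proof.
move=> kw hy; have [e|ne] := eqVneq y (k%:R + 1); last first.
  by apply: wpath_nat => //; rewrite lt_neqAle ne; lra.
by rewrite e -[k%:R + 1]/(k%:R + 1%:R) -natrD letter_nat (wpath_int w (k + 1)%N).
Qed.

Lemma wpathD w y : wpath w (y + (size w)%:R) = wpath w y.
Proof.
rewrite /wpath (_ : Num.floor (y + (size w)%:R) = Num.floor y + size w).
  by rewrite modzDr closed_curveDn //; exact: letter_closed.
by apply: floor_def; have := floor_itv y; rewrite !intrD -!pmulrn; lra.
Qed.

Lemma word_curve_based w : based_loop x (wc w).
Proof.
split; last by rewrite word_curveE mulr0 (wpath_int w 0).
split; last by move=> t; rewrite !word_curveE mulrDr mulr1 wpathD.
exact: continuous_comp2 (contM (@continuous_cst _ R _) (@continuous_idfun _)) (@wpath_cont w).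
Qed.

Lemma letter_hol u v l : hol a u -> hol b v -> hol (letter_curve a b l) (lval u v l).
Proof.
by move=> hu hv; case: l => //=; apply: reverse_hol => //; [exact: ha.1 | exact: hb.1].
Qed.

Lemma wpath_hol u v w k : hol a u -> hol b v -> (k <= size w)%N ->
  holp (@tau R) 0 k%:R (wpath w) (ev u v (take k w)).
Proof.
move=> hu hv; elim: k => [_|k IH kw].
  rewrite take0; apply: holp_ext (holp_cst (@tau_cocycle R) 0 0 (wpath w 0)) => t h.
  by congr wpath; lra.
rewrite (take_nth la) // -cats1 ev_cat /= mulg1.
have k0 : 0 <= k%:R :> R by rewrite ler0n.
have k1 : k.+1%:R = k%:R + 1 :> R by rewrite -addn1 natrD.
apply: holp_cat (IH (ltnW kw)) _ => //; first by rewrite k1; lra.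
apply: (@holp_ext _ _ _ _ _ _ (letter_curve a b (nth la w k) \o (fun y => y - k%:R))).
  move=> y; rewrite k1 => hy; rewrite (wpath_seg kw hy) /=.
  by rewrite -(closed_curveDn k _ (letter_closed _)) subrK.
apply: holp_comp (letter_hol _ hu hv); rewrite ?k1; [|by move=> t h; lra | lra | lra].
exact: contD (@continuous_idfun _) (@continuous_cst _ R _).
Qed.

Lemma word_curve_hol u v w : hol a u -> hol b v -> hol (wc w) (ev u v w).
Proof.
move=> hu hv; rewrite -{2}(take_size w).
apply: (@holp_ext _ _ _ _ _ _ (wpath w \o (fun t => (size w)%:R * t))) => //.
apply: holp_comp (wpath_hol hu hv (leqnn _)); rewrite ?mulr0 ?mulr1 //.
  exact: contM (@continuous_cst _ R _) (@continuous_idfun _).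
by move=> t /andP[t0 t1]; rewrite mulr_ge0 ?ler_piMr.
Qed.

Lemma word_curve_rot1 w : freely_homotopic (wc w) (wc (rot 1 w)).
Proof.
case: w => [|l w]; first exact: freely_homotopic_refl (word_curve_based _).1.
have -> : wc (rot 1 (l :: w)) = fun t => wc (l :: w) (t + (size (l :: w))%:R^-1).
  apply/funext => t; rewrite !word_curveE size_rot mulrDr mulfV ?pnatr_eq0 //.
  move: (_%:R * t) => y; rewrite /wpath size_rot.
  have -> : Num.floor (y + 1) = Num.floor y + 1.
    by apply: floor_def; have := floor_itv y; rewrite !intrD; lra.
  rewrite (letter_closed _).2.
  congr (letter_curve a b _ y); rewrite -modzDml rot1_cons.
  have m0 : 0 <= (Num.floor y %% (size (l :: w))%:Z)%Z by apply: modz_ge0.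
  have m1 : (Num.floor y %% (size (l :: w))%:Z)%Z < (size (l :: w))%:Z by apply: ltz_pmod.
  case: (Num.floor y %% (size (l :: w))%:Z)%Z m0 m1 => // k _ kw.
  rewrite -PoszD modz_nat /= nth_rcons.
  have [lt|ge] := ltnP k (size w); first by rewrite modn_small addn1.
  have -> : k = size w by move: kw => /=; lia.
  by rewrite eqxx addn1 modnn.
exact: freely_homotopic_shift (word_curve_based _).1.
Qed.

(* The first two letters are run along up to time [1 - s] only, then back. *)
Lemma word_curve_cancel l w : freely_homotopic (wc (l :: linv l :: w)) (wc w).
Proof.
set W := l :: linv l :: w; set n : R := (size w)%:R.
have n0 : 0 <= n by rewrite ler0n.
have sW : (size W)%:R = n + 2 :> R by rewrite /W /= -addn2 natrD.
pose Y (p : R * R) := p.2 * (n + 2 - 2 * p.1).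
pose phi p := if Y p <= 1 - p.1 then wpath W (Y p) else wpath W (Y p + 2 * p.1).
have cY : continuous Y.
  apply: contM (@continuous_snd _ _) (contD (@continuous_cst _ R _) (contN _)).
  exact: contM (@continuous_cst _ R _) (@continuous_fst _ _).
have cY2 : continuous (fun p => Y p + 2 * p.1).
  exact: contD cY (contM (@continuous_cst _ R _) (@continuous_fst _ _)).
have cD : continuous (fun p => Y p - (1 - p.1)).
  exact: contD cY (contN (contD (@continuous_cst _ R _) (contN (@continuous_fst _ _)))).
have x0 : wpath W 0 = x by exact: (wpath_int W 0).
have turn s : 0 <= s <= 1 -> wpath W (1 - s) = wpath W (1 + s).
  move=> hs; rewrite (@wpath_seg W 0) //; last by rewrite /=; lra.
  rewrite (@wpath_seg W 1) //; last by rewrite /=; lra.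
  rewrite /= letter_linv -(closed_curveDn 2 (- (1 + s)) (letter_closed l)).
  by congr letter_curve; lra.
have cphi : {within `[0, 1]%classic `*` `[0, 1]%classic, continuous phi}.
  apply: (@continuous_glue _ _ _
    (box 0 1 0 1 `&` [set p | Y p - (1 - p.1) <= 0])
    (box 0 1 0 1 `&` [set p | 0 <= Y p - (1 - p.1)]) (wpath W \o Y)
    (wpath W \o (fun p => Y p + 2 * p.1))).
  - move=> [s t] [/=]; rewrite !in_itv => h1 h2.
    by have [le|lt] := leP (Y (s, t) - (1 - s)) 0; [left|right]; split=> //; exact: ltW.
  - by apply: closedI; [exact: closed_box | exact: closed_set_le].
  - by apply: closedI; [exact: closed_box | exact: closed_set_ge].
  - by apply: continuous_subspaceT; exact: continuous_comp2 (@wpath_cont W).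
  - by apply: continuous_subspaceT; exact: continuous_comp2 (@wpath_cont W).
  - by move=> p [_ /= h]; rewrite /phi ifT //; lra.
  - move=> p [[h1 _] /= h]; rewrite /phi; case: ifP => // h'.
    have -> : Y p = 1 - p.1 by lra.
    by rewrite turn //; congr wpath; lra.
have per s : `[0, 1]%classic s -> phi (s, 0) = phi (s, 1).
  rewrite /= in_itv /= => hs; rewrite /phi /Y /= mul0r mul1r ifT; last lra.
  case: ifP => h; first by congr wpath; nra.
  rewrite x0 (_ : _ + _ = (size W)%:R); first by rewrite (wpath_int W (size W)).
  by rewrite sW; lra.
exists (fun p => phi (p.1, fracp p.2)); split.
- exact: (@continuous_fracp R R T `[0, 1]%classic phi).
- by move=> s t _ /=; rewrite fracpD1.
- move=> t; rewrite -(closed_curve_frac t (word_curve_based W).1) word_curveE sW /phi /Y /=.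
  by rewrite !mulr0 !subr0 addr0; case: ifP => _; congr wpath; lra.
- move=> t; rewrite -(closed_curve_frac t (word_curve_based w).1) word_curveE /phi /Y /=.
  have /andP[f0 f1] := fracp_itv t; rewrite subrr mulr1 addrK -/n [fracp t * n]mulrC.
  set y := n * fracp t; have y0 : 0 <= y by rewrite mulr_ge0.
  case: leP => hy.
    have -> : y = 0 by lra.
    by rewrite x0 (wpath_int w 0).
  have yn : y < n.
    have nn : n != 0 by apply/eqP => e; move: hy; rewrite /y e mul0r ltxx.
    have np : 0 < n by rewrite lt_neqAle eq_sym nn.
    by rewrite /y -[X in _ < X]mulr1 ltr_pM2l.
  have [k [ky ek]] : exists k : nat, k%:R <= y < k%:R + 1 /\ (k < size w)%N.
    have := floor_itv y; rewrite intrD; case e : (Num.floor y) => [k|k] hk.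
      exists k; split=> //; rewrite -(ltr_nat R); apply: le_lt_trans yn.
      by case/andP: hk.
    have := floor_ge0 y; rewrite y0 e; by [].
  rewrite (wpath_nat ek ky) (@wpath_nat W k.+2) //.
    by rewrite -[RHS](closed_curveDn 2) //; exact: letter_closed.
  by rewrite -addn2 natrD; lra.
Qed.

Notation hw w w' := (freely_homotopic (wc w) (wc w')).

Lemma hw_rot i w : hw w (rot i w).
Proof.
elim: i => [|i IH]; first by rewrite rot0; exact: freely_homotopic_refl (word_curve_based _).1.
have [lt|ge] := ltnP i (size w).
  by rewrite rotS //; apply: freely_homotopic_trans IH _; exact: word_curve_rot1.
by rewrite rot_oversize ?leqW //; rewrite rot_oversize // in IH.
Qed.

Lemma hw_catC u v : hw (u ++ v) (v ++ u).
Proof. by have := hw_rot (size u) (u ++ v); rewrite rot_size_cat. Qed.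

Lemma hw_cancel u l v : hw (u ++ l :: linv l :: v) (u ++ v).
Proof.
apply: freely_homotopic_trans (hw_catC _ _) _.
apply: freely_homotopic_trans (hw_catC _ _).
exact: word_curve_cancel.
Qed.

Lemma hw_red u w : hw (u ++ w) (u ++ red w).
Proof.
elim: w u => [|l w IH] u; first exact: freely_homotopic_refl (word_curve_based _).1.
rewrite -cat_rcons; apply: freely_homotopic_trans (IH _) _; rewrite cat_rcons.
have refl v : hw v v by exact: freely_homotopic_refl (word_curve_based _).1.
rewrite [red (l :: w)]/(consr l (red w)); case: (red w) => [|m r] /=; first exact: refl.
case: eqP => [->|_]; [exact: hw_cancel | exact: refl].
Qed.

Lemma hw_fw w w' : fw w = fw w' -> hw w w'.
Proof.
move=> /(congr1 fword) e; apply: freely_homotopic_trans (hw_red [::] w) _.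
by rewrite /= in e *; rewrite e; exact/freely_homotopic_sym/(hw_red [::]).
Qed.

Lemma hw_conjp w w' : conjp (fw w) (fw w') -> hw w w'.
Proof.
move=> [c ec]; apply: freely_homotopic_sym.
have e : fw w' = fw (winv c ++ w ++ c).
  by rewrite ec /conjg !fw_cat fw_winv fwordK.
apply: freely_homotopic_trans (hw_fw e) _; apply: freely_homotopic_trans (hw_catC _ _) _.
by apply: hw_fw; rewrite -catA !fw_cat fw_winv fwordK mulgV mulg1.
Qed.

End WordCurves.

(** * Paths and loops in the punctured torus *)

Section Paths.
Variable R : realType.
Notation T := (ptorus R).
Notation hol := (holp (@tau R) 0 1).

Definition clip (t : R) := (`|t| - `|t - 1| + 1) / 2.

Lemma clip_itv t : 0 <= clip t <= 1.
Proof.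
rewrite /clip; have [h|h] := leP 0 t; have [h'|h'] := leP 1 t.
- rewrite (ger0_norm h) ger0_norm; lra.
- rewrite (ger0_norm h) ltr0_norm; lra.
- lra.
- rewrite (ltr0_norm h) ltr0_norm; lra.
Qed.
Lemma clip0 : clip 0 = 0.
Proof. by rewrite /clip normr0 [0 - 1]sub0r normrN normr1; lra. Qed.
Lemma clip1 : clip 1 = 1.
Proof. by rewrite /clip subrr normr0 normr1; lra. Qed.

Lemma cont_norm (X : topologicalType) (f : X -> R) : continuous f -> continuous (fun x => `|f x|).
Proof. by move=> cf; exact: continuous_comp2 cf (@norm_continuous R R). Qed.

Lemma continuous_clip : continuous clip.
Proof.
apply: contM (@continuous_cst _ R _); apply: contD (@continuous_cst _ R _).
apply: contD (cont_norm (@continuous_idfun _)) (contN (cont_norm _)).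
exact: contD (@continuous_idfun _) (@continuous_cst _ R _).
Qed.

(* Half of the circle: from a point to [(-1, 0)] with an ordinate of constant
   sign. *)
Definition semi (v : R * R) (t : R) : R * R :=
  let c := (1 - t) * v.1 - t in
  (c, (if 0 <= v.2 then 1 else -1) * Num.sqrt (1 - c ^+ 2)).

Lemma semi_circle v t : v.1 ^+ 2 + v.2 ^+ 2 = 1 -> 0 <= t <= 1 ->
  (semi v t).1 ^+ 2 + (semi v t).2 ^+ 2 = 1.
Proof.
move=> h ht; rewrite /semi /= exprMn.
have -> : (if 0 <= v.2 then 1 else -1 : R) ^+ 2 = 1 by case: ifP; rewrite ?sqrrN expr1n.
rewrite mul1r sqr_sqrtr ?subrKC //.
have : -1 <= v.1 <= 1 by apply/andP; split; nra.
move: (v.1) => z hz; rewrite subr_ge0.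
have : -1 <= (1 - t) * z - t <= 1 by apply/andP; split; nra.
by nra.
Qed.

Lemma semi0 v : v.1 ^+ 2 + v.2 ^+ 2 = 1 -> semi v 0 = v.
Proof.
case: v => z y /= h; rewrite /semi /= (_ : (1 - 0) * z - 0 = z); last by lra.
congr (_, _).
have -> : 1 - z ^+ 2 = y ^+ 2 by lra.
rewrite sqrtr_sqr; case: ifP => h'.
  by rewrite mul1r ger0_norm.
by rewrite mulN1r ltr0_norm ?opprK // ltNge h'.
Qed.

Lemma semi1 v : semi v 1 = (-1, 0).
Proof. by rewrite /semi /= subrr mul0r sub0r sqrrN expr1n subrr sqrtr0 mulr0. Qed.

Lemma continuous_semi v : continuous (semi v).
Proof.
have cc : continuous (fun t : R => (1 - t) * v.1 - t).
  apply: contD (contN (@continuous_idfun _)); apply: contM (@continuous_cst _ R _).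
  exact: contD (@continuous_cst _ R _) (contN (@continuous_idfun _)).
apply: continuous_pair => //; apply: contM (@continuous_cst _ R _) _.
apply: (@continuous_comp2 _ _ _ (fun t : R => 1 - ((1 - t) * v.1 - t) ^+ 2)) (@sqrt_continuous R).
exact: contD (@continuous_cst _ R _) (contN (contM cc cc)).
Qed.

Lemma to_base_on (p : T) t : on_torus (semi (tcoord p).1 (clip t), semi (tcoord p).2 (clip t)).
Proof.
have [hz hw hp] := tcoordP p; have h := clip_itv t; split; try exact: semi_circle.
have lz := le1_circle hz; have lw := le1_circle hw.
by rewrite /semi /= => -[e1 e2]; apply: hp; split; nra.
Qed.

Lemma base_on : on_torus ((-1, 0), (-1, 0) : R * R).
Proof. by split=> /=; rewrite ?sqrrN ?expr1n ?expr0n ?addr0 //= => -[]; lra. Qed.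
Definition tbase : T := tmk base_on.

Definition to_base (p : T) t : T := tmk (to_base_on p t).

Lemma continuous_to_base p : continuous (to_base p).
Proof.
apply: continuous_into_torus; apply: continuous_pair;
  exact: continuous_comp2 continuous_clip (@continuous_semi _).
Qed.
Lemma to_base0 p : to_base p 0 = p.
Proof.
have [hz hw _] := tcoordP p; apply: tcoord_inj.
by rewrite tmkK clip0 !semi0 //; case: (tcoord p).
Qed.
Lemma to_base1 p : to_base p 1 = tbase.
Proof. by apply: tcoord_inj; rewrite !tmkK clip1 !semi1. Qed.

Lemma torus_path (p q : T) : exists rho : R -> T, [/\ continuous rho, rho 0 = p & rho 1 = q].
Proof.
pose rho t := if t <= 1 / 2 then to_base p (2 * t) else to_base q (2 - 2 * t).
have c2 : continuous (fun t : R => 2 * t) by exact: contM (@continuous_cst _ R _) (@continuous_idfun _).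
exists rho; split.
- have cr : {within setT, continuous rho}.
    apply: (@continuous_glue _ _ _ [set t : R | t <= 1 / 2] [set t : R | 1 / 2 <= t]
      (to_base p \o (fun t => 2 * t)) (to_base q \o (fun t => 2 - 2 * t))).
    + by move=> y _ /=; case: (leP y (1 / 2)); [left | right; exact: ltW].
    + exact: closed_le.
    + exact: closed_ge.
    + by apply: continuous_subspaceT; exact: continuous_comp2 (@continuous_to_base _).
    + apply: continuous_subspaceT; apply: continuous_comp2 (@continuous_to_base _).
      exact: contD (@continuous_cst _ R _) (contN c2).
    + by move=> t /= h; rewrite /rho h.
    + move=> t /= h; rewrite /rho; case: ifP => // h'; have -> : t = 1 / 2 by lra.
      have -> : 2 - 2 * (1 / 2) = 1 :> R by lra.
      have -> : 2 * (1 / 2) = 1 :> R by lra.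
      by rewrite !to_base1.
  move=> t P nP; have n : \forall y \near t, setT y -> P (rho y) := (withinP _ _).1 cr t I P nP.
  by apply: filterS n => y; apply.
- by rewrite /rho ifT ?mulr0 ?to_base0 //; lra.
- rewrite /rho ifF; last by apply/negbTE; lra.
  have -> : 2 - 2 * 1 = 0 :> R by lra.
  exact: to_base0.
Qed.

(* The square of the rational parametrisation of the right half circle: once
   around the circle, from [-1] to [-1], for [y] from [-1] to [1]. *)
Definition around (y : R) : R * R :=
  let c := (1 - y ^+ 2) / (1 + y ^+ 2) in let s := 2 * y / (1 + y ^+ 2) in
  (c ^+ 2 - s ^+ 2, 2 * c * s).

Lemma den_gt0 (y : R) : 0 < 1 + y ^+ 2. Proof. by have := sqr_ge0 y; lra. Qed.

Lemma around_on y : on_torus (around y, (-1, 0)).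
Proof.
split; rewrite /= ?sqrrN ?expr1n ?expr0n ?addr0 //=; last by case; lra.
by have := den_gt0 y => h; field; rewrite gt_eqF.
Qed.

Definition round (y : R) : T := tmk (around_on y).

Lemma continuous_round : continuous round.
Proof.
have c2 : continuous (fun y : R => y ^+ 2) by exact: contM (@continuous_idfun _) (@continuous_idfun _).
have cd : continuous (fun y : R => (1 + y ^+ 2)^-1).
  move=> y; apply: cvgV; first by rewrite gt_eqF // den_gt0.
  exact: (contD (@continuous_cst _ R _) c2).
have cc : continuous (fun y : R => (1 - y ^+ 2) / (1 + y ^+ 2)).
  exact: contM (contD (@continuous_cst _ R _) (contN c2)) cd.
have cs : continuous (fun y : R => 2 * y / (1 + y ^+ 2)).
  exact: contM (contM (@continuous_cst _ R _) (@continuous_idfun _)) cd.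
apply: continuous_into_torus; apply: continuous_pair (@continuous_cst _ _ _).
apply: continuous_pair; first exact: contD (contM cc cc) (contN (contM cs cs)).
exact: contM (contM (@continuous_cst _ R _) cc) cs.
Qed.

Lemma round_ends : round (-1) = tbase /\ round 1 = tbase.
Proof.
by split; apply: tcoord_inj; rewrite !tmkK; congr pair; rewrite /around ?sqrrN expr1n subrr mul0r;
  congr pair; rewrite ?mulr0 ?mul0r // ?mulrN ?mulNr mulr1 divff ?sqrrN ?expr1n ?expr0n /= ?sub0r // pnatr_eq0.
Qed.

Definition loop_a (t : R) : T := round (2 * fracp t - 1).

Lemma continuous_2t1 : continuous (fun t : R => 2 * t - 1).
Proof. exact: contD (contM (@continuous_cst _ R _) (@continuous_idfun _)) (@continuous_cst _ R _). Qed.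

Lemma loop_a_itv t : 0 <= t <= 1 -> loop_a t = round (2 * t - 1).
Proof.
move=> h; rewrite /loop_a; have [->|ne] := eqVneq t 1; last first.
  by rewrite fracp_id // lt_neqAle ne; lra.
rewrite fracp1 mulr0 sub0r (_ : 2 * 1 - 1 = 1); last by lra.
by rewrite !round_ends.1 round_ends.2.
Qed.

Lemma loop_a_based : based_loop tbase loop_a.
Proof.
split; last by rewrite /loop_a fracp0 mulr0 sub0r round_ends.1.
split; last by move=> t; rewrite /loop_a fracpD1.
have c : {within setT, continuous (fun p : R * R => loop_a p.2)}.
  have -> : [set: R * R] = setT `*` setT by apply/seteqP; split.
  apply: (@continuous_fracp R R T setT (fun p => round (2 * p.2 - 1))).
    apply: continuous_subspaceT; apply: continuous_comp2 (continuous_comp2 continuous_2t1 continuous_round).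
    exact: continuous_snd.
  move=> s _ /=; rewrite mulr0 sub0r (_ : 2 * 1 - 1 = 1); last by lra.
  by rewrite round_ends.1 round_ends.2.
move=> t P nP.
have n : \forall y \near t, setT (0 : R, y) -> P (loop_a y).
  exact: continuous_pair (@continuous_cst _ R 0) (@continuous_idfun _) t _
    ((withinP _ _).1 c (0, t) I P nP).
by apply: filterS n => y; apply.
Qed.

Lemma round_z1 y : y != 0 -> (tcoord (round y)).1.1 < 1.
Proof.
move=> y0; rewrite tmkK /around /=; have d0 := den_gt0 y.
have s0 : 0 < (2 * y / (1 + y ^+ 2)) ^+ 2.
  by rewrite exprn_even_gt0 //= mulf_neq0 ?mulf_neq0 ?pnatr_eq0 // invr_eq0 gt_eqF.
have [+ _ _] := around_on y; rewrite /around /=.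
move: s0; move: ((1 - _) / _) (2 * y / _) => c s s0 e; nra.
Qed.

Lemma round_z2 y : -1 < y < 1 -> ((tcoord (round y)).1.2 < 0) = (y < 0).
Proof.
move=> hy; rewrite tmkK /around /=; have d0 := den_gt0 y.
have y2 : 0 < 1 - y ^+ 2 by nra.
have k0 : 0 < 4 * ((1 - y ^+ 2) / (1 + y ^+ 2) ^+ 2).
  by rewrite mulr_gt0 ?divr_gt0 ?exprn_gt0.
rewrite -[in RHS](pmulr_llt0 y k0); congr (_ < 0).
by field; rewrite gt_eqF.
Qed.

Lemma round0_z1 : (tcoord (round 0)).1.1 = 1.
Proof.
by rewrite tmkK /around /= expr0n /= subr0 addr0 mulr0 mul0r divr1 expr1n expr0n subr0.
Qed.

Lemma loop_a_hol : hol loop_a xa.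
Proof.
apply: (@holp_ext _ _ _ _ _ _ (round \o (fun t => 2 * t - 1))) => [t h|].
  by rewrite loop_a_itv.
exists (fun t => if t < 1 / 2 then xa^-1%g else 1%g); last first.
  rewrite ifT; last by lra.
  by rewrite ifF ?invgK ?mulg1 //; apply/negbTE; lra.
have off t : t != 1 / 2 -> tau (round (2 * t - 1)) =1 fun _ => 1%g.
  move=> ht q; apply: tau_off; last by rewrite tmkK /=; lra.
  by apply: round_z1; apply/eqP => e; move/eqP: ht; apply; lra.
move=> t _; case: (ltgtP t (1 / 2)) => ht.
- apply: filterS (near_lt (@continuous_idfun R) ht) => y /= -> _.
  by rewrite off ?mulg1 // lt_eqF.
- apply: filterS (near_gt (@continuous_idfun R) ht) => y /= hy _.
  by rewrite ifF ?off ?mulg1 ?gt_eqF //; apply/negbTE; lra.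
- have l0 : 0 < t by lra.
  have l1 : t < 1 by lra.
  apply: filterS2 (near_gt (@continuous_idfun R) l0) (near_lt (@continuous_idfun R) l1) => y /= y0 y1 _.
  have -> : 2 * t - 1 = 0 by lra.
  rewrite /tau round0_z1 eqxx.
  rewrite round_z2; last by lra.
  by rewrite mul1g; congr (if _ then _ else _); apply/idP/idP; lra.
Qed.

Definition loop_b : R -> T := @tswap R \o loop_a.

Lemma loop_b_based : based_loop tbase loop_b.
Proof.
split; first exact: closed_curve_comp (@continuous_tswap R) loop_a_based.1.
by rewrite /loop_b /= loop_a_based.2; apply: tcoord_inj; rewrite !tmkK.
Qed.

Lemma loop_b_hol : hol loop_b xb.
Proof.
have hc (p : T) : \forall q \near p,
    tau (tswap p) (tswap q) = ((1 : free2)^-1 * act Esw (tau p q) * 1)%g.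
  by apply: filterS filterT => q _; rewrite mulg1 invg1 mul1g tau_swap.
have := holp_equiv (c := fun _ : T => 1%g) (autM [:: Esw]) (autV [:: Esw]) hc
  (continuous_subspaceT loop_a_based.1.1) loop_a_hol.
rewrite invg1 mul1g mulg1; congr holp; exact: val_inj.
Qed.

Lemma hol_surj (y : T) (g : free2) : exists2 d, based_loop y d & hol d g.
Proof.
have [rho [crho r0 r1]] := torus_path y tbase.
have [c hc] := hol_exists (@tau_cocycle R) (continuous_subspaceT crho).
pose w : seq letter := (g ^ c)%g.
have bw := word_curve_based loop_a_based loop_b_based w.
have hw := word_curve_hol loop_a_based loop_b_based w loop_a_hol loop_b_hol.
have [|d bd [H hH Hr]] := change_base crho bw.1; first by rewrite r1 bw.2.
rewrite r0 in bd; exists d => //; have [k hk] := closed_hol bd.1.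
have := homotopy_hol hH hk hw (holp_ext (fun s hs => esym (Hr s hs)) hc).
by rewrite ev_xab fwordK => /conjg_inj ->.
Qed.

End Paths.

(** * Mapping class group orbits *)

Section Classes.
Variables (R : realType) (x : ptorus R) (a b : R -> ptorus R).
Hypothesis hab : generating_pair a b x.
Notation T := (ptorus R).
Notation hol := (holp (@tau R) 0 1).
Notation wc := (word_curve a b).

Let ha : based_loop x a. Proof. by case: hab. Qed.
Let hb : based_loop x b. Proof. by case: hab. Qed.

Lemma hol_uniq (g : R -> T) k k' : hol g k -> hol g k' -> k = k'.
Proof. exact: holp_uniq ler01. Qed.

Lemma homeo_gens (h : T -> T) u v : homeo h -> hol (h \o a) u -> hol (h \o b) v -> gens (u, v).
Proof.
move=> [k [ch ck hk kh]] hu hv g.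
have [d [cd d0] hd] := hol_surj (h x) g.
have [_ _ gen] := hab.
have [w [H hH Hx]] : exists w, based_homotopic x (k \o d) (wc w).
  by apply: gen; split; [exact: closed_curve_comp | rewrite /= d0 hk].
exists w => /=.
have bha : based_loop (h x) (h \o a) by split; [exact: closed_curve_comp ch ha.1 | rewrite /= ha.2].
have bhb : based_loop (h x) (h \o b) by split; [exact: closed_curve_comp ch hb.1 | rewrite /= hb.2].
have hw : hol (h \o wc w) (ev u v w).
  apply: holp_ext (word_curve_hol bha bhb w hu hv) => t _.
  by rewrite /word_curve /=; case: (nth la w _).
have hhH : is_homotopy (h \o H) d (h \o wc w).
  case: hH => cH pH H0 H1; split.
  - by apply/withinP => y Ky P nP; exact: ((withinP _ _).1 cH y Ky _ (ch _ _ nP)).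
  - by move=> s t hs /=; rewrite pH.
  - by move=> t; rewrite /= H0 /= kh.
  - by move=> t; rewrite /= H1.
rewrite (homotopy_hol (c := 1%g) hhH hd hw) ?conjg1 //.
apply: holp_ext (holp_cst (@tau_cocycle R) 0 1 (h x)) => s hs.
by rewrite /= Hx.
Qed.

Lemma nielsen_hol (h : T -> T) : homeo h -> exists es, forall w k,
  hol (h \o wc w) k -> conjp (aut es (fw w)) k.
Proof.
move=> hh; have [k [ch ck hk kh]] := hh.
have cha := closed_curve_comp ch ha.1; have chb := closed_curve_comp ch hb.1.
have [[u hu] [v hv]] := (closed_hol cha, closed_hol chb).
have [es [c ec]] := nielsen (homeo_gens hh hu hv); exists es => w k' hw.
have bha : based_loop (h x) (h \o a) by split; rewrite //= ha.2.
have bhb : based_loop (h x) (h \o b) by split; rewrite //= hb.2.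
have hw' : hol (h \o wc w) (ev u v w).
  apply: holp_ext (word_curve_hol bha bhb w hu hv) => t _.
  by rewrite /word_curve /=; case: (nth la w _).
rewrite (hol_uniq hw hw') -ev_fw; exists c.
by rewrite (ec (fw w)) /= ev_xab fwordK.
Qed.

Lemma homeo_id : homeo (@id T).
Proof. by exists id; split=> //; exact: continuous_idfun. Qed.

Lemma homotopic_word (g : R -> T) : closed_curve g -> exists w, freely_homotopic g (wc w).
Proof.
move=> cg; have [rho [crho r0 r1]] := torus_path x (g 0).
have [d bd [H hH _]] := change_base crho cg r1; rewrite r0 in bd.
have [_ _ gen] := hab; have [w [K hK _]] := gen d bd.
exists w; apply: (@freely_homotopic_trans _ _ d); last by exists K.
by apply: freely_homotopic_sym; exists H.
Qed.

Lemma conjp_freely_homotopic (g d : R -> T) k k' : closed_curve g -> closed_curve d ->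
  hol g k -> hol d k' -> conjp k k' -> freely_homotopic g d.
Proof.
move=> cg cd hg hd kk'.
have [es hes] := nielsen_hol homeo_id.
have [[wg gw] [wd dw]] := (homotopic_word cg, homotopic_word cd).
have [kg hkg] := closed_hol (word_curve_based ha hb wg).1.
have [kd hkd] := closed_hol (word_curve_based ha hb wd).1.
apply: (freely_homotopic_trans gw); apply: (freely_homotopic_trans _ (freely_homotopic_sym dw)).
apply: (hw_conjp ha hb); apply: (@conjp_autV es).
apply: conjp_trans (hes _ _ hkg) _; apply: conjp_trans (conjp_sym (hes _ _ hkd)).
apply: conjp_trans (conjp_sym (freely_homotopic_hol gw hg hkg)) _.
exact: conjp_trans kk' (freely_homotopic_hol dw hd hkd).
Qed.

Lemma curve_classE (g : R -> T) k : closed_curve g -> hol g k ->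
  curve_class g = [set d | closed_curve d /\ exists2 k', hol d k' & conjpm k k'].
Proof.
move=> cg hg; apply/seteqP; split=> d /= [cd].
  have [k' hd] := closed_hol cd; case=> h; split=> //; exists k' => //.
    by left; exact: freely_homotopic_hol h hg hd.
  right; rewrite -[k']invgK; apply: conjpV.
  exact: freely_homotopic_hol h hg (reverse_hol cd hd).
move=> [k' hd [h|h]]; split=> //; [left|right].
  exact: conjp_freely_homotopic hg hd h.
apply: (conjp_freely_homotopic _ _ hg (reverse_hol cd hd)) => //; first exact: closed_reverse.
by rewrite -[k]invgK; exact: conjpV.
Qed.

Lemma curve_class_eq (g d : R -> T) k k' : closed_curve g -> closed_curve d -> hol g k -> hol d k' ->
  conjpm k k' -> curve_class g = curve_class d.
Proof.
move=> cg cd hg hd kk'; rewrite (curve_classE cg hg) (curve_classE cd hd).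
apply/seteqP; split=> e /= [ce [l he h]]; split=> //; exists l => //.
  exact: conjpm_trans (conjpm_sym kk') h.
exact: conjpm_trans kk' h.
Qed.

Lemma image_curve_class (h : T -> T) (g : R -> T) : homeo h -> closed_curve g ->
  [set h \o d | d in curve_class g] = curve_class (h \o g).
Proof.
move=> [k [ch ck hk kh]] cg; apply/seteqP; split=> d /=.
  move=> [e [ce he] <-]; split; first exact: closed_curve_comp.
  by case: he => he; [left | right]; exact: (freely_homotopic_comp ch he).
move=> [cd hd].
have kg : k \o (h \o g) = g by apply/funext => t /=; rewrite hk.
exists (k \o d); last by apply/funext => t /=; rewrite kh.
split; first exact: closed_curve_comp.
by case: hd => hd; [left | right]; have := freely_homotopic_comp ck hd; rewrite kg.
Qed.

Lemma mcg_orbitP (C D : set (R -> T)) : mcg_orbit C D <->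
  classes D /\ exists2 h : T -> T, homeo h & D = [set h \o g | g in C].
Proof.
split=> [[cD [M [h0 hh0 <-] [h Mh eD]]]|[cD [h hh eD]]]; split=> //.
  by exists h => //; exact: connected_component_sub Mh.
exists (connected_component (@homeomorphisms R) h); first by exists h.
by exists h => //; exact: connected_component_refl.
Qed.

Definition word_class w := curve_class (wc w).

Section Orbit.
Variable es0 : seq elem.
Hypothesis hes0 : forall w k, hol (@id T \o wc w) k -> conjp (aut es0 (fw w)) k.

Let closed_wc w : closed_curve (wc w). Proof. exact: (word_curve_based ha hb w).1. Qed.

Lemma word_classE w d : word_class w d <->
  closed_curve d /\ exists2 k, hol d k & conjpm (aut es0 (fw w)) k.
Proof.
have [k hk] := closed_hol (closed_wc w); have h := hes0 hk.
rewrite /word_class (curve_classE (closed_wc w) hk) /=.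
split=> -[cd [k' hd h']]; split=> //; exists k' => //.
  by apply: conjpm_trans h'; left.
by apply: conjpm_trans h'; left; exact: conjp_sym.
Qed.

Lemma word_class_word w w' : word_class w (wc w') <-> conjpm (fw w) (fw w').
Proof.
have [k hk] := closed_hol (closed_wc w'); have h := hes0 hk.
split=> [/word_classE[_ [k' hk']]|h'].
  rewrite (hol_uniq hk' hk) => h1.
  have := conjpm_trans h1 (or_introl (conjp_sym h)).
  by move=> /(conjpm_aut (esinv es0)); rewrite !esinvK.
apply/word_classE; split; first exact: closed_wc.
exists k => //; apply: conjpm_trans (conjpm_aut es0 h') _; by left.
Qed.

Lemma word_class_self w : word_class w (wc w).
Proof. by apply/word_class_word; exact: conjpm_refl. Qed.

Lemma word_class_length w : cycred w -> word_length a b (word_class w) (size w).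
Proof.
move=> cw; split; first by exists w => //; exact: word_class_self.
move=> w' /word_class_word /(size_conjpm cw) le; apply: leq_trans le _.
exact: size_fw.
Qed.

Lemma orbit_card w0 l c : rootfree (fw w0) -> counted (fw w0) l c ->
  (orbit_of_length a b w0 l #= `I_c)%card.
Proof.
move=> rf [s [<- hs inj full]].
have -> : orbit_of_length a b w0 l = (fun i => word_class (nth [::] s i)) @` `I_(size s).
  apply/seteqP; split=> D /=.
    move=> [/mcg_orbitP[cD [h hh]]]; rewrite image_curve_class // => eD wl.
    have [es hes] := nielsen_hol hh.
    have [w [cw hw ws]] := full (esinv es0 ++ es).
    have ch : closed_curve (h \o wc w0) by have [k [? _ _ _]] := hh; exact: closed_curve_comp.
    have [k0 hk0] := closed_hol ch.
    have [k hk] := closed_hol (closed_wc w).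
    have eD' : D = word_class w.
      rewrite eD; apply: (curve_class_eq ch (closed_wc w) hk0 hk).
      apply: conjpm_trans (or_introl (conjp_sym (hes _ _ hk0))) _.
      apply: conjpm_trans (or_introl (hes0 hk)).
      by apply: conjpm_sym; have := conjpm_aut es0 hw; rewrite aut_cat esKinv.
    have sl : size w = l.
      rewrite eD' in wl; have [wl1 wl2] := wl; have [_ wl3] := word_class_length cw.
      apply/eqP; rewrite eqn_leq wl2 ?andbT; last exact: word_class_self.
      by have [w2 /wl3 + <-] := wl1.
    exists (index w s); first by rewrite /= index_mem ws.
    by rewrite nth_index ?ws.
  move=> [i /= ilt <-]; have := mem_nth [::] ilt; move: (nth _ _ _) => w /hs[cw sl [es hes]].
  split; last by rewrite -sl; exact: word_class_length.
  have [k hk] := closed_hol (closed_wc w); have ek := hes0 hk.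
  apply/mcg_orbitP; split.
    exists (wc w); split; [exact: closed_wc | | by []].
    move=> [d [n [cd n1 hp]]]; have [kd hkd] := closed_hol cd.
    have hpow : hol (power n d) (kd ^+ n)%g.
      have bd : based_loop (d 0) d by [].
      have := word_curve_hol bd bd (nseq n la) hkd hkd.
      have -> : ev kd kd (nseq n la) = (kd ^+ n)%g.
        by elim: (n) => //= m ->; rewrite expgS.
      apply: holp_ext => t _; rewrite /word_curve /power size_nseq nth_nseq.
      by case: ifP.
    apply: (rootfree_aut (es := es0 ++ es) rf n1 (y := kd)).
    rewrite aut_cat; apply: conjpm_trans (or_introl (conjp_sym (freely_homotopic_hol hp hk hpow))) _.
    apply: conjpm_trans (or_introl (conjp_sym ek)) _; left; exact: conjp_aut.
  have [h hh hr] := realises_aut R (es0 ++ es ++ esinv es0); exists h => //.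
  have [kw hkw] := closed_hol (closed_wc w0).
  have [k' kk' hk'] : exists2 k', conjp (aut (es0 ++ es ++ esinv es0) kw) k' & hol (h \o wc w0) k'.
    apply: hr hkw; first exact: (closed_wc w0).1.
    by rewrite -[1]add0r (closed_wc w0).2.
  rewrite image_curve_class //.
  have ch : closed_curve (h \o wc w0) by have [? [? _ _ _]] := hh; exact: closed_curve_comp.
  apply: (curve_class_eq (closed_wc w) ch hk hk'); left.
  apply: conjp_trans (conjp_sym ek) _; apply: conjp_trans (conjp_aut _ hes) _.
  apply: conjp_trans kk'; rewrite !aut_cat; do 2!apply: conjp_aut.
  by have := conjp_aut (esinv es0) (hes0 hkw); rewrite esinvK.
apply: inj_card_eq => i j; rewrite !inE /= => li lj e.
apply: inj => //; apply/word_class_word; rewrite e; exact: word_class_self.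
Qed.

End Orbit.
End Classes.

Local Close Scope ring_scope.
Local Open Scope card_scope.

Theorem proposition3p2 (R : realType) (x : ptorus R) (a b : R -> ptorus R)
    (hab : generating_pair a b x) :
  (forall l : nat,
     orbit_of_length a b [:: la; la; lb; lA; lB] l
       #= `I_(4 * totient (l - 4))%N)
  /\
  (forall l : nat, l <> 2%N -> l <> 4%N ->
     orbit_of_length a b [:: la; lb; la; lB] l
       #= `I_(if odd l then 0 else 2 * totient l./2)%N).
Proof.
have [es hes] := nielsen_hol hab (@homeo_id R); split=> [l|l l2 l4].
  exact: (orbit_card hab hes rootfree1 (counted1 l)).
exact: (orbit_card hab hes rootfree2 (counted2 l2 l4)).
Qed.
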